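(* If $G$ is a finitely generated regular nilpotent group and $H$ is a finitely generated group with $G\equiv H$, then $G\cong H$.
   Context: For a subgroup $N$ of a group $G$, $Is(N)=\{x\in G:\ x^k\in N \text{ for some integer } k\ge1\}$. With $I(G)=Is(G')\cap Z(G)$, an addition of $G$ is a subgroup $G_0\le Z(G)$ with $Z(G)=G_0\times I(G)$, and $G/G_0$ is the associated foundation. A finitely generated nilpotent group $G$ is regular if $G\cong G/G_0\times G_0$ for an addition $G_0$; equivalently $Is(G'\cdot Z(G))=Is(G')\cdot Z(G)$. *)

(* Defs.v *)
From Stdlib Require Import List.

Set Implicit Arguments.

Record Group := {
  carrier :> Type;
  g_op : carrier -> carrier -> carrier;
  g_inv : carrier -> carrier;
  g_one : carrier;
  g_assoc : forall x y z, g_op x (g_op y z) = g_op (g_op x y) z;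
  g_one_l : forall x, g_op g_one x = x;
  g_one_r : forall x, g_op x g_one = x;
  g_inv_l : forall x, g_op (g_inv x) x = g_one;
  g_inv_r : forall x, g_op x (g_inv x) = g_one
}.

Arguments g_op {_}.
Arguments g_inv {_}.
Arguments g_one {_}.

Fixpoint gpow {G : Group} (x : G) (n : nat) : G :=
  match n with 0 => g_one | S n => g_op x (gpow x n) end.

Definition comm {G : Group} (x y : G) : G :=
  g_op (g_op (g_inv x) (g_inv y)) (g_op x y).

Definition is_subgroup {G : Group} (P : G -> Prop) : Prop :=
  P g_one /\ (forall x y, P x -> P y -> P (g_op x y)) /\ (forall x, P x -> P (g_inv x)).

Definition gen {G : Group} (S : G -> Prop) (x : G) : Prop :=
  forall P : G -> Prop, is_subgroup P -> (forall s, S s -> P s) -> P x.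

Definition finitely_generated (G : Group) : Prop :=
  exists l : list G, forall x : G, gen (fun y => In y l) x.

Definition derived (G : Group) : G -> Prop :=
  gen (fun z => exists x y : G, z = comm x y).

Definition center {G : Group} (x : G) : Prop := forall y : G, g_op x y = g_op y x.

Fixpoint lcs (G : Group) (i : nat) : G -> Prop :=
  match i with
  | 0 => fun _ => True
  | S i => gen (fun z => exists x y : G, lcs G i x /\ z = comm x y)
  end.

Definition nilpotent (G : Group) : Prop :=
  exists c : nat, forall x : G, lcs G c x -> x = g_one.

Definition isolator {G : Group} (N : G -> Prop) (x : G) : Prop :=
  exists k : nat, 1 <= k /\ N (gpow x k).

Definition setmul {G : Group} (A B : G -> Prop) (x : G) : Prop :=
  exists a b, A a /\ B b /\ x = g_op a b.

Definition IG (G : Group) (x : G) : Prop := isolator (derived G) x /\ center x.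

Definition addition {G : Group} (G0 : G -> Prop) : Prop :=
  is_subgroup G0 /\ (forall x, G0 x -> center x) /\
  (forall x, G0 x -> IG G x -> x = g_one) /\
  (forall x, center x <-> setmul G0 (IG G) x).

Definition is_hom {G H : Group} (f : G -> H) : Prop :=
  forall x y, f (g_op x y) = g_op (f x) (f y).

Definition isomorphic (G H : Group) : Prop :=
  exists f : G -> H, is_hom f /\ (forall x y, f x = f y -> x = y) /\
                     (forall z, exists x, f x = z).

Section Prod.
Variables G H : Group.
Definition pmul (a b : G * H) : G * H := (g_op (fst a) (fst b), g_op (snd a) (snd b)).
Definition pinv (a : G * H) : G * H := (g_inv (fst a), g_inv (snd a)).
Definition pone : G * H := (g_one, g_one).
Lemma p_assoc x y z : pmul x (pmul y z) = pmul (pmul x y) z.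
Proof. destruct x, y, z; unfold pmul; simpl; rewrite !g_assoc; reflexivity. Qed.
Lemma p_one_l x : pmul pone x = x.
Proof. destruct x; unfold pmul; simpl; rewrite !g_one_l; reflexivity. Qed.
Lemma p_one_r x : pmul x pone = x.
Proof. destruct x; unfold pmul; simpl; rewrite !g_one_r; reflexivity. Qed.
Lemma p_inv_l x : pmul (pinv x) x = pone.
Proof. destruct x; unfold pmul; simpl; rewrite !g_inv_l; reflexivity. Qed.
Lemma p_inv_r x : pmul x (pinv x) = pone.
Proof. destruct x; unfold pmul; simpl; rewrite !g_inv_r; reflexivity. Qed.
Definition prod_group : Group :=
  @Build_Group (G * H) pmul pinv pone p_assoc p_one_l p_one_r p_inv_l p_inv_r.
End Prod.

(* G is regular: G ~= G/G0 x G0 for some addition G0.  The quotient G/G0 is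
   represented (first isomorphism theorem) by a group K with a surjective
   homomorphism pi : G -> K whose kernel is exactly G0; the subgroup G0 is
   represented by a group A embedded in G with image exactly G0. *)
Definition regular (G : Group) : Prop :=
  exists G0 : G -> Prop, addition G0 /\
  exists (K A : Group) (pi : G -> K) (iota : A -> G),
    is_hom pi /\ (forall k, exists x, pi x = k) /\ (forall x, pi x = g_one <-> G0 x) /\
    is_hom iota /\ (forall a b, iota a = iota b -> a = b) /\
    (forall x, G0 x <-> exists a, iota a = x) /\
    isomorphic G (prod_group K A).

Inductive term : Type :=
| tvar : nat -> term
| tone : term
| tmul : term -> term -> term
| tinv : term -> term.

Inductive formula : Type :=
| feq : term -> term -> formula
| fneg : formula -> formula
| fand : formula -> formula -> formula
| for_ : formula -> formula -> formula
| fimp : formula -> formula -> formula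
| fex : formula -> formula
| fall : formula -> formula.

Fixpoint teval {G : Group} (env : nat -> G) (t : term) : G :=
  match t with
  | tvar n => env n
  | tone => g_one
  | tmul a b => g_op (teval env a) (teval env b)
  | tinv a => g_inv (teval env a)
  end.

Definition scons {G : Group} (x : G) (env : nat -> G) (n : nat) : G :=
  match n with 0 => x | S m => env m end.

Fixpoint sat {G : Group} (env : nat -> G) (phi : formula) : Prop :=
  match phi with
  | feq a b => teval env a = teval env b
  | fneg p => ~ sat env p
  | fand p q => sat env p /\ sat env q
  | for_ p q => sat env p \/ sat env q
  | fimp p q => sat env p -> sat env q
  | fex p => exists x : G, sat (scons x env) p
  | fall p => forall x : G, sat (scons x env) p
  end.

Fixpoint tclosed (n : nat) (t : term) : Prop :=
  match t with
  | tvar i => i < n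
  | tone => True
  | tmul a b => tclosed n a /\ tclosed n b
  | tinv a => tclosed n a
  end.

Fixpoint fclosed (n : nat) (phi : formula) : Prop :=
  match phi with
  | feq a b => tclosed n a /\ tclosed n b
  | fneg p => fclosed n p
  | fand p q | for_ p q | fimp p q => fclosed n p /\ fclosed n q
  | fex p | fall p => fclosed (S n) p
  end.

Definition sentence (phi : formula) : Prop := fclosed 0 phi.

(* G |= phi for a sentence phi (the environment is irrelevant) *)
Definition models (G : Group) (phi : formula) : Prop := forall env : nat -> G, sat env phi.

Definition elem_equiv (G H : Group) : Prop :=
  forall phi, sentence phi -> (models G phi <-> models H phi).

(* Main.v *)
Require Import Defs.
From Stdlib Require Import List ZArith Lia Wf_nat Classical ClassicalEpsilon.
From Stdlib Require Import FunctionalExtensionality PropExtensionality Ring Setoid Morphisms.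
From Stdlib Require FinFun.

(* A formula true of a generating tuple of [G] holds for its image under some homomorphism [f : G -> H], because finitely
   many relators of [G] suffice in [H]. Let [Z_i] be the upper central series.

   The central step is to get [H = f(G) Z(H)]. The endomorphisms [e] of [Z_2/Z_1] with [[g, e y] = [lam g, y]] that
   extend compatibly to every [Z_(i+2)/Z_(i+1)] form an interpretable ring containing the integers; let [R(G)] be its
   centre, a commutative ring finitely generated as an abelian group. That given elements span [Z_(i+2)/Z_(i+1)] over
   [R] is first-order, so it is enough that [f] induce a surjection [F : R(G) -> R(H)]. One asks that
   [R(H) = F(R(G)) + q R(H)] and that the nilradical of [R(G)] generate that of [R(H)]. Modulo nilpotents [F] is given
   by roots of fixed monic polynomials, so there are finitely many possible images, and one [q] rules out all the
   proper ones; a Nakayama argument removes the nilpotents.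

   Regularity gives [G = K x A] with [A] free abelian and [Z(K) = I(G)], the latter because [A] is Hopfian. Torsion in
   the centres has bounded exponent, so injectivity of [f] follows from injectivity on [Z(G)] modulo one integer. The
   derived subgroup is definable (finite commutator width), hence [I(H) = f(I(G))] and [H = f(K) x W] for any complement
   [W] of [I(H)] in [Z(H)]; the rank of [W] is read off modulo 2. *)

Set Implicit Arguments.

(** * Groups *)

(* A formula satisfied by a tuple cannot say that the tuple generates. It controls the image of [f]
   only modulo chosen integers, and multiplication by [k] on [Z] passes every test modulo [q] as
   soon as [k] is prime to [q]. A ring with 1 is more rigid: [Z] has a single ring endomorphism, and
   in general integrality leaves finitely many images up to nilpotents. This is why surjectivity is
   first established for scalars and only then for the layers on which they act. The adjoint
   condition [[g, e y] = [lam g, y]] is what allows a scalar to be given by the finite tuple of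
   values of [lam] at the generators, hence to be quantified over. The scalars act on no part of the
   centre, where a direct factor [Z] may still be multiplied by [k]; so [f] is shown to be onto only
   modulo the centre and need not be the isomorphism. The isomorphism is [f] on [K] together with a
   new map from [A] onto [W]. *)
Declare Scope grp_scope.
Delimit Scope grp_scope with grp.
Infix "·" := g_op (at level 40, left associativity) : grp_scope.
Notation "x '⁻¹'" := (g_inv x) (at level 1, left associativity, format "x '⁻¹'") : grp_scope.
Notation "1" := g_one : grp_scope.
Open Scope grp_scope.

Section Group_basics.
Context {X : Group}.
Implicit Types x y z g h : X.

Lemma mulA' x y z : (x · y) · z = x · (y · z).
Proof. symmetry; apply g_assoc. Qed.
Lemma mulVK x y : x⁻¹ · (x · y) = y.
Proof. now rewrite g_assoc, g_inv_l, g_one_l. Qed.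
Lemma mulKV x y : x · (x⁻¹ · y) = y.
Proof. now rewrite g_assoc, g_inv_r, g_one_l. Qed.
Lemma mul_cancel_l x y z : x · y = x · z -> y = z.
Proof. intros H; rewrite <- (mulVK x y), H; apply mulVK. Qed.
Lemma inv_unique x y : x · y = 1 -> y = x⁻¹.
Proof. intros H; apply (mul_cancel_l x); now rewrite H, g_inv_r. Qed.
Lemma invM x y : (x · y)⁻¹ = y⁻¹ · x⁻¹.
Proof.
symmetry; apply inv_unique.
now rewrite mulA', mulKV, g_inv_r.
Qed.
Lemma invK x : (x⁻¹)⁻¹ = x.
Proof. symmetry; apply inv_unique, g_inv_l. Qed.
Lemma inv1 : (1 : X)⁻¹ = 1.
Proof. symmetry; apply inv_unique, g_one_l. Qed.
End Group_basics.

Ltac grp := unfold comm; repeat progress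
  (rewrite ?invM, ?invK, ?inv1, ?mulA', ?mulVK, ?mulKV, ?g_inv_l, ?g_inv_r, ?g_one_l, ?g_one_r);
  try reflexivity.
Ltac grp_in H := unfold comm in H; repeat progress
  (rewrite ?invM, ?invK, ?inv1, ?mulA', ?mulVK, ?mulKV, ?g_inv_l, ?g_inv_r, ?g_one_l, ?g_one_r in H).

Lemma eq_of_div {X : Group} (x y : X) : x⁻¹ · y = 1 -> y = x.
Proof. intros H; rewrite <- (mulKV x y), H; apply g_one_r. Qed.

Section Subgroups.
Context {X : Group}.
Implicit Types (x y z g h : X) (P Q N M : X -> Prop).

Lemma sub1 P : is_subgroup P -> P 1. Proof. intros H; apply H. Qed.
Lemma subM P x y : is_subgroup P -> P x -> P y -> P (x · y).
Proof. intros H; apply H. Qed.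
Lemma subV P x : is_subgroup P -> P x -> P x⁻¹.
Proof. intros H; apply H. Qed.
Lemma subV' P x : is_subgroup P -> P x⁻¹ -> P x.
Proof. intros H K; rewrite <- (invK x); now apply subV. Qed.
Lemma subDl P x y : is_subgroup P -> P x -> P (x · y) -> P y.
Proof. intros H K L; rewrite <- (mulVK x y); apply subM; auto; now apply subV. Qed.
Lemma gen_subgroup (S : X -> Prop) : is_subgroup (gen S).
Proof.
split; [|split].
- intros P HP _; now apply sub1.
- intros x y Hx Hy P HP HS; apply subM; [|apply Hx|apply Hy]; auto.
- intros x Hx P HP HS; apply subV; [|apply Hx]; auto.
Qed.
Lemma gen_incl (S : X -> Prop) x : S x -> gen S x.
Proof. intros H P _ HS; auto. Qed.
Lemma gen_min (S P : X -> Prop) : is_subgroup P -> (forall s, S s -> P s) -> forall x, gen S x -> P x.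
Proof. intros HP HS x Hx; apply Hx; auto. Qed.
Lemma gen_mono (S T : X -> Prop) : (forall s, S s -> T s) -> forall x, gen S x -> gen T x.
Proof. intros HS; apply gen_min; [apply gen_subgroup|]; intros; apply gen_incl; auto. Qed.

Lemma subI P Q : is_subgroup P -> is_subgroup Q -> is_subgroup (fun x => P x /\ Q x).
Proof. firstorder. Qed.
Lemma subT : is_subgroup (fun _ : X => True).
Proof. firstorder. Qed.
Lemma sub_triv : is_subgroup (fun x => x = 1).
Proof.
split; [|split]; auto.
- intros x y -> ->; grp.
- intros x ->; grp.
Qed.

Lemma gpow_comm x n : x · gpow x n = gpow x n · x.
Proof. induction n; simpl; [grp|]. now rewrite IHn, g_assoc, <- IHn. Qed.
Lemma gpow_add x n m : gpow x (n + m) = gpow x n · gpow x m.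
Proof. induction n; simpl; [grp|]; now rewrite IHn, g_assoc. Qed.
Lemma gpow_mul x n m : gpow x (n * m) = gpow (gpow x m) n.
Proof. induction n; simpl; auto; now rewrite gpow_add, IHn. Qed.
Lemma gpow_1 n : gpow (1 : X) n = 1.
Proof. induction n; simpl; auto; rewrite IHn; grp. Qed.
Lemma gpow_comm2 x y n : x · y = y · x -> x · gpow y n = gpow y n · x.
Proof.
intros H; induction n; simpl; [grp|].
now rewrite g_assoc, H, mulA', IHn, g_assoc.
Qed.
Lemma gpow_mulc x y n : x · y = y · x -> gpow (x · y) n = gpow x n · gpow y n.
Proof.
intros H; induction n; simpl; [grp|].
rewrite IHn, !mulA'; f_equal; rewrite <- !mulA'; f_equal.
now apply gpow_comm2.
Qed.
Lemma gpow_inv x n : gpow x⁻¹ n = (gpow x n)⁻¹.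
Proof.
induction n; simpl; [grp|].
now rewrite IHn, gpow_comm, invM.
Qed.
Lemma sub_gpow P x n : is_subgroup P -> P x -> P (gpow x n).
Proof. intros H K; induction n; simpl; [now apply sub1|now apply subM]. Qed.

Definition zpow x (k : Z) : X :=
  match k with Z0 => 1 | Zpos p => gpow x (Pos.to_nat p) | Zneg p => (gpow x (Pos.to_nat p))⁻¹ end.
Lemma zpow_nat x n : zpow x (Z.of_nat n) = gpow x n.
Proof. destruct n; simpl; auto; rewrite SuccNat2Pos.id_succ; auto. Qed.
Lemma zpow_natN x n : zpow x (- Z.of_nat n) = (gpow x n)⁻¹.
Proof. destruct n; simpl; [grp|rewrite SuccNat2Pos.id_succ; auto]. Qed.
Lemma zpow_opp x k : zpow x (- k) = (zpow x k)⁻¹.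
Proof. destruct k; simpl; auto; [now rewrite inv1|now rewrite invK]. Qed.
Lemma zpow_succ x k : zpow x (Z.succ k) = x · zpow x k.
Proof.
destruct (Z_le_dec 0 k) as [H|H].
- rewrite <- (Z2Nat.id k H), <- Nat2Z.inj_succ, !zpow_nat; reflexivity.
- assert (E : k = (- Z.of_nat (S (Z.to_nat (- Z.succ k))))%Z) by lia.
  rewrite E, zpow_natN.
  replace (Z.succ (- Z.of_nat (S (Z.to_nat (- Z.succ k)))))
    with (- Z.of_nat (Z.to_nat (- Z.succ k)))%Z by lia.
  rewrite zpow_natN; simpl; rewrite gpow_comm; grp.
Qed.
Lemma zpow_add x k l : zpow x (k + l) = zpow x k · zpow x l.
Proof.
revert k; apply Z.bi_induction; [intros ? ? ->; reflexivity|simpl; grp|].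
intros k; rewrite Z.add_succ_l, !zpow_succ, mulA'; split; [now intros ->|].
apply mul_cancel_l.
Qed.
Lemma zpow_mul x k l : zpow x (k * l) = zpow (zpow x l) k.
Proof.
revert k; apply Z.bi_induction; [intros ? ? ->; reflexivity|reflexivity|].
intros k; rewrite Z.mul_succ_l, Z.add_comm, zpow_add, zpow_succ; split; [now intros ->|].
apply mul_cancel_l.
Qed.
Lemma zpow_1r x : zpow x 1 = x.
Proof. simpl; grp. Qed.
Lemma zpow_1l k : zpow (1 : X) k = 1.
Proof. destruct k; simpl; rewrite ?gpow_1, ?inv1; auto. Qed.
Lemma zpow_mulc x y k : x · y = y · x -> zpow (x · y) k = zpow x k · zpow y k.
Proof.
intros H; destruct k; simpl; [grp|now apply gpow_mulc|].
rewrite gpow_mulc by auto; rewrite invM, <- !gpow_inv.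
symmetry; rewrite <- !gpow_mulc; [f_equal| |].
all: rewrite <- !invM; now rewrite H.
Qed.
Lemma sub_zpow P x k : is_subgroup P -> P x -> P (zpow x k).
Proof.
intros H K; destruct k; simpl; [now apply sub1|now apply sub_gpow|].
apply subV; auto; now apply sub_gpow.
Qed.
End Subgroups.

Section Homs.
Context {X Y : Group} (f : X -> Y) (Hf : is_hom f).
Lemma hom1 : f 1 = 1.
Proof. apply (mul_cancel_l (f 1)); rewrite <- Hf, g_one_l; grp. Qed.
Lemma homV x : f x⁻¹ = (f x)⁻¹.
Proof. apply inv_unique; rewrite <- Hf, g_inv_r; apply hom1. Qed.
Lemma homC x y : f (comm x y) = comm (f x) (f y).
Proof. unfold comm; now rewrite !Hf, !homV. Qed.
Lemma hom_gpow x n : f (gpow x n) = gpow (f x) n.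
Proof. induction n; simpl; [apply hom1|now rewrite Hf, IHn]. Qed.
Lemma hom_zpow x k : f (zpow x k) = zpow (f x) k.
Proof. destruct k; simpl; [apply hom1|apply hom_gpow|now rewrite homV, hom_gpow]. Qed.
Lemma hom_preim (P : Y -> Prop) : is_subgroup P -> is_subgroup (fun x => P (f x)).
Proof.
intros H; split; [|split].
- rewrite hom1; now apply sub1.
- intros; rewrite Hf; now apply subM.
- intros; rewrite homV; now apply subV.
Qed.
Lemma hom_inj : (forall x, f x = 1 -> x = 1) -> forall x y, f x = f y -> x = y.
Proof.
intros H x y E; symmetry; apply eq_of_div, H; rewrite Hf, homV, E; grp.
Qed.
End Homs.

(** * Noetherian nilpotent groups *)

Definition fg_sub {X : Group} (Q : X -> Prop) : Prop :=
  exists l : list X, forall x, Q x <-> gen (fun y => In y l) x.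

(** Stated for a subset of a group, so that a subgroup needs no group type of its own. *)
Definition noeth {X : Group} (M : X -> Prop) : Prop :=
  forall Q : X -> Prop, is_subgroup Q -> (forall x, Q x -> M x) -> fg_sub Q.

Lemma noeth_mono {X : Group} (M N : X -> Prop) :
  noeth M -> (forall x, N x -> M x) -> noeth N.
Proof. intros H K Q HQ HQN; apply H; auto. Qed.

Arguments noeth_mono {X M N}.

Lemma chain_le {X : Group} (S : nat -> X -> Prop) :
  (forall n x, S n x -> S (Datatypes.S n) x) -> forall n m x, n <= m -> S n x -> S m x.
Proof. intros H n m x Hle; induction Hle; auto. Qed.

(** The union of the chain is finitely generated, and its finitely many generators already lie in
    one member. *)
Lemma chain_stab {X : Group} (M : X -> Prop) (S : nat -> X -> Prop) :
  noeth M -> (forall n, is_subgroup (S n)) -> (forall n x, S n x -> M x) ->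
  (forall n x, S n x -> S (Datatypes.S n) x) ->
  exists n, forall m x, S m x -> S n x.
Proof.
intros HM HS HSM Hinc.
pose proof (chain_le S Hinc) as Hle.
destruct (HM (fun x => exists n, S n x)) as [l Hl].
- split; [|split].
  + exists 0; now apply sub1.
  + intros x y [n Hn] [m Hm]; exists (n + m); apply subM; auto.
    * now apply (Hle n); [lia|].
    * now apply (Hle m); [lia|].
  + intros x [n Hn]; exists n; now apply subV.
- intros x [n Hn]; eauto.
- assert (E : exists n, forall x, In x l -> S n x).
  { assert (E : forall x, In x l -> exists n, S n x) by
      (intros x Hx; apply Hl; now apply gen_incl).
    clear Hl; induction l as [|a l IH].
    - exists 0; intros x [].
    - destruct IH as [n Hn]; [intros; apply E; now right|].
      destruct (E a) as [m Hm]; [now left|].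
      exists (n + m); intros x [<-|Hx].
      + now apply (Hle m); [lia|].
      + apply (Hle n); [lia|auto]. }
  destruct E as [n Hn]; exists n; intros m x Hx.
  apply (gen_min (S := fun y => In y l)); auto.
  apply Hl; eauto.
Qed.

(** Induction from larger subgroups down to smaller ones: by choice, a failure would start a
    strictly ascending chain inside [M]. *)
Lemma noeth_ind {X : Group} (M : X -> Prop) (A : (X -> Prop) -> Prop) :
  noeth M ->
  (forall S, is_subgroup S -> (forall x, S x -> M x) ->
     (forall S', is_subgroup S' -> (forall x, S' x -> M x) -> (forall x, S x -> S' x) ->
        (exists x, S' x /\ ~ S x) -> A S') -> A S) ->
  forall S, is_subgroup S -> (forall x, S x -> M x) -> A S.
Proof.
intros HM step S0 HS0 HSM0.
apply NNPP; intros HA.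
set (good := fun S : X -> Prop => is_subgroup S /\ (forall x, S x -> M x) /\ ~ A S).
assert (next : forall S : {S | good S}, exists S' : {S | good S},
  (forall x, proj1_sig S x -> proj1_sig S' x) /\ exists x, proj1_sig S' x /\ ~ proj1_sig S x).
{ intros [S (H1 & H2 & H3)]; simpl; apply NNPP; intros H; apply H3, step; auto.
  intros S' H1' H2' Hi Hx; apply NNPP; intros H3'; apply H.
  exists (exist _ S' (conj H1' (conj H2' H3'))); auto. }
apply choice in next; destruct next as [nx Hnx].
pose (T := fun n : nat => Nat.iter n nx (exist _ S0 (conj HS0 (conj HSM0 HA)))).
destruct (@chain_stab X M (fun n => proj1_sig (T n)) HM) as [n Hn].
- intros n; exact (proj1 (proj2_sig (T n))).
- intros n; exact (proj1 (proj2 (proj2_sig (T n)))).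
- intros n; exact (proj1 (Hnx (T n))).
- destruct (proj2 (Hnx (T n))) as [x [H1 H2]]; apply H2, (Hn (Datatypes.S n)), H1.
Qed.

(* [psi] is the graph of a homomorphism from a subgroup of [M] onto [N]. *)
Lemma noeth_image {X Y : Group} (M : X -> Prop) (N : Y -> Prop) (psi : X -> Y -> Prop) :
  noeth M -> is_subgroup N ->
  (forall x y x' y', psi x y -> psi x' y' -> psi (x · x') (y · y')) ->
  (forall x y, psi x y -> psi x⁻¹ y⁻¹) ->
  (forall x y, psi x y -> M x) ->
  (forall y, psi 1 y -> y = 1) ->
  (forall y, N y -> exists x, psi x y) ->
  noeth N.
Proof.
intros HM HN Hop Hinv HpM Hfun Hsurj Q HQ HQN.
assert (H1 : psi 1 1).
{ destruct (Hsurj 1 (sub1 HN)) as [x Hx].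
  generalize (Hop _ _ _ _ Hx (Hinv _ _ Hx)); now rewrite !g_inv_r. }
destruct (HM (fun x => exists y, Q y /\ psi x y)) as [l Hl].
- split; [|split].
  + exists 1; split; auto; now apply sub1.
  + intros x x' (y & Hy & Hp) (y' & Hy' & Hp'); exists (y · y'); split; auto; now apply subM.
  + intros x (y & Hy & Hp); exists y⁻¹; split; auto; now apply subV.
- intros x (y & Hy & Hp); eauto.
- assert (E : forall x, exists y, In x l -> Q y /\ psi x y).
  { intros x; destruct (classic (In x l)) as [Hx|Hx].
    - destruct (proj2 (Hl x)) as (y & Hy); [now apply gen_incl|eauto].
    - exists 1; tauto. }
  apply choice in E; destruct E as [g Hg].
  exists (map g l); intros y; split.
  + intros Hy; destruct (Hsurj y) as [x Hx]; auto.
    assert (Hxl : gen (fun z => In z l) x) by (apply Hl; eauto).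
    assert (exists y', psi x y' /\ gen (fun z => In z (map g l)) y') as (y' & Hp & Hy').
    { revert Hxl; apply (@gen_min _ _ (fun x => exists y', psi x y' /\ gen (fun z => In z (map g l)) y')).
      - split; [|split].
        + exists 1; split; auto; apply sub1, gen_subgroup.
        + intros a b (a' & Ha & Ha') (b' & Hb & Hb'); exists (a' · b'); split; auto.
          apply subM; auto; apply gen_subgroup.
        + intros a (a' & Ha & Ha'); exists a'⁻¹; split; auto; apply subV; auto; apply gen_subgroup.
      - intros s Hs; exists (g s); split; [now apply Hg|].
        apply gen_incl, in_map, Hs. }
    enough (y' = y) by (now subst y').
    apply eq_of_div, Hfun.
    replace (1 : X) with (x⁻¹ · x) by grp; auto.
  + apply gen_min; auto; intros s Hs; apply in_map_iff in Hs.
    destruct Hs as (x & <- & Hx); now apply Hg.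
Qed.

(** * The upper central series *)

Section Upper_central.
Variable X : Group.
Implicit Types x y z g h : X.

(** Recursion through commutators instead of quotients makes every term first-order ([def_ucs]). *)
Fixpoint ucs (i : nat) (z : X) : Prop :=
  match i with 0 => z = 1 | S i => forall g, ucs i (comm g z) end.

(** The two claims need a joint induction: [comm g (x · y)] is [comm g y] times a conjugate of
    [comm g x]. *)
Lemma ucs_sub_norm i : is_subgroup (ucs i) /\ forall g z, ucs i z -> ucs i (g⁻¹ · z · g).
Proof.
induction i as [|i [IHs IHn]]; simpl.
- split; [apply sub_triv|intros g z ->; grp].
- split; [split; [|split]|].
  + intros g; replace (comm g 1) with (1 : X) by grp; now apply sub1.
  + intros x y Hx Hy g.
    replace (comm g (x · y)) with (comm g y · (y⁻¹ · comm g x · y)) by grp.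
    apply subM; auto.
  + intros x Hx g.
    replace (comm g x⁻¹) with (x⁻¹⁻¹ · (comm g x)⁻¹ · x⁻¹) by grp.
    apply IHn; now apply subV.
  + intros h z Hz g.
    replace (comm g (h⁻¹ · z · h)) with (h⁻¹ · comm (h · g · h⁻¹) z · h) by grp.
    auto.
Qed.
Lemma ucs_sub i : is_subgroup (ucs i). Proof. apply ucs_sub_norm. Qed.
Lemma ucs_norm i g z : ucs i z -> ucs i (g⁻¹ · z · g). Proof. apply ucs_sub_norm. Qed.
Lemma ucs_S i z : ucs i z -> ucs (S i) z.
Proof.
intros H g; replace (comm g z) with ((g⁻¹ · z · g)⁻¹ · z) by grp.
apply subM; auto using ucs_sub; apply subV; auto using ucs_sub, ucs_norm.
Qed.
Lemma ucs_le i j z : i <= j -> ucs i z -> ucs j z.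
Proof. intros Hle; induction Hle; auto; intros; apply ucs_S; auto. Qed.
Lemma ucs_commr i z g : ucs (S i) z -> ucs i (comm z g).
Proof.
intros H; replace (comm z g) with (comm g z)⁻¹ by grp; apply subV; auto using ucs_sub.
Qed.
Lemma ucs_1 z : ucs 1 z <-> center z.
Proof.
split; intros H g.
- specialize (H g); simpl in H; unfold comm in H; grp_in H.
  apply (mul_cancel_l (z⁻¹)), (mul_cancel_l g⁻¹); now grp.
- simpl; unfold comm; rewrite <- (H g); grp.
Qed.
End Upper_central.
Arguments ucs {X}.

Lemma center_sub (X : Group) : is_subgroup (@center X).
Proof.
generalize (ucs_sub X 1); intros (H1 & H2 & H3); split; [|split].
- now apply ucs_1.
- intros x y Hx Hy; apply ucs_1, H2; now apply ucs_1.
- intros x Hx; apply ucs_1, H3; now apply ucs_1.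
Qed.

(** The generator is the least positive element, found as the least [n] with [S n] in [D]; division
    with remainder does the rest. *)
Lemma Z_subgroup (D : Z -> Prop) :
  D 0%Z -> (forall a b, D a -> D b -> D (a + b)%Z) -> (forall a, D a -> D (- a)%Z) ->
  exists d, D d /\ forall a, D a -> exists k, a = (k * d)%Z.
Proof.
intros H0 Hadd Hopp.
destruct (classic (exists a, D a /\ a <> 0%Z)) as [(a & Ha & Hn)|H].
- destruct (dec_inh_nat_subset_has_unique_least_element (fun n => D (Z.of_nat (S n)))) as (n & (Hd & Hmin) & _).
  { intros n; apply classic. }
  { exists (Z.abs_nat a - 1); replace (Z.of_nat _) with (Z.abs a) by lia.
    destruct (Z.abs_eq_or_opp a) as [->| ->]; auto. }
  exists (Z.of_nat (S n)); split; auto.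
  assert (Hmul : forall k, D (k * Z.of_nat (S n))%Z).
  { apply Z.bi_induction; [intros ? ? ->; reflexivity|now simpl|].
    intros k; rewrite Z.mul_succ_l; split; intros; [auto|].
    replace (k * Z.of_nat (S n))%Z with ((k * Z.of_nat (S n) + Z.of_nat (S n)) + - Z.of_nat (S n))%Z by lia.
    auto. }
  intros b Hb; exists (b / Z.of_nat (S n))%Z.
  pose proof (Z.div_mod b (Z.of_nat (S n)) ltac:(lia)) as E.
  pose proof (Z.mod_pos_bound b (Z.of_nat (S n)) ltac:(lia)) as B.
  destruct (Z.eq_dec (b mod Z.of_nat (S n)) 0) as [E0|E0]; [lia|exfalso].
  assert (Hr : D (Z.of_nat (S (Z.to_nat (b mod Z.of_nat (S n) - 1))))).
  { replace (Z.of_nat _) with (b + - ((b / Z.of_nat (S n)) * Z.of_nat (S n)))%Z by lia; auto. }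
  apply Hmin in Hr; lia.
- exists 0%Z; split; auto; intros a Ha; exists 0%Z.
  destruct (Z.eq_dec a 0); [lia|exfalso; eauto].
Qed.

Section Cyclic_extension.
Variable X : Group.
Variables (N : X -> Prop) (a : X).
Hypotheses (HN : is_subgroup N) (Ha : forall n, N n -> N (a⁻¹ · n · a) /\ N (a · n · a⁻¹)).

(** A relation and not a function of [x]: the exponent [k] is determined only up to the order of [a]
    modulo [N]. *)
Definition cyc_coset (k : Z) (x : X) : Prop := exists n, N n /\ x = zpow a k · n.

Lemma cyc_coset_op k l x y : cyc_coset k x -> cyc_coset l y -> cyc_coset (k + l) (x · y).
Proof.
assert (C : forall n, N n -> forall l, N ((zpow a l)⁻¹ · n · zpow a l)).
{ intros n Hn; apply Z.bi_induction; [intros ? ? ->; reflexivity|simpl; now grp|].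
  intros l'; replace (Z.succ l') with (l' + 1)%Z by lia.
  rewrite zpow_add, zpow_1r.
  replace ((zpow a l' · a)⁻¹ · n · (zpow a l' · a)) with (a⁻¹ · ((zpow a l')⁻¹ · n · zpow a l') · a) by grp.
  split; intros H; [now apply Ha|].
  apply Ha in H; now grp_in H; grp. }
intros (n & Hn & ->) (m & Hm & ->); exists (((zpow a l)⁻¹ · n · zpow a l) · m); split.
- apply subM; auto.
- rewrite zpow_add; grp.
Qed.

Lemma cyc_coset_inv k x : cyc_coset k x -> cyc_coset (- k) x⁻¹.
Proof.
intros (n & Hn & ->); rewrite invM, <- zpow_opp.
change (- k)%Z with (0 + - k)%Z; apply cyc_coset_op.
- exists n⁻¹; split; [now apply subV|simpl; grp].
- exists 1; split; [now apply sub1|grp].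
Qed.

Lemma cyc_coset_0 x : cyc_coset 0 x <-> N x.
Proof.
split; [intros (n & Hn & ->); simpl; now grp|intros H; exists x; simpl; split; auto; grp].
Qed.

Lemma cyc_coset_pow k x l : cyc_coset k x -> cyc_coset (l * k) (zpow x l).
Proof.
intros H; revert l; apply Z.bi_induction; [intros ? ? ->; reflexivity| |].
- apply cyc_coset_0; simpl; now apply sub1.
- intros l; rewrite Z.mul_succ_l, zpow_succ; split; intros K.
  + rewrite Z.add_comm; now apply cyc_coset_op.
  + replace (l * k)%Z with (- k + (l * k + k))%Z by lia.
    replace (zpow x l) with (x⁻¹ · (x · zpow x l)) by grp.
    apply cyc_coset_op; auto; now apply cyc_coset_inv.
Qed.

Lemma cyc_ext_sub : is_subgroup (fun x => exists k, cyc_coset k x).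
Proof.
split; [|split].
- exists 0%Z; apply cyc_coset_0; now apply sub1.
- intros x y [k Hk] [l Hl]; exists (k + l)%Z; now apply cyc_coset_op.
- intros x [k Hk]; exists (- k)%Z; now apply cyc_coset_inv.
Qed.

(** The exponents occurring in [Q] form a group [d Z]. One element [q] of [Q] with exponent [d],
    together with generators of the intersection of [Q] and [N], generates [Q]. *)
Lemma noeth_cyc_ext : noeth N -> noeth (fun x => exists k, cyc_coset k x).
Proof.
intros HNn Q HQ HQM.
destruct (Z_subgroup (fun k => exists x, Q x /\ cyc_coset k x)) as (d & (q & Hq & Hqd) & Hd).
- exists 1; split; [now apply sub1|apply cyc_coset_0; now apply sub1].
- intros k l (x & Hx & Hk) (y & Hy & Hl); exists (x · y); split; [now apply subM|now apply cyc_coset_op].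
- intros k (x & Hx & Hk); exists x⁻¹; split; [now apply subV|now apply cyc_coset_inv].
- destruct (HNn (fun x => Q x /\ N x)) as [l Hl]; [now apply subI|tauto|].
  exists (q :: l); intros x; split.
  + intros Hx; destruct (HQM x Hx) as [k Hk].
    destruct (Hd k) as [j ->]; [eauto|].
    pose proof (cyc_coset_pow j Hqd) as Hj.
    assert (Hz : Q ((zpow q j)⁻¹ · x) /\ N ((zpow q j)⁻¹ · x)).
    { split; [apply subM; auto; apply subV; auto; now apply sub_zpow|].
      apply cyc_coset_0; replace 0%Z with (- (j * d) + j * d)%Z by lia.
      apply cyc_coset_op; auto; now apply cyc_coset_inv. }
    apply Hl in Hz; rewrite <- (mulKV (zpow q j) x).
    apply subM; [apply gen_subgroup| |].
    * apply sub_zpow; [apply gen_subgroup|apply gen_incl; now left].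
    * revert Hz; apply gen_mono; intros; now right.
  + apply gen_min; auto; intros s [<-|Hs]; auto.
    apply (Hl s); now apply gen_incl.
Qed.
End Cyclic_extension.

(** * Finitely generated nilpotent groups are noetherian *)

Section Nilpotent_noeth.
Variables (X : Group) (c : nat) (Hc : forall x : X, ucs c x) (l : list X).

(** Simple commutators of weight [i + 1] in the generators. By [iter_comms_ucs] those with [i = c]
    are trivial. *)
Fixpoint iter_comms (i : nat) : list X :=
  match i with
  | 0 => l
  | S i => flat_map (fun a => map (fun b => comm b a) l) (iter_comms i)
  end.

Lemma iter_comms_ucs i x : In x (iter_comms i) -> ucs (c - i) x.
Proof.
revert x; induction i as [|i IH]; intros x Hx; [apply (@ucs_le X c); [lia|auto]|].
simpl in Hx; apply in_flat_map in Hx; destruct Hx as (a & Ha & Hx).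
apply in_map_iff in Hx; destruct Hx as (b & <- & Hb).
apply IH in Ha; destruct (c - i) as [|j] eqn:E.
- simpl in Ha; subst a; replace (comm b 1) with (1 : X) by grp; apply sub1, ucs_sub.
- replace (c - S i) with j by lia; apply Ha.
Qed.

Let M := gen (fun x => In x l).
(** Plays the part of the lower central series of [M]: [T 0] contains the generators, [T c] is
    trivial, and by [T_central] the new generators of each term are central modulo the next one. *)
Let T i := gen (fun x => exists j, i <= j /\ In x (iter_comms j)).
Let normd (N : X -> Prop) g := forall x, N x -> N (g⁻¹ · x · g) /\ N (g · x · g⁻¹).

Lemma normd_sub N : is_subgroup (normd N).
Proof.
split; [|split].
- intros x Hx; grp; auto.
- intros g h Hg Hh x Hx; split.
  + replace ((g · h)⁻¹ · x · (g · h)) with (h⁻¹ · (g⁻¹ · x · g) · h) by grp.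
    apply Hh, Hg, Hx.
  + replace (g · h · x · (g · h)⁻¹) with (g · (h · x · h⁻¹) · g⁻¹) by grp.
    apply Hg, Hh, Hx.
- intros g Hg x Hx; rewrite invK; split; apply Hg, Hx.
Qed.

Lemma normd_gen (S : X -> Prop) g :
  (forall s, S s -> gen S (g⁻¹ · s · g) /\ gen S (g · s · g⁻¹)) -> normd (gen S) g.
Proof.
intros H x Hx; split; revert x Hx.
- apply gen_min; [|firstorder].
  apply (hom_preim (f := fun x : X => g⁻¹ · x · g)); [intros x y; grp|apply gen_subgroup].
- apply gen_min; [|firstorder].
  apply (hom_preim (f := fun x : X => g · x · g⁻¹)); [intros x y; grp|apply gen_subgroup].
Qed.

Lemma iter_comms_gen i x : In x (iter_comms i) -> M x.
Proof.
assert (HM : is_subgroup M) by apply gen_subgroup.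
revert x; induction i as [|i IH]; intros x Hx; [now apply gen_incl|].
simpl in Hx; apply in_flat_map in Hx; destruct Hx as (a & Ha & Hx).
apply in_map_iff in Hx; destruct Hx as (b & <- & Hb).
assert (M a) by auto. assert (M b) by now apply gen_incl.
unfold comm; repeat apply subM; auto; apply subV; auto.
Qed.

Lemma T_S i x : T (S i) x -> T i x.
Proof. apply gen_mono; intros s (j & Hj & Hs); exists j; split; [lia|auto]. Qed.

Lemma T_comm i x b : In x (iter_comms i) -> In b l -> T (S i) (comm b x).
Proof.
intros Hx Hb; apply gen_incl; exists (S i); split; auto.
simpl; apply in_flat_map; exists x; split; auto; apply in_map_iff; eauto.
Qed.

(** [b⁻¹ · x · b] is [x] times the inverse of [comm b x], which lies one step deeper; the induction
    therefore starts at the trivial end of the series. *)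
Lemma T_normd_step i : (forall g, M g -> normd (T (S i)) g) -> forall g, M g -> normd (T i) g.
Proof.
intros H g Hg; revert g Hg; apply gen_min; [apply normd_sub|].
intros b Hb; apply normd_gen; intros x (j & Hj & Hx).
assert (Hxi : T i x) by (apply gen_incl; eauto).
assert (Hc' : T (S i) (comm b x)).
{ apply gen_incl; exists (S j); split; [lia|].
  simpl; apply in_flat_map; exists x; split; auto; apply in_map_iff; eauto. }
assert (HT : is_subgroup (T i)) by apply gen_subgroup.
change (T i (b⁻¹ · x · b) /\ T i (b · x · b⁻¹)); split.
- replace (b⁻¹ · x · b) with (x · (comm b x)⁻¹) by grp.
  apply subM; auto; apply subV; auto; now apply T_S.
- replace (b · x · b⁻¹) with (x · (b · comm b x · b⁻¹)) by grp.
  apply subM; auto; apply T_S, H; auto; now apply gen_incl.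
Qed.

Lemma T_central i x g : (forall g, M g -> normd (T (S i)) g) ->
  In x (iter_comms i) -> M g -> T (S i) (comm g x).
Proof.
intros H Hx Hg.
assert (HT : is_subgroup (T (S i))) by apply gen_subgroup.
enough (K : M g /\ T (S i) (comm g x)) by apply K.
revert g Hg; apply gen_min; [split; [|split]|].
- split; [apply sub1, gen_subgroup|replace (comm 1 x) with (1 : X) by grp; now apply sub1].
- intros g h [Hg Kg] [Hh Kh]; split; [apply subM; auto; apply gen_subgroup|].
  replace (comm (g · h) x) with ((h⁻¹ · comm g x · h) · comm h x) by (grp).
  apply subM; auto; now apply H.
- intros g [Hg Kg]; split; [apply subV; auto; apply gen_subgroup|].
  replace (comm g⁻¹ x) with (g · (comm g x)⁻¹ · g⁻¹) by grp.
  apply H; auto; now apply subV.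
- intros s Hs; split; [now apply gen_incl|now apply T_comm].
Qed.

(** The commutators of weight [i + 1] are adjoined to [T (S i)] one at a time. Each normalizes what
    precedes it, because the commutators that arise fall into [T (S i)]; so this is a tower of
    cyclic extensions. *)
Lemma T_noeth_step i : (forall g, M g -> normd (T (S i)) g) -> noeth (T (S i)) -> noeth (T i).
Proof.
intros Hn HT.
assert (E : forall p, (forall x, In x p -> In x (iter_comms i)) ->
  noeth (gen (fun x => In x p \/ T (S i) x))).
{ induction p as [|a p IH]; intros Hp.
  - apply (noeth_mono HT); apply gen_min; [apply gen_subgroup|intros s [[]|]; auto].
  - assert (Hsub : is_subgroup (gen (fun x => In x p \/ T (S i) x))) by apply gen_subgroup.
    assert (HMa : M a) by (apply (iter_comms_gen i), Hp; now left).
    assert (Hnorm : normd (gen (fun x => In x p \/ T (S i) x)) a).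
    { apply normd_gen; intros s [Hs|Hs].
      - assert (Hsp : gen (fun x => In x p \/ T (S i) x) s) by (apply gen_incl; now left).
        assert (K : T (S i) (comm a s)) by (apply T_central; auto; apply Hp; now right).
        split.
        + replace (a⁻¹ · s · a) with (s · (comm a s)⁻¹) by grp.
          apply subM; auto; apply subV; auto; apply gen_incl; now right.
        + replace (a · s · a⁻¹) with (s · (a · comm a s · a⁻¹)) by grp.
          apply subM; auto; apply gen_incl; right; now apply Hn.
      - split; apply gen_incl; right; now apply Hn. }
    assert (IH' : noeth (gen (fun x => In x p \/ T (S i) x))) by (apply IH; intros; apply Hp; now right).
    apply (noeth_mono (noeth_cyc_ext Hsub Hnorm IH')).
    apply gen_min; [now apply cyc_ext_sub|].
    intros s [[<-|Hs]|Hs].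
    + exists 1%Z, 1; split; [now apply sub1|rewrite zpow_1r; grp].
    + exists 0%Z; apply cyc_coset_0, gen_incl; now left.
    + exists 0%Z; apply cyc_coset_0, gen_incl; now right. }
apply (noeth_mono (E _ (fun x H => H))).
apply gen_min; [apply gen_subgroup|].
intros s (j & Hj & Hs); apply gen_incl.
destruct (Nat.eq_dec i j) as [->|Hne]; [now left|right].
apply gen_incl; exists j; split; [lia|auto].
Qed.

Theorem nilpotent_noeth : noeth (gen (fun x => In x l)).
Proof.
assert (E : forall k, k <= c -> (forall g, M g -> normd (T (c - k)) g) /\ noeth (T (c - k))).
{ induction k as [|k IH]; intros Hk.
  - assert (HT : forall x, T (c - 0) x -> x = 1).
    { apply gen_min; [apply sub_triv|].
      intros s (j & Hj & Hs); apply iter_comms_ucs in Hs.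
      replace (c - j) with 0 in Hs by lia; exact Hs. }
    split.
    + intros g _ x Hx; apply HT in Hx; subst x.
      split; replace (_ : X) with (1 : X) by grp; apply sub1, gen_subgroup.
    + intros Q HQ HQT; exists nil; intros x; split.
      * intros Hx; rewrite (HT x (HQT x Hx)); apply sub1, gen_subgroup.
      * apply gen_min; auto; intros s [].
  - destruct IH as [IH1 IH2]; [lia|].
    replace (c - k) with (S (c - S k)) in IH1, IH2 by lia.
    split; [now apply T_normd_step|now apply T_noeth_step]. }
destruct (E c) as [_ H]; [lia|].
apply (noeth_mono H); apply gen_mono.
intros s Hs; exists 0; split; [lia|auto].
Qed.
End Nilpotent_noeth.

Lemma fg_noeth (X : Group) c : (forall x : X, ucs c x) -> finitely_generated X -> noeth (fun _ : X => True).
Proof. intros Hc [l Hl]; apply (noeth_mono (@nilpotent_noeth X c Hc l)); auto. Qed.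

Section Commuting.
Variables (X : Group) (B : X -> Prop).
Hypotheses (HB : is_subgroup B) (Bcomm : forall a b, B a -> B b -> a · b = b · a).

Lemma gen_cons_comm a (l : list X) : (forall y, In y (a :: l) -> B y) ->
  forall x, gen (fun y => In y (a :: l)) x ->
  exists k y, x = zpow a k · y /\ gen (fun y => In y l) y.
Proof.
intros Hl.
assert (HlB : forall y, gen (fun y => In y l) y -> B y) by (apply gen_min; auto; intros; apply Hl; now right).
assert (HG := gen_subgroup (fun y => In y l)).
assert (Ha : forall k y, gen (fun y => In y l) y -> y · zpow a k = zpow a k · y).
{ intros k y Hy; apply Bcomm; [auto|apply sub_zpow; auto; apply Hl; now left]. }
apply (@gen_min X _ (fun x => exists k y, x = zpow a k · y /\ gen (fun y => In y l) y)).
- split; [|split].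
  + exists 0%Z, 1; split; [simpl; grp|now apply sub1].
  + intros x y (k & x' & -> & Hx) (m & y' & -> & Hy); exists (k + m)%Z, (x' · y'); split; [|now apply subM].
    rewrite zpow_add, !mulA'; f_equal; rewrite <- !mulA'; f_equal; auto.
  + intros x (k & x' & -> & Hx); exists (- k)%Z, x'⁻¹; split; [|now apply subV].
    rewrite zpow_opp, <- invM; f_equal; rewrite Ha; auto.
- intros s [<-|Hs].
  + exists 1%Z, 1; rewrite zpow_1r; split; [grp|now apply sub1].
  + exists 0%Z, s; split; [simpl; grp|now apply gen_incl].
Qed.

(** The representatives modulo [m]-th powers are products of powers of the generators with exponents
    below [m]. This finiteness is what turns a congruence into a formula. *)
Lemma fin_mod (m : nat) : 1 <= m -> fg_sub B ->
  exists L, (forall t, In t L -> B t) /\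
    forall b, B b -> exists t c, In t L /\ B c /\ b = t · gpow c m.
Proof.
intros Hm [l Hl].
assert (E : forall l, (forall y, In y l -> B y) -> exists L, (forall t, In t L -> B t) /\
    forall b, gen (fun y => In y l) b -> exists t c, In t L /\ B c /\ b = t · gpow c m).
{ clear l Hl; induction l as [|a l IH]; intros Hl.
  - exists (1 :: nil); split; [intros t [<-|[]]; now apply sub1|].
    intros b Hb; exists 1, 1; split; [now left|split; [now apply sub1|]].
    rewrite gpow_1, g_one_l; revert b Hb; apply gen_min; [apply sub_triv|intros s []].
  - destruct IH as (L & HL & HLm); [intros; apply Hl; now right|].
    exists (flat_map (fun i => map (fun t => gpow a i · t) L) (seq 0 m)); split.
    + intros t Ht; apply in_flat_map in Ht; destruct Ht as (i & _ & Ht).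
      apply in_map_iff in Ht; destruct Ht as (t' & <- & Ht).
      apply subM; auto; apply sub_gpow; auto; apply Hl; now left.
    + intros b Hb; destruct (gen_cons_comm Hl Hb) as (k & b' & -> & Hb').
      destruct (HLm b' Hb') as (t & c & Ht & Hc & ->).
      assert (Ba : B a) by (apply Hl; now left).
      set (i := Z.to_nat (k mod Z.of_nat m)); set (q := (k / Z.of_nat m)%Z).
      pose proof (Z.mod_pos_bound k (Z.of_nat m) ltac:(lia)) as Hi.
      exists (gpow a i · t), (zpow a q · c); repeat split.
      * apply in_flat_map; exists i; split; [apply in_seq; lia|apply in_map_iff; eauto].
      * apply subM; auto; now apply sub_zpow.
      * rewrite gpow_mulc by (apply Bcomm; auto; now apply sub_zpow).
        assert (Ek : zpow a k = gpow a i · gpow (zpow a q) m).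
        { rewrite <- !zpow_nat, <- zpow_mul, <- zpow_add; f_equal; unfold i, q.
          rewrite Z2Nat.id by lia; rewrite (Z.div_mod k (Z.of_nat m)) at 1 by lia; lia. }
        rewrite Ek, !mulA'; f_equal; rewrite <- !mulA'; f_equal.
        apply Bcomm; auto; apply sub_gpow; auto; now apply sub_zpow. }
destruct (E l) as (L & HL & HLm).
- intros y Hy; apply Hl; now apply gen_incl.
- exists L; split; auto; intros b Hb; apply HLm, Hl, Hb.
Qed.
End Commuting.

(** * Definable predicates *)

Inductive word (V : Type) : Type :=
| wvar : V -> word V
| wone : word V
| wmul : word V -> word V -> word V
| winv : word V -> word V.
Arguments wone {V}.

Fixpoint wev {X : Group} {V : Type} (e : V -> X) (w : word V) : X :=
  match w with
  | wvar v => e v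
  | wone => 1
  | wmul a b => wev e a · wev e b
  | winv a => (wev e a)⁻¹
  end.

Fixpoint wsub {V W : Type} (s : W -> word V) (w : word W) : word V :=
  match w with
  | wvar v => s v
  | wone => wone
  | wmul a b => wmul (wsub s a) (wsub s b)
  | winv a => winv (wsub s a)
  end.

Lemma wev_sub {X : Group} V W (s : W -> word V) (e : V -> X) w :
  wev e (wsub s w) = wev (fun v => wev e (s v)) w.
Proof. induction w; simpl; congruence. Qed.

Lemma wev_hom {X Y : Group} (f : X -> Y) (Hf : is_hom f) V (e : V -> X) w :
  f (wev e w) = wev (fun v => f (e v)) w.
Proof.
induction w; simpl; auto; [now apply hom1|now rewrite Hf, IHw1, IHw2|now rewrite homV, IHw].
Qed.

Lemma gen_word {X : Group} V (e : V -> X) (x : X) :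
  gen (fun y => exists v, y = e v) x -> exists w, wev e w = x.
Proof.
apply (@gen_min X _ (fun x => exists w, wev e w = x)).
- split; [|split].
  + now exists wone.
  + intros a b [u <-] [v <-]; now exists (wmul u v).
  + intros a [u <-]; now exists (winv u).
- intros s [v ->]; now exists (wvar v).
Qed.

Lemma word_gen {X : Group} V (e : V -> X) w : gen (fun y => exists v, y = e v) (wev e w).
Proof.
assert (H := gen_subgroup (fun y => exists v, y = e v)).
induction w; simpl; [apply gen_incl; eauto|now apply sub1|now apply subM|now apply subV].
Qed.

(* Formulas with free variables in an arbitrary type, so that a quantifier simply adds one point to the
   type of variables. *)
Inductive iform (V : Type) : Type :=
| ieq : word V -> word V -> iform V
| inot : iform V -> iform V
| iand : iform V -> iform V -> iform V
| iex : iform (option V) -> iform V.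

Definition ocons {T V : Type} (x : T) (e : V -> T) (o : option V) : T :=
  match o with None => x | Some v => e v end.

Fixpoint isat {X : Group} {V : Type} (p : iform V) : (V -> X) -> Prop :=
  match p with
  | ieq a b => fun e => wev e a = wev e b
  | inot p => fun e => ~ isat p e
  | iand p q => fun e => isat p e /\ isat q e
  | iex p => fun e => exists x : X, isat p (ocons x e)
  end.

Definition wup {V W : Type} (s : W -> word V) : option W -> word (option V) :=
  ocons (wvar None) (fun w => wsub (fun v => wvar (Some v)) (s w)).

Fixpoint isub {V W : Type} (s : W -> word V) (p : iform W) : iform V :=
  match p with
  | ieq a b => ieq (wsub s a) (wsub s b)
  | inot p => inot (isub s p)
  | iand p q => iand (isub s p) (isub s q)
  | iex p => iex (isub (wup s) p)
  end.

Lemma isat_sub {X : Group} W (p : iform W) : forall V (s : W -> word V) (e : V -> X),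
  isat (isub s p) e <-> isat p (fun w => wev e (s w)).
Proof.
induction p; intros V' s e; simpl.
- now rewrite !wev_sub.
- now rewrite IHp.
- now rewrite IHp1, IHp2.
- enough (E : forall x, isat (isub (wup s) p) (ocons x e) <->
      isat p (ocons x (fun w => wev e (s w)))).
  { split; intros [x Hx]; exists x; now apply E. }
  intros x; rewrite IHp; replace (fun w => wev (ocons x e) (wup s w))
    with (ocons x (fun w => wev e (s w))); [reflexivity|].
  extensionality o; destruct o; simpl; auto.
  now rewrite wev_sub.
Qed.

Fixpoint wterm {V : Type} (r : V -> nat) (w : word V) : term :=
  match w with
  | wvar v => tvar (r v)
  | wone => tone
  | wmul a b => tmul (wterm r a) (wterm r b)
  | winv a => tinv (wterm r a)
  end.

Fixpoint compile {V : Type} (p : iform V) : (V -> nat) -> formula :=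
  match p with
  | ieq a b => fun r => feq (wterm r a) (wterm r b)
  | inot p => fun r => fneg (compile p r)
  | iand p q => fun r => fand (compile p r) (compile q r)
  | iex p => fun r => fex (compile p (ocons 0 (fun v => S (r v))))
  end.

Lemma wterm_eval {X : Group} V (r : V -> nat) (env : nat -> X) w :
  teval env (wterm r w) = wev (fun v => env (r v)) w.
Proof. induction w; simpl; congruence. Qed.

Lemma compile_sat {X : Group} V (p : iform V) : forall r (env : nat -> X),
  sat env (compile p r) <-> isat p (fun v => env (r v)).
Proof.
induction p; intros r env; simpl.
- now rewrite !wterm_eval.
- now rewrite IHp.
- now rewrite IHp1, IHp2.
- enough (E : forall x, sat (scons x env) (compile p (ocons 0 (fun v => S (r v)))) <->
      isat p (ocons x (fun v => env (r v)))).
  { split; intros [x Hx]; exists x; now apply E. }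
  intros x; rewrite IHp.
  replace (fun v => scons x env (ocons 0 (fun v0 => S (r v0)) v))
    with (ocons x (fun v => env (r v))); [reflexivity|].
  extensionality o; now destruct o.
Qed.

Lemma wterm_closed V (r : V -> nat) n w : (forall v, r v < n) -> tclosed n (wterm r w).
Proof. intros H; induction w; simpl; auto. Qed.

Lemma compile_closed V (p : iform V) : forall (r : V -> nat) n,
  (forall v, r v < n) -> fclosed n (compile p r).
Proof.
induction p; intros r n H; simpl; auto.
- auto using wterm_closed.
- apply IHp; intros [v|]; simpl; [specialize (H v)|]; lia.
Qed.

(** One formula must serve in all groups at once; this uniformity is what makes [transfer]
    possible. *)
Definition Def (V : Type) (P : forall X : Group, (V -> X) -> Prop) : Prop :=
  exists p : iform V, forall X e, isat p e <-> P X e.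

(** In [Type], so that a family of definable terms is a substitution without appeal to choice
    ([def_sub]). *)
Definition DefT (V : Type) (t : forall X : Group, (V -> X) -> X) : Type :=
  {w : word V | forall X e, t X e = wev e w}.

Lemma transfer (G H : Group) (P : Group -> Prop) :
  elem_equiv G H -> @Def Empty_set (fun X _ => P X) -> P G -> P H.
Proof.
intros HE [p Hp] HG.
set (r := fun v : Empty_set => match v return nat with end).
assert (E : forall X : Group, models X (compile p r) <-> P X).
{ intros X; split.
  - intros K; apply (Hp X (fun v => match v with end)).
    specialize (K (fun _ => 1)); apply compile_sat in K.
    replace (fun v : Empty_set => match v return X with end) with (fun v => (fun _ : nat => (1 : X)) (r v));
      auto; extensionality v; destruct v.
  - intros K env; apply compile_sat, Hp, K. }
apply E, HE; [|now apply E].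
apply compile_closed; intros [].
Qed.

(** * Closure rules for definability *)

Section Def_rules.
Variable V : Type.
Implicit Types (P Q : forall X : Group, (V -> X) -> Prop) (t u : forall X : Group, (V -> X) -> X).

Lemma def_iff P Q : (forall X e, P X e <-> Q X e) -> Def P -> Def Q.
Proof. intros H [p Hp]; exists p; intros X e; now rewrite Hp. Qed.
Lemma def_eq t u : DefT t -> DefT u -> Def (fun X e => t X e = u X e).
Proof. intros [a Ha] [b Hb]; exists (ieq a b); intros X e; simpl; now rewrite Ha, Hb. Qed.
Lemma def_not P : Def P -> Def (fun X e => ~ P X e).
Proof. intros [p Hp]; exists (inot p); intros X e; simpl; now rewrite Hp. Qed.
Lemma def_and P Q : Def P -> Def Q -> Def (fun X e => P X e /\ Q X e).
Proof. intros [p Hp] [q Hq]; exists (iand p q); intros X e; simpl; now rewrite Hp, Hq. Qed.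
Lemma def_imp P Q : Def P -> Def Q -> Def (fun X e => P X e -> Q X e).
Proof.
intros HP HQ; apply (@def_iff (fun X e => ~ (P X e /\ ~ Q X e))); [intros; tauto|].
now apply def_not, def_and; [|apply def_not].
Qed.
Lemma def_bi P Q : Def P -> Def Q -> Def (fun X e => P X e <-> Q X e).
Proof. intros; apply def_and; now apply def_imp. Qed.
Lemma def_True : Def (fun (X : Group) (_ : V -> X) => True).
Proof. exists (ieq wone wone); simpl; tauto. Qed.
Lemma def_ex (Q : forall X : Group, X -> (V -> X) -> Prop) :
  @Def (option V) (fun X e => Q X (e None) (fun v => e (Some v))) ->
  Def (fun X e => exists x : X, Q X x e).
Proof.
intros [p Hp]; exists (iex p); intros X e; simpl.
split; intros [x Hx]; exists x; [now apply (Hp X (ocons x e))|now apply Hp].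
Qed.
Lemma deft_var v : DefT (fun (X : Group) (e : V -> X) => e v).
Proof. now exists (wvar v). Qed.
Lemma deft_one : DefT (fun (X : Group) (e : V -> X) => 1).
Proof. now exists wone. Qed.
Lemma deft_mul t u : DefT t -> DefT u -> DefT (fun X e => t X e · u X e).
Proof. intros [a Ha] [b Hb]; exists (wmul a b); intros; simpl; congruence. Qed.
Lemma deft_inv t : DefT t -> DefT (fun X e => (t X e)⁻¹).
Proof. intros [a Ha]; exists (winv a); intros; simpl; congruence. Qed.
Lemma deft_comm t u : DefT t -> DefT u -> DefT (fun X e => comm (t X e) (u X e)).
Proof. intros; unfold comm; repeat first [apply deft_mul|apply deft_inv|assumption]. Qed.
Lemma deft_gpow t n : DefT t -> DefT (fun X e => gpow (t X e) n).
Proof. intros H; induction n; simpl; [apply deft_one|now apply deft_mul]. Qed.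
Lemma def_list A (l : list A) (P : A -> forall X : Group, (V -> X) -> Prop) :
  (forall a, Def (P a)) -> Def (fun X e => forall a, In a l -> P a X e).
Proof.
intros H; induction l as [|a l IH].
- apply (def_iff (P := fun X e => True)); [simpl; firstorder|apply def_True].
- apply (def_iff (P := fun X e => P a X e /\ forall a, In a l -> P a X e)); [|now apply def_and].
  intros X e; simpl; split; [intros [H1 H2] b [<-|Hb]; auto|intros K; split; auto].
Qed.
Lemma def_exlist A (l : list A) (P : A -> forall X : Group, (V -> X) -> Prop) :
  (forall a, Def (P a)) -> Def (fun X e => exists a, In a l /\ P a X e).
Proof.
intros H; apply (def_iff (P := fun X e => ~ forall a, In a l -> ~ P a X e)).
- intros X e; split; [|firstorder].
  intros K; apply NNPP; intros K'; apply K; intros a Ha Hp; eauto.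
- now apply def_not, def_list; intros; apply def_not.
Qed.
End Def_rules.

Lemma def_all V (Q : forall X : Group, X -> (V -> X) -> Prop) :
  @Def (option V) (fun X e => Q X (e None) (fun v => e (Some v))) ->
  Def (fun X e => forall x : X, Q X x e).
Proof.
intros H; apply (@def_iff V (fun X e => ~ exists x, ~ Q X x e)).
- intros X e; split; [intros K x; apply NNPP; eauto|intros K [x Hx]; auto].
- apply def_not, def_ex, def_not, H.
Qed.

Lemma def_sub V W (P : forall X : Group, (W -> X) -> Prop) (s : W -> forall X : Group, (V -> X) -> X) :
  Def P -> (forall w, DefT (s w)) -> Def (fun X e => P X (fun w => s w X e)).
Proof.
intros [p Hp] Hs; exists (isub (fun w => proj1_sig (Hs w)) p); intros X e.
rewrite isat_sub, Hp.
replace (fun w => wev e (proj1_sig (Hs w))) with (fun w => s w X e); [reflexivity|].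
extensionality w; exact (proj2_sig (Hs w) X e).
Qed.

Lemma deft_wev V W (s : W -> forall X : Group, (V -> X) -> X) (w : word W) :
  (forall v, DefT (s v)) -> DefT (fun X e => wev (fun v => s v X e) w).
Proof.
intros Hs; exists (wsub (fun v => proj1_sig (Hs v)) w); intros X e.
rewrite wev_sub; f_equal; extensionality v; exact (proj2_sig (Hs v) X e).
Qed.

(** A type with [n] points, built by [option] because [iex] binds a variable by [option]: a tuple
    grows by [ocons] as quantifiers are added. *)
Fixpoint I (n : nat) : Type := match n with 0 => Empty_set | S n => option (I n) end.

Fixpoint enumI (n : nat) : list (I n) :=
  match n with 0 => nil | S n => None :: map Some (enumI n) end.

Lemma enumI_all n (k : I n) : In k (enumI n).
Proof.
induction n as [|n IH]; [destruct k|].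
destruct k as [k|]; simpl; [right; apply in_map, IH|now left].
Qed.

Lemma def_allI V n (P : I n -> forall X : Group, (V -> X) -> Prop) :
  (forall k, Def (P k)) -> Def (fun X e => forall k, P k X e).
Proof.
intros H; apply (@def_iff V (fun X e => forall k, In k (enumI n) -> P k X e)).
- intros X e; split; intros K k; [apply K, enumI_all|auto].
- now apply def_list.
Qed.

Lemma def_exT n : forall V (Q : forall X : Group, (I n -> X) -> (V -> X) -> Prop),
  @Def (I n + V) (fun X e => Q X (fun k => e (inl k)) (fun v => e (inr v))) ->
  Def (fun X e => exists t : I n -> X, Q X t e).
Proof.
induction n as [|n IH]; intros V Q H.
- apply (@def_iff V (fun X e => Q X (fun k : I 0 => match k with end) e)).
  + intros X e; split; [eauto|intros [t Ht]].
    replace (fun k : I 0 => match k return X with end) with t; auto; extensionality k; destruct k.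
  + apply (@def_sub V _ _ (fun (w : I 0 + V) X e => match w with inl k => match k with end | inr v => e v end)) in H.
    * revert H; apply def_iff; intros X e; simpl.
      replace (fun k : Empty_set => match k return X with end) with (fun k : I 0 => match k return X with end);
        [reflexivity|extensionality k; destruct k].
    * intros [[]|v]; apply deft_var.
- apply (@def_iff V (fun X e => exists x, exists t, Q X (ocons x t) e)).
  + intros X e; split; [intros (x & t & Ht); eauto|].
    intros [t Ht]; exists (t None), (fun k => t (Some k)).
    replace (ocons _ _) with t; auto; extensionality k; now destruct k.
  + apply def_ex, IH.
    apply (@def_sub (I n + option V) _ _ (fun (w : I (S n) + V) X (e : I n + option V -> X) =>
       match w with inl None => e (inr None) | inl (Some k) => e (inl k) | inr v => e (inr (Some v)) end)) in H.
    * revert H; apply def_iff; intros X e; simpl.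
      replace (ocons _ _) with (fun k : I (S n) => match k with Some k0 => e (inl k0) | None => e (inr None) end);
        [reflexivity|extensionality k; now destruct k].
    * intros [[k|]|v]; apply deft_var.
Qed.

Lemma def_allT n V (Q : forall X : Group, (I n -> X) -> (V -> X) -> Prop) :
  @Def (I n + V) (fun X e => Q X (fun k => e (inl k)) (fun v => e (inr v))) ->
  Def (fun X e => forall t : I n -> X, Q X t e).
Proof.
intros H; apply (@def_iff V (fun X e => ~ exists t, ~ Q X t e)).
- intros X e; split; [intros K x; apply NNPP; eauto|intros K [x Hx]; auto].
- apply def_not, def_exT, def_not, H.
Qed.

(** * Homomorphisms realizing a formula *)

Ltac ext j := apply functional_extensionality; intros j; cbn.

Section Pow.
Variables (J : Type) (X : Group).
(** The index type will be [I n] for tuples and [I n -> H] for word functions. *)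
Definition pow_group : Group.
Proof.
refine (@Build_Group (J -> X) (fun a b j => a j · b j) (fun a j => (a j)⁻¹) (fun _ => 1) _ _ _ _ _);
  intros; ext j; grp.
Defined.
Lemma pow_ucs i (t : pow_group) : (forall j, ucs i (t j)) -> ucs i t.
Proof.
revert t; induction i as [|i IH]; intros t H.
- ext j; apply H.
- intros g; apply IH; intros j; apply (H j).
Qed.
Lemma pow_proj_hom j : @is_hom pow_group X (fun t => t j).
Proof. intros s t; reflexivity. Qed.
End Pow.

Lemma hom_gen {X Y : Group} (f : X -> Y) (Hf : is_hom f) (S : X -> Prop) (P : Y -> Prop) :
  is_subgroup P -> (forall s, S s -> P (f s)) -> forall x, gen S x -> P (f x).
Proof. intros HP; apply (@gen_min X S (fun x => P (f x)) (hom_preim Hf HP)). Qed.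

Lemma pow_fg (X : Group) n : finitely_generated X -> finitely_generated (pow_group (I n) X).
Proof.
intros [l Hl]; induction n as [|n [L HL]].
- exists nil; intros t; replace t with (1 : pow_group (I 0) X); [apply sub1, gen_subgroup|ext k; destruct k].
- set (a := (fun g => ocons g (fun _ => 1)) : X -> pow_group (I (S n)) X).
  set (b := (fun t => ocons 1 t) : pow_group (I n) X -> pow_group (I (S n)) X).
  assert (Ha : is_hom a) by (intros u v; ext k; destruct k; simpl; grp).
  assert (Hb : is_hom b) by (intros u v; ext k; destruct k; simpl; grp).
  exists (map a l ++ map b L); intros t.
  replace t with (a (t None) · b (fun k => t (Some k))) by (ext k; destruct k; simpl; grp).
  assert (HG := gen_subgroup (fun y => In y (map a l ++ map b L))).
  apply subM; auto; [generalize (Hl (t None))|generalize (HL (fun k => t (Some k)))]; apply hom_gen; auto;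
    intros s Hs; apply gen_incl, in_or_app; [left|right]; now apply in_map.
Qed.

Lemma noeth_pow (X : Group) c n : (forall x : X, ucs c x) -> finitely_generated X ->
  noeth (fun _ : pow_group (I n) X => True).
Proof.
intros Hc HX; apply (@fg_noeth (pow_group (I n) X) c); [|now apply pow_fg].
intros t; apply pow_ucs; intros j; apply Hc.
Qed.

Section Exists_hom.
Variables (G H : Group) (n : nat) (x : I n -> G) (c : nat).
Hypotheses (GH : elem_equiv G H) (Hx : forall g, gen (fun y => exists k, y = x k) g)
  (Hc : forall h : H, ucs c h).

(* The group of [H]-valued word functions on [H^n] is a finitely generated nilpotent group, so the word
   functions vanishing at [x] are generated by finitely many of them. *)
Lemma finite_relators : exists ws : list (word (I n)), (forall w, In w ws -> wev x w = 1) /\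
  forall h : I n -> H, (forall w, In w ws -> wev h w = 1) -> forall w, wev x w = 1 -> wev h w = 1.
Proof.
set (F := pow_group (I n -> H) H).
set (crd := fun k : I n => (fun h => h k) : F).
assert (Ew : forall w h, wev crd w h = wev h w).
{ intros w h; apply (wev_hom (@pow_proj_hom (I n -> H) H h)). }
assert (HN : noeth (gen (fun y => In y (map crd (enumI n))))).
{ apply (@nilpotent_noeth F c); intros t; apply pow_ucs; intros j; apply Hc. }
destruct (HN (fun phi => exists w, wev crd w = phi /\ wev x w = 1)) as [l Hl].
- split; [|split].
  + now exists wone.
  + intros a b (u & <- & Eu) (v & <- & Ev); exists (wmul u v); split; auto.
    simpl; rewrite Eu, Ev; grp.
  + intros a (u & <- & Eu); exists (winv u); split; auto; simpl; rewrite Eu; grp.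
- intros phi (w & <- & _).
  generalize (word_gen crd w); apply gen_mono; intros s [k ->]; apply in_map, enumI_all.
- assert (E : exists ws : list (word (I n)), (forall w, In w ws -> wev x w = 1) /\
    forall phi, In phi l -> exists w, In w ws /\ wev crd w = phi).
  { assert (K : forall phi, In phi l -> exists w, wev crd w = phi /\ wev x w = 1)
      by (intros phi Hp; apply Hl; now apply gen_incl).
    clear Hl; induction l as [|phi l IH].
    - exists nil; split; [intros w []|intros phi []].
    - destruct IH as (ws & H1 & H2); [intros; apply K; now right|].
      destruct (K phi) as (w & Ew' & Ew1); [now left|].
      exists (w :: ws); split.
      + intros w' [<-|Hw]; auto.
      + intros phi' [<-|Hp]; [exists w; split; auto; now left|].
        destruct (H2 phi' Hp) as (w' & Hw & E); exists w'; split; auto; now right. }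
  destruct E as (ws & H1 & H2); exists ws; split; auto.
  intros h Hh w Hw; rewrite <- Ew.
  assert (K : gen (fun y => In y l) (wev crd w)) by (apply Hl; eauto).
  revert K; generalize (wev crd w : F).
  apply (@gen_min F _ (fun phi => phi h = 1)).
  + apply (hom_preim (@pow_proj_hom (I n -> H) H h) (sub_triv (X := H))).
  + intros phi Hp; destruct (H2 phi Hp) as (w' & Hw' & <-); rewrite Ew; auto.
Qed.

(** The transferred sentence asks for a tuple of [H] that satisfies [P] and finitely many relators.
    The tuple then satisfies every relator of [x], so the generators may be sent to its entries. *)
Lemma exists_hom (P : forall X : Group, (I n -> X) -> Prop) :
  Def P -> P G x -> exists f : G -> H, is_hom f /\ P H (fun k => f (x k)).
Proof.
intros HP HG.
destruct finite_relators as (ws & Hws & Hrel).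
destruct (@transfer G H (fun X => exists h : I n -> X, (forall w, In w ws -> wev h w = 1) /\ P X h) GH)
  as (h & Hh & Hp).
- apply def_exT, def_and.
  + apply def_list; intros w; apply def_eq; [|apply deft_one].
    apply (deft_wev (fun k X (e : I n + Empty_set -> X) => e (inl k))); intros k; apply deft_var.
  + apply (def_sub (fun k X (e : I n + Empty_set -> X) => e (inl k)) HP); intros k; apply deft_var.
- now exists x.
- specialize (Hrel h Hh).
  assert (E : forall g, exists w, wev x w = g) by (intros g; now apply gen_word).
  apply choice in E; destruct E as [r Hr].
  assert (Ef : forall w g, wev x w = g -> wev h (r g) = wev h w).
  { intros w g Ew; symmetry; apply eq_of_div; change (wev h (wmul (winv (r g)) w) = 1).
    apply Hrel; simpl; rewrite Hr, Ew; grp. }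
  exists (fun g => wev h (r g)); split.
  + intros a b; symmetry; change (wev h (wmul (r a) (r b)) = wev h (r (a · b))).
    symmetry; apply Ef; simpl; now rewrite !Hr.
  + replace (fun k => wev h (r (x k))) with h; auto.
    ext k; symmetry; now rewrite (Ef (wvar k)).
Qed.
End Exists_hom.

(** * Commutative rings that are noetherian as abelian groups *)

Record CRing := {
  rcar :> Type;
  r0 : rcar; r1 : rcar;
  radd : rcar -> rcar -> rcar;
  rmul : rcar -> rcar -> rcar;
  ropp : rcar -> rcar;
  rth : ring_theory r0 r1 radd rmul (fun x y => radd x (ropp y)) ropp eq
}.
Declare Scope cr_scope.
Delimit Scope cr_scope with cr.
Infix "+" := (radd _) : cr_scope.
Infix "*" := (rmul _) : cr_scope.
Notation "- x" := (ropp _ x) : cr_scope.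
Notation "x - y" := (radd _ x (ropp _ y)) : cr_scope.
Notation "0" := (r0 _) : cr_scope.
Notation "1" := (r1 _) : cr_scope.
Open Scope cr_scope.

(** Lets noetherian induction and generation of groups apply to rings unchanged. *)
Definition addG (R : CRing) : Group.
Proof.
refine (@Build_Group R (radd R) (ropp R) 0 _ _ _ _ _); intros; destruct (rth R).
- apply Radd_assoc.
- apply Radd_0_l.
- now rewrite Radd_comm, Radd_0_l.
- now rewrite Radd_comm, Ropp_def.
- apply Ropp_def.
Defined.

Definition rnoeth (R : CRing) : Prop := noeth (fun _ : addG R => True).

Fixpoint rpow {R : CRing} (x : R) (n : nat) : R :=
  match n with 0%nat => 1 | S n => x * rpow x n end.

Definition nilp {R : CRing} (x : R) : Prop := exists n, rpow x n = 0.

Definition zsc {R : CRing} (k : Z) : R := @zpow (addG R) (1 : R) k.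

(** A monic polynomial of degree [length l] in Horner form: the list holds the lower coefficients
    and [nil] supplies the leading 1. *)
Fixpoint mev {R : CRing} (l : list R) (x : R) : R :=
  match l with nil => 1 | c :: l => c + x * mev l x end.

Fixpoint lev {R : CRing} (l : list Z) (x : R) : R :=
  match l with nil => 0 | c :: l => zsc c + x * lev l x end.

Fixpoint idl {R : CRing} (l : list R) (x : R) : Prop :=
  match l with nil => x = 0 | n :: l => exists r y, x = n * r + y /\ idl l y end.

Definition is_rhom {R S : CRing} (F : R -> S) : Prop :=
  (forall x y, F (x + y) = F x + F y) /\ (forall x y, F (x * y) = F x * F y) /\ F 1 = 1.

Section One_ring.
Variable R : CRing.
Add Ring Rring : (rth R).
Implicit Types (x y a b : R) (J S : R -> Prop).
(** Goals may be stated in [addG R]; its operations are turned into those of [R] before [ring]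
    runs. *)
Ltac cring := try change (@g_op (addG R)) with (radd R); try change (@g_inv (addG R)) with (ropp R);
  try change (@g_one (addG R)) with (r0 R); lazymatch goal with |- @eq _ ?a _ =>
  transitivity (radd R (r0 R) a); [symmetry; apply (Radd_0_l (rth R))|] end;
  lazymatch goal with |- @eq _ ?a ?b => change (@eq (rcar R) a b) end; ring.

Lemma rpow_add x n m : rpow x (n + m) = rpow x n * rpow x m.
Proof. induction n; simpl; [|rewrite IHn]; cring. Qed.
Lemma rpow_mul x y n : rpow (x * y) n = rpow x n * rpow y n.
Proof. induction n; simpl; [|rewrite IHn]; cring. Qed.
Lemma rpow_rpow x n m : rpow (rpow x n) m = rpow x (n * m).
Proof.
induction m; simpl; [now rewrite Nat.mul_0_r|].
rewrite IHm, <- rpow_add; f_equal; lia.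
Qed.

(** Every monomial of degree [i + j] in [a] and [b] contains [a^i] or [b^j]. Peeling off one factor
    [a + b] and lowering [i] or [j] avoids binomial coefficients. *)
Lemma rpow_binom i j a b : exists p q, rpow (a + b) (i + j) = rpow a i * p + rpow b j * q.
Proof.
enough (H : forall n i j, n = (i + j)%nat ->
  exists p q, rpow (a + b) n = rpow a i * p + rpow b j * q) by now apply H.
clear i j; induction n as [n IH] using lt_wf_ind; intros i j E.
destruct i as [|i]; [exists (rpow (a + b) n), 0; simpl; cring|].
destruct j as [|j]; [exists 0, (rpow (a + b) n); simpl; cring|].
destruct n as [|n]; [lia|].
destruct (IH n ltac:(lia) i (Datatypes.S j)) as (p & q & E1); [lia|].
destruct (IH n ltac:(lia) (Datatypes.S i) j) as (p' & q' & E2); [lia|].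
exists (p + b * p'), (a * q + q').
change (rpow (a + b) (Datatypes.S n)) with ((a + b) * rpow (a + b) n).
replace ((a + b) * rpow (a + b) n) with (a * rpow (a + b) n + b * rpow (a + b) n) by cring.
rewrite E1 at 1; rewrite E2; simpl; cring.
Qed.

Definition ideal J : Prop := @is_subgroup (addG R) J /\ forall r x, J x -> J (r * x).
Definition radical J x : Prop := exists n, J (rpow x n).

Lemma idealM J r x : ideal J -> J x -> J (x * r).
Proof. intros [_ H] K; replace (x * r) with (r * x) by cring; auto. Qed.
Lemma idealD J x y : ideal J -> J x -> J y -> J (x + y).
Proof. intros [H _]; apply H. Qed.
Lemma ideal0 J : ideal J -> J 0.
Proof. intros [H _]; apply H. Qed.
Lemma idealN J x : ideal J -> J x -> J (- x).
Proof. intros [H _]; apply H. Qed.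

Lemma radical_ideal J : ideal J -> ideal (radical J).
Proof.
intros HJ; split; [split; [|split]|].
- exists 1%nat; simpl; replace (0 * 1) with (0 : R) by cring; now apply ideal0.
- intros x y [n Hn] [m Hm]; exists (n + m)%nat.
  destruct (rpow_binom n m x y) as (p & q & E); change (J (rpow (x + y) (n + m))).
  rewrite E; apply idealD; auto; now apply idealM.
- intros x [n Hn]; exists n; change (J (rpow (- x) n)).
  replace (- x) with ((- (1)) * x) by cring; rewrite rpow_mul; now apply HJ.
- intros r x [n Hn]; exists n; rewrite rpow_mul; now apply HJ.
Qed.
Lemma radical_radical J x : radical (radical J) x -> radical J x.
Proof. intros [n [m H]]; exists (n * m)%nat; now rewrite <- rpow_rpow. Qed.
Lemma radical_incl J x : J x -> radical J x.
Proof. intros H; exists 1%nat; simpl; now replace (x * 1) with x by cring. Qed.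

(** Synthetic division by [x - a]: the quotient is again monic, of degree one less ([quot_spec]). *)
Fixpoint quot (l : list R) (a : R) : list R :=
  match l with
  | nil => nil
  | _ :: l' => match l' with nil => nil | _ :: _ => mev l' a :: quot l' a end
  end.

Lemma quot_spec l a x : l <> nil -> mev l x - mev l a = (x - a) * mev (quot l a) x.
Proof.
induction l as [|c l IH]; [easy|intros _].
destruct l as [|c' l]; [simpl; cring|].
specialize (IH ltac:(discriminate)).
change ((c + x * mev (c' :: l) x) - (c + a * mev (c' :: l) a) =
  (x - a) * (mev (c' :: l) a + x * mev (quot (c' :: l) a) x)).
transitivity (x * (mev (c' :: l) x - mev (c' :: l) a) + (x - a) * mev (c' :: l) a); [cring|].
rewrite IH; cring.
Qed.
Lemma quot_length l a : length (quot l a) = pred (length l).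
Proof.
induction l as [|c l IH]; auto.
destruct l as [|c' l]; auto.
change (S (length (quot (c' :: l) a)) = S (length l)); now rewrite IH.
Qed.

Lemma prime_roots J : ideal J -> (forall a b, J (a * b) -> J a \/ J b) ->
  forall l, exists L, forall x, J (mev l x) -> exists a, In a L /\ J (x - a).
Proof.
intros HJ Hp l; remember (length l) as d eqn:Ed; revert l Ed.
induction d as [|d IH]; intros l Ed.
(* In degree 0 the hypothesis says that 1 lies in [J], so [J] is everything and any nonempty list
   serves. *)
- destruct l; [|discriminate]; exists (0 :: nil); intros x Hx; exists 0; split; [now left|].
  simpl in Hx; replace (x - 0) with (x * 1) by cring; now apply HJ.
- destruct (classic (exists a, J (mev l a))) as [[a Ha]|Hno].
  + destruct (IH (quot l a)) as [L HL]; [rewrite quot_length, <- Ed; auto|].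
    exists (a :: L); intros x Hx.
    destruct (Hp (x - a) (mev (quot l a) x)) as [K|K].
    * rewrite <- quot_spec by (intros ->; discriminate).
      apply idealD; auto; now apply idealN.
    * exists a; split; auto; now left.
    * destruct (HL x K) as (b & Hb & Kb); exists b; split; auto; now right.
  + exists nil; intros x Hx; exfalso; eauto.
Qed.

Lemma ideal_add J a : ideal J -> ideal (fun x => exists j r, J j /\ x = j + a * r).
Proof.
intros HJ; split; [split; [|split]|].
- exists 0, 0; split; [now apply ideal0|cring].
- intros x y (j & r & Hj & ->) (k & s & Hk & ->); exists (j + k), (r + s).
  split; [now apply idealD|cring].
- intros x (j & r & Hj & ->); exists (- j), (- r); split; [now apply idealN|].
  cring.
- intros s x (j & r & Hj & ->); exists (s * j), (s * r); split; [now apply HJ|cring].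
Qed.

Hypothesis HR : rnoeth R.

(* Noetherian induction on the ideal, splitting a radical ideal that is not prime into two larger ones. *)
Lemma radical_roots l : forall J, ideal J ->
  exists L, forall x, radical J (mev l x) -> exists a, In a L /\ radical J (x - a).
Proof.
enough (E : forall J, @is_subgroup (addG R) J -> (forall x, J x -> True) -> ideal J ->
  exists L, forall x, radical J (mev l x) -> exists a, In a L /\ radical J (x - a))
  by (intros J HJ; apply E; auto; apply HJ).
apply (@noeth_ind (addG R) (fun _ => True) (fun J => ideal J ->
  exists L, forall x, radical J (mev l x) -> exists a, In a L /\ radical J (x - a))); auto.
intros J _ _ IH HJ.
pose proof (radical_ideal HJ) as HrJ.
destruct (classic (exists a b, radical J (a * b) /\ ~ radical J a /\ ~ radical J b))
  as [(a & b & Hab & Ha & Hb)|Hno].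
- assert (K : forall c, ~ radical J c -> exists L, forall x, radical J (mev l x) ->
     exists a, In a L /\ radical (fun x => exists j r, J j /\ x = j + c * r) (x - a)).
  { intros c Hc; destruct (IH (fun x => exists j r, J j /\ x = j + c * r)) as [L HL]; auto.
    - now apply ideal_add.
    - intros x Hx; exists x, 0; split; auto; cring.
    - exists c; split; [exists 0, 1; split; [now apply ideal0|cring]|].
      intros Hc'; now apply Hc, radical_incl.
    - now apply ideal_add.
    - exists L; intros x [n Hx]; apply HL; exists n, (rpow (mev l x) n), 0; split; auto; cring. }
  destruct (K a Ha) as [L1 H1], (K b Hb) as [L2 H2].
  (* A pair of roots modulo the two larger ideals need not come from a single [x]. For each pair
     that does, one such [x] is chosen once and for all; 0 fills the other entries. *)
  set (good := fun p x => radical J (mev l x) /\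
     radical (fun x => exists j r, J j /\ x = j + a * r) (x - fst p) /\
     radical (fun x => exists j r, J j /\ x = j + b * r) (x - snd p)).
  assert (E : forall p, exists x0, (exists x, good p x) -> good p x0).
  { intros p; destruct (classic (exists x, good p x)) as [[x Hx]|Hn]; [eauto|exists 0; tauto]. }
  apply choice in E; destruct E as [g Hg].
  exists (map g (list_prod L1 L2)); intros x Hx.
  destruct (H1 x Hx) as (a1 & Ha1 & K1), (H2 x Hx) as (a2 & Ha2 & K2).
  exists (g (a1, a2)); split; [apply in_map, in_prod; auto|].
  destruct (Hg (a1, a2)) as (_ & K1' & K2'); [now exists x|simpl in K1', K2'].
  assert (D : forall c z, radical (fun x => exists j r, J j /\ x = j + c * r) (x - z) ->
    radical (fun x => exists j r, J j /\ x = j + c * r) (g (a1, a2) - z) ->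
    radical (fun x => exists j r, J j /\ x = j + c * r) (x - g (a1, a2))).
  { intros c z Hz Hz'; assert (HI := radical_ideal (ideal_add c HJ)).
    replace (x - g (a1, a2)) with ((x - z) - (g (a1, a2) - z)) by cring.
    apply idealD; auto; now apply idealN. }
  (* An element of [J + aR] times one of [J + bR] lies in the radical of [J], because [a * b]
     does. *)
  destruct (D a a1 K1 K1') as (n & j & r & Hj & E1), (D b a2 K2 K2') as (m & k & s & Hk & E2).
  apply radical_radical; exists (n + m)%nat; rewrite rpow_add, E1, E2.
  replace ((j + a * r) * (k + b * s)) with (j * (k + b * s) + (a * r * k + (a * b) * (r * s))) by cring.
  apply idealD; auto; [apply radical_incl; now apply idealM|].
  apply idealD; auto; [apply radical_incl; now apply HJ|now apply idealM].
- destruct (prime_roots HrJ) with (l := l) as [L HL]; [|eauto].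
  intros a b Hab; apply NNPP; intros K; apply Hno; exists a, b; tauto.
Qed.

Lemma zero_ideal : ideal (fun x => x = 0).
Proof. split; [apply (sub_triv (X := addG R))|intros r x ->; cring]. Qed.

Lemma nilp_roots l : exists L, forall x, mev l x = 0 -> exists a, In a L /\ nilp (x - a).
Proof.
destruct (radical_roots l zero_ideal) as [L HL].
exists L; intros x Hx; apply HL; now apply radical_incl.
Qed.

Lemma nilp_ideal : ideal nilp.
Proof. apply (radical_ideal zero_ideal). Qed.

Lemma addsub0 S : @is_subgroup (addG R) S -> S 0.
Proof. apply (@sub1 (addG R)). Qed.
Lemma addsubD S x y : @is_subgroup (addG R) S -> S x -> S y -> S (x + y).
Proof. apply (@subM (addG R)). Qed.
Lemma addsubN S x : @is_subgroup (addG R) S -> S x -> S (- x).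
Proof. apply (@subV (addG R)). Qed.
Lemma addsub_zpow S x k : @is_subgroup (addG R) S -> S x -> S (@zpow (addG R) x k).
Proof. apply (@sub_zpow (addG R)). Qed.

Lemma zsc_add k m : @zsc R (k + m) = zsc k + zsc m.
Proof. apply (@zpow_add (addG R)). Qed.
Lemma zsc_opp k : @zsc R (- k) = - zsc k.
Proof. apply (@zpow_opp (addG R)). Qed.
Lemma zpow_zsc k x : @zpow (addG R) x k = zsc k * x.
Proof.
revert k; apply Z.bi_induction; [intros ? ? ->; reflexivity|unfold zsc; simpl; cring|].
intros k; rewrite (@zpow_succ (addG R)); unfold zsc; rewrite (@zpow_succ (addG R)); fold (@zsc R k).
change (@zpow (addG R) x k = zsc k * x <-> x + @zpow (addG R) x k = (1 + zsc k) * x).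
split; [intros ->; cring|intros E].
replace (@zpow (addG R) x k) with (- x + (x + @zpow (addG R) x k)) by cring; rewrite E; cring.
Qed.

Lemma gen_cons a (l : list R) x : @gen (addG R) (fun y => In y (a :: l)) x ->
  exists k y, x = zsc k * a + y /\ @gen (addG R) (fun y => In y l) y.
Proof.
intros Hx; destruct (@gen_cons_comm (addG R) (fun _ => True) (@subT (addG R))
  (fun a b _ _ => Radd_comm (rth R) a b) a l (fun _ _ => Logic.I) x Hx) as (k & y & E & Hy).
exists k, y; rewrite <- zpow_zsc; auto.
Qed.

(** The nilradical is finitely generated as an abelian group, so one exponent, obtained by adding
    those of the generators, serves for all. With [s] fixed, nilpotency becomes a first-order
    condition. *)
Lemma nilp_bound : exists s, forall x, nilp x -> rpow x s = 0.
Proof.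
destruct (HR (proj1 nilp_ideal) (fun _ _ => Logic.I)) as [l Hl].
assert (E : forall l : list R, (forall x, In x l -> nilp x) ->
   exists s, forall x, @gen (addG R) (fun y => In y l) x -> rpow x s = 0).
{ clear l Hl; induction l as [|a l IH]; intros Hn.
  - exists 1%nat; intros x Hx; simpl.
    enough (x = 0) as -> by cring.
    revert x Hx; apply (@gen_min (addG R)); [apply (sub_triv (X := addG R))|intros s []].
  - destruct IH as [s Hs]; [intros; apply Hn; now right|].
    destruct (Hn a) as [t Ht]; [now left|].
    exists (t + s)%nat; intros x Hx.
    destruct (gen_cons Hx) as (k & y & -> & Hy).
    destruct (rpow_binom t s (zsc k * a) y) as (p & q & ->).
    rewrite rpow_mul, Ht, Hs by auto; cring. }
destruct (E l) as [s Hs].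
- intros x Hx; apply (Hl x); now apply gen_incl.
- exists s; intros x Hx; apply Hs, Hl, Hx.
Qed.

Lemma lev_add l : forall m x, length l = length m -> exists u, length u = length l /\ lev u x = lev l x + lev m x.
Proof.
induction l as [|c l IH]; intros [|d m] x E; try discriminate.
- exists nil; split; auto; simpl; cring.
- destruct (IH m x) as (u & Hu & Eu); [simpl in E; lia|].
  exists ((c + d)%Z :: u); simpl; split; [lia|]; rewrite Eu, zsc_add; cring.
Qed.
Lemma lev_opp l x : lev (map Z.opp l) x = - lev l x.
Proof. induction l as [|c l IH]; simpl; [|rewrite IH, zsc_opp]; cring. Qed.
Lemma lev_app0 l x : lev (l ++ 0%Z :: nil) x = lev l x.
Proof. induction l as [|c l IH]; simpl; [unfold zsc; simpl|rewrite IH]; cring. Qed.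
Lemma lev_zero n x : lev (repeat 0%Z n) x = 0.
Proof. induction n; simpl; [|rewrite IHn; unfold zsc; simpl]; cring. Qed.
Lemma mev_lev l x : mev (map zsc l) x = rpow x (length l) + lev l x.
Proof. induction l as [|c l IH]; simpl; [|rewrite IH]; cring. Qed.
Lemma lev_pow n x : lev (repeat 0%Z n ++ 1%Z :: nil) x = rpow x n.
Proof. induction n; simpl; [|rewrite IHn]; unfold zsc; simpl; [change (1 + 0 + x * 0 = 1)|]; cring. Qed.

(** The values at [x] of integer polynomials of degree below [k] form an ascending chain of groups;
    where it stops, a power of [x] is an integer combination of lower ones. *)
Lemma integral x : exists l : list Z, mev (map zsc l) x = 0.
Proof.
destruct (@chain_stab (addG R) (fun _ => True)
  (fun k y => exists l, length l = k /\ y = lev l x)) as [n Hn]; auto.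
- intros k; split; [|split].
  + exists (repeat 0%Z k); rewrite repeat_length, lev_zero; auto.
  + intros a b (l & <- & ->) (m & Hm & ->); destruct (lev_add l m x) as (u & Hu & Eu); auto.
    exists u; auto.
  + intros a (l & <- & ->); exists (map Z.opp l); rewrite length_map, lev_opp; auto.
- intros k y (l & <- & ->); exists (l ++ 0%Z :: nil); rewrite lev_app0, length_app; simpl; split; [lia|auto].
- destruct (Hn (S n) (rpow x n)) as (l & Hl & E).
  + exists (repeat 0%Z n ++ 1%Z :: nil); rewrite lev_pow, length_app, repeat_length; simpl; split; [lia|auto].
  + exists (map Z.opp l); rewrite mev_lev, length_map, Hl, E, lev_opp; cring.
Qed.

(* If [M] is a maximal proper subgroup and [y] is outside [M], then [3 y] lies in [M] or [y = 3 k y] modulo [M],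
   so that some [q >= 2] annihilates the quotient. *)
Lemma proper_mod S : @is_subgroup (addG R) S -> (exists x, ~ S x) ->
  exists q : Z, (1 <= q)%Z /\ exists x, ~ exists s y, S s /\ x = s + zsc q * y.
Proof.
intros HS; assert (HSM : forall x, S x -> True) by auto.
revert S HS HSM.
apply (@noeth_ind (addG R) (fun _ => True) (fun S => (exists x, ~ S x) ->
  exists q : Z, (1 <= q)%Z /\ exists x, ~ exists s y, S s /\ x = s + zsc q * y)); auto.
intros S HS _ IH [y Hy].
destruct (classic (exists S', @is_subgroup (addG R) S' /\ (forall x, S x -> S' x) /\
   (exists x, S' x /\ ~ S x) /\ exists x, ~ S' x)) as [(S' & HS' & Hi & Hx & Hx')|Hmax].
- destruct (IH S') as (q & Hq & x & Hn); auto.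
  exists q; split; auto; exists x; intros (s & z & Hs & ->); apply Hn; eauto.
- assert (K : forall z, ~ S z -> forall x, exists k s, S s /\ x = s + zsc k * z).
  { intros z Hz x; apply NNPP; intros Hn; apply Hmax.
    exists (fun x => exists k s, S s /\ x = s + zsc k * z); repeat split.
    - exists 0%Z, 0; split; [now apply addsub0|].
      unfold zsc; simpl; cring.
    - intros a b (k & s & Hs & ->) (m & t & Ht & ->); exists (k + m)%Z, (s + t).
      split; [now apply addsubD|].
      rewrite zsc_add; cring.
    - intros a (k & s & Hs & ->); exists (- k)%Z, (- s).
      split; [now apply addsubN|].
      rewrite zsc_opp; cring.
    - intros a Ha; exists 0%Z, a; split; auto; unfold zsc; simpl; cring.
    - exists z; split; auto; exists 1%Z, 0; split; [now apply addsub0|].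
      unfold zsc; simpl; cring.
    - eauto. }
  assert (Q : forall q, (2 <= q)%Z -> S (zsc q * y) -> exists q : Z, (1 <= q)%Z /\
     exists x, ~ exists s y, S s /\ x = s + zsc q * y).
  { intros q Hq Hqy; exists q; split; [lia|]; exists y; intros (s & z & Hs & E).
    destruct (K y Hy z) as (k & t & Ht & ->).
    apply Hy; rewrite E; apply addsubD; auto.
    rewrite <- zpow_zsc.
    change (t + zsc k * y) with (@g_op (addG R) t (zsc k * y)).
    rewrite (@zpow_mulc (addG R)) by (apply (Radd_comm (rth R))).
    apply (@addsubD S); auto; [now apply addsub_zpow|].
    rewrite zpow_zsc; replace (zsc q * (zsc k * y)) with (zsc k * (zsc q * y)) by cring.
    rewrite <- zpow_zsc; now apply addsub_zpow. }
  (* 3 and not 2: for [k] nonzero [1 - 3k] has absolute value at least 2, whereas [1 - 2k] may be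
     -1. *)
  destruct (classic (S (zsc 3 * y))) as [H3|H3]; [now apply (Q 3%Z)|].
  destruct (K _ H3 y) as (k & s & Hs & E).
  assert (Hd : S (zsc (1 - k * 3) * y)).
  { replace (zsc (1 - k * 3) * y) with s; auto.
    unfold Z.sub; rewrite zsc_add, zsc_opp.
    replace (@zsc R (k * 3)) with (@zsc R k * zsc 3)
      by (rewrite <- zpow_zsc; unfold zsc; symmetry; apply (@zpow_mul (addG R))).
    replace (@zsc R 1) with (1 : R) by (unfold zsc; symmetry; apply (@zpow_1r (addG R))).
    replace ((1 + - (zsc k * zsc 3)) * y) with (y - zsc k * (zsc 3 * y)) by cring.
    rewrite E at 1; cring. }
  destruct (Z.eq_dec k 0) as [->|Hk].
  { exfalso; apply Hy; rewrite E; replace (s + zsc 0 * (zsc 3 * y)) with s; auto.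
    unfold zsc at 1; simpl; cring. }
  apply (Q (Z.abs (1 - k * 3))); [lia|].
  destruct (Z.abs_eq_or_opp (1 - k * 3)) as [->| ->]; auto.
  rewrite zsc_opp; replace (- zsc (1 - k * 3) * y) with (- (zsc (1 - k * 3) * y)) by cring.
  now apply addsubN.
Qed.

Lemma idl_ideal (l : list R) : ideal (idl l).
Proof.
induction l as [|n l IH]; [apply zero_ideal|split; [split; [|split]|]].
- exists 0, 0; split; [cring|now apply ideal0].
- intros x y (r & x' & -> & Hx) (s & y' & -> & Hy); exists (r + s), (x' + y').
  split; [cring|now apply idealD].
- intros x (r & x' & -> & Hx); exists (- r), (- x'); split; [cring|now apply idealN].
- intros t x (r & x' & -> & Hx); exists (t * r), (t * x'); split; [cring|now apply IH].
Qed.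

Lemma idl_In (l : list R) n : In n l -> idl l n.
Proof.
induction l as [|m l IH]; [intros []|intros [->|Hn]].
- exists 1, 0; split; [cring|apply ideal0, idl_ideal].
- exists 0, n; split; [cring|auto].
Qed.

Lemma gen_idl (l : list R) x : @gen (addG R) (fun y => In y l) x -> idl l x.
Proof. apply (@gen_min (addG R)); [apply idl_ideal|apply idl_In]. Qed.

(** Passing to a multiple of [q] only strengthens the hypothesis on [T], so the product of the
    integers found for the single subgroups serves for all of them. *)
Lemma proper_mod_list (TT : list (R -> Prop)) : exists q : Z, (1 <= q)%Z /\
  forall T, In T TT -> @is_subgroup (addG R) T ->
    (forall y, exists t z, T t /\ y = t + zsc q * z) -> forall y, T y.
Proof.
induction TT as [|T TT (q & Hq & IH)].
- exists 1%Z; split; [lia|intros T []].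
- destruct (classic (@is_subgroup (addG R) T /\ exists x, ~ T x)) as [[HT Hx]|Hno].
  + destruct (proper_mod HT Hx) as (q' & Hq' & x & Hn).
    exists (q' * q)%Z; split; [nia|].
    assert (E : forall z : R, zsc (q' * q) * z = zsc q' * (zsc q * z)).
    { intros z; replace (@zsc R (q' * q)) with (@zsc R q' * zsc q); [cring|].
      rewrite <- zpow_zsc; unfold zsc; symmetry; apply (@zpow_mul (addG R)). }
    intros T' [<-|HT'] HS Hall.
    * exfalso; apply Hn; destruct (Hall x) as (t & z & Ht & ->); rewrite E; eauto.
    * apply IH; auto; intros y; destruct (Hall y) as (t & z & Ht & ->).
      exists t, (zsc q' * z); split; auto; rewrite E; cring.
  + exists q; split; auto; intros T' [<-|HT'] HS Hall y; [|now apply (IH T')].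
    apply NNPP; intros Hy; apply Hno; eauto.
Qed.
End One_ring.

(** * Ring homomorphisms and their images *)

Section Two_rings.
Variables R S : CRing.
Hypotheses (HR : rnoeth R) (HS : rnoeth S).
Add Ring Rring2 : (rth R).
Add Ring Sring2 : (rth S).

Section Hom.
Variables (F : R -> S) (HF : is_rhom F).
Lemma rhomD x y : F (x + y) = F x + F y. Proof. apply HF. Qed.
Lemma rhomM x y : F (x * y) = F x * F y. Proof. apply HF. Qed.
Lemma rhom1 : F 1 = 1. Proof. apply HF. Qed.
Lemma rhom_add : @is_hom (addG R) (addG S) F. Proof. exact rhomD. Qed.
Lemma rhom0 : F 0 = 0. Proof. apply (hom1 rhom_add). Qed.
Lemma rhom_zsc k : F (zsc k) = zsc k.
Proof.
unfold zsc; rewrite <- rhom1; apply (@hom_zpow (addG R) (addG S) F rhom_add).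
Qed.
Lemma rhom_mev l x : F (mev (map zsc l) x) = mev (map zsc l) (F x).
Proof. induction l as [|c l IH]; simpl; [apply rhom1|now rewrite rhomD, rhomM, IH, rhom_zsc]. Qed.
Lemma rhom_pow x n : F (rpow x n) = rpow (F x) n.
Proof. induction n; simpl; [apply rhom1|now rewrite rhomM, IHn]. Qed.
End Hom.

(** Both sides are additive in each argument, so multiplicativity reduces to finitely many
    equations, which a formula can express. *)
Lemma additive_mul (F : R -> S) (l : list R) : @is_hom (addG R) (addG S) F ->
  (forall x, @gen (addG R) (fun y => In y l) x) ->
  (forall a b, In a l -> In b l -> F (a * b) = F a * F b) -> forall a b, F (a * b) = F a * F b.
Proof.
intros HF Hl Hm.
assert (E0 : F 0 = 0) by apply (hom1 HF).
assert (EN : forall x, F (- x) = - F x) by apply (homV HF).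
assert (ED : forall x y, F (x + y) = F x + F y) by apply HF.
assert (Hgen : forall b, (forall a, In a l -> F (a * b) = F a * F b) -> forall a, F (a * b) = F a * F b).
{ intros b Hb a; generalize (Hl a); apply (@gen_min (addG R) _ (fun a => F (a * b) = F a * F b)); auto.
  split; [|split].
  - change (F (0 * b) = F 0 * F b); replace (0 * b) with (r0 R) by ring; rewrite E0; ring.
  - intros u v Hu Hv; change (F ((u + v) * b) = F (u + v) * F b).
    replace ((u + v) * b) with (u * b + v * b) by ring; rewrite !ED, Hu, Hv; ring.
  - intros u Hu; change (F ((- u) * b) = F (- u) * F b).
    replace ((- u) * b) with (- (u * b)) by ring; rewrite !EN, Hu; ring. }
intros a b; apply Hgen; intros a' Ha.
replace (a' * b) with (b * a') by ring; rewrite Hgen; [ring|auto].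
Qed.

(* A homomorphism is determined modulo nilpotents by finitely many roots of fixed monic integer polynomials. *)
Lemma images_mod_nilp : exists TT : list (S -> Prop), forall F : R -> S, is_rhom F ->
  exists T, In T TT /\ forall y, T y <-> exists x, nilp (y - F x).
Proof.
assert (E : forall l : list R, exists TT : list (S -> Prop), forall F : R -> S, is_rhom F ->
  exists T, In T TT /\ forall y, T y <->
    exists x, @gen (addG R) (fun y => In y l) x /\ nilp (y - F x)).
{ induction l as [|e l [TT IH]].
  - exists (nilp :: nil); intros F HF; exists nilp; split; [now left|].
    intros y; split.
    + intros Hy; exists 0; split; [apply addsub0, gen_subgroup|].
      rewrite rhom0 by auto; replace (y - 0) with y by ring; auto.
    + intros (x & Hx & Hy); replace x with (r0 R) in Hy.
      * rewrite rhom0 in Hy by auto; now replace (y - 0) with y in Hy by ring.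
      * symmetry; revert x Hx Hy; intros x Hx _; revert x Hx.
        apply (@gen_min (addG R)); [apply (sub_triv (X := addG R))|intros s []].
  - destruct (integral HR e) as [p Hp].
    destruct (nilp_roots HS (map zsc p)) as [L HL].
    exists (flat_map (fun a => map (fun (T : S -> Prop) y => exists k, T (y - zsc k * a)) TT) L).
    intros F HF; destruct (IH F HF) as (T & HT & HTy).
    destruct (HL (F e)) as (a & Ha & Hna); [now rewrite <- rhom_mev, Hp, rhom0|].
    exists (fun y => exists k, T (y - zsc k * a)); split.
    { apply in_flat_map; exists a; split; auto; apply in_map_iff; eauto. }
    intros y; split.
    + intros [k Hk]; apply HTy in Hk; destruct Hk as (x & Hx & Hk).
      exists (zsc k * e + x); split.
      * apply addsubD; [apply gen_subgroup| |].
        -- rewrite <- zpow_zsc; apply addsub_zpow; [apply gen_subgroup|apply gen_incl; now left].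
        -- revert Hx; apply (@gen_mono (addG R)); intros; now right.
      * rewrite rhomD, rhomM, rhom_zsc by auto.
        replace (y - (zsc k * F e + F x)) with ((y - zsc k * a - F x) - zsc k * (F e - a)) by ring.
        apply idealD; [apply nilp_ideal|auto|].
        apply idealN; [apply nilp_ideal|]; now apply nilp_ideal.
    + intros (x & Hx & Hk); destruct (gen_cons Hx) as (k & x' & -> & Hx').
      exists k; apply HTy; exists x'; split; auto.
      rewrite rhomD, rhomM, rhom_zsc in Hk by auto.
      replace (y - zsc k * a - F x') with ((y - (zsc k * F e + F x')) + zsc k * (F e - a)) by ring.
      apply idealD; [apply nilp_ideal|auto|]; now apply nilp_ideal. }
destruct (HR (@subT (addG R)) (fun _ H => H)) as [l Hl].
destruct (E l) as [TT HTT]; exists TT; intros F HF; destruct (HTT F HF) as (T & HT & HTy).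
exists T; split; auto; intros y; rewrite HTy; split; intros [x Hx]; exists x; [apply Hx|].
split; auto; now apply Hl.
Qed.

(** Nakayama for one nilpotent generator at a time: substituting the hypothesis into itself replaces
    [F n] by its powers modulo the remaining generators, until the power vanishes. *)
Lemma strip_nilp (F : R -> S) (HF : is_rhom F) (nl : list R) : (forall n, In n nl -> nilp n) ->
  (forall y, exists x, idl (map F nl) (y - F x)) -> forall y, exists x, F x = y.
Proof.
induction nl as [|n nl IH]; intros Hn Hall.
- intros y; destruct (Hall y) as [x Hx]; exists x; simpl in Hx.
  replace y with ((y - F x) + F x) by ring; rewrite Hx; ring.
- apply IH; [intros; apply Hn; now right|].
  assert (HI := @idl_ideal S (map F nl)).
  assert (K : forall k y, exists x z, idl (map F nl) (y - F x - rpow (F n) k * z)).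
  { induction k as [|k IHk]; intros y.
    - exists 0, y; rewrite rhom0 by auto; simpl; replace (y - 0 - 1 * y) with (r0 S) by ring.
      now apply ideal0.
    - destruct (IHk y) as (x & z & Hz), (Hall z) as (x' & r & j & E & Hj).
      exists (x + rpow n k * x'), r; rewrite rhomD, rhomM, rhom_pow by auto; simpl.
      replace (y - (F x + rpow (F n) k * F x') - F n * rpow (F n) k * r)
        with ((y - F x - rpow (F n) k * z) + rpow (F n) k * ((z - F x') - F n * r)) by ring.
      rewrite E; replace (F n * r + j - F n * r) with j by ring.
      apply idealD; auto; now apply HI. }
  destruct (Hn n) as [k Hk]; [now left|].
  intros y; destruct (K k y) as (x & z & Hz); exists x.
  rewrite <- rhom_pow, Hk, rhom0 in Hz by auto.
  now replace (y - F x) with (y - F x - 0 * z) by ring.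
Qed.

(** [q], [s] and [nl] are chosen before [F], so both conditions on [F] can be imposed by a formula.
    The clause on [R] says that the second condition holds in the source, from where it is to be
    transferred. *)
Theorem rhom_onto : exists (q : Z) (s : nat) (nl : list R), (1 <= q)%Z /\
  (forall x : R, rpow x s = 0 -> idl nl x) /\
  forall F : R -> S, is_rhom F ->
    (forall y, exists x z, y = F x + zsc q * z) ->
    (forall y, rpow y s = 0 -> idl (map F nl) y) ->
    forall y, exists x, F x = y.
Proof.
destruct images_mod_nilp as [TT HTT].
destruct (proper_mod_list HS TT) as (q & Hq & Hmod).
destruct (nilp_bound HS) as [s Hs].
destruct (HR (proj1 (nilp_ideal R)) (fun _ _ => Logic.I)) as [nl Hnl].
exists q, s, nl; split; [|split]; auto.
- intros x Hx; apply gen_idl, Hnl; now exists s.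
- intros F HF Hq' Hs'; apply (strip_nilp HF nl).
  + intros n Hn; apply (Hnl n); now apply gen_incl.
  + destruct (HTT F HF) as (T & HT & HTy).
    (* [T] is the sum of the image of [F] and the nilradical; together with [q S] it fills [S],
       hence it is all of [S]. *)
    intros y; assert (Ty : T y).
    { apply Hmod; auto.
      - split; [|split].
        + apply HTy; exists 0; rewrite rhom0 by auto; exists 1%nat; change (g_one : addG S) with (r0 S); simpl; ring.
        + intros a b Ha Hb; apply HTy in Ha, Hb; apply HTy.
          destruct Ha as [u Hu], Hb as [v Hv]; exists (u + v); rewrite rhomD by auto.
          change (nilp (a + b - (F u + F v))).
          replace (a + b - (F u + F v)) with ((a - F u) + (b - F v)) by ring.
          apply idealD; auto; apply nilp_ideal.
        + intros a Ha; apply HTy in Ha; apply HTy; destruct Ha as [u Hu]; exists (- u).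
          change (F (- u)) with (F (@g_inv (addG R) u)); rewrite (homV (rhom_add HF)).
          change (nilp (- a - - F u)); replace (- a - - F u) with (- (a - F u)) by ring.
          apply idealN; auto; apply nilp_ideal.
      - intros y'; destruct (Hq' y') as (x & z & ->); exists (F x), z; split; auto.
        apply HTy; exists x; exists 1%nat; simpl; ring. }
    apply HTy in Ty; destruct Ty as [x Hx]; exists x; auto.
Qed.
End Two_rings.

(** * The ring of scalars of a group *)

Unset Strict Implicit.
Close Scope cr_scope.

(** Scalars are graphs on the group itself, saturated under the smaller term of a layer, instead of
    maps of quotient groups. Extensionality then gives the ring axioms as plain equalities. *)
Lemma rel_ext A (e f : A -> A -> Prop) : (forall y v, e y v <-> f y v) -> e = f.
Proof. intros H; extensionality y; extensionality v; apply propositional_extensionality, H. Qed.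

Section Scalars.
Variables (X : Group) (d : nat).
Implicit Types (g h y v w z : X) (e f r : X -> X -> Prop).

Lemma ucsM i y z : ucs i y -> ucs i z -> ucs i (y · z).
Proof. apply subM, ucs_sub. Qed.
Lemma ucsV i y : ucs i y -> ucs i y⁻¹.
Proof. apply subV, ucs_sub. Qed.
Lemma ucs_one i : ucs i (1 : X).
Proof. apply sub1, ucs_sub. Qed.

(** [comm g y] and [comm g z] lie in [ucs (S i)], and commutators with such elements lie in [ucs i].
    So commutation with [g] is additive on the layers. *)
Lemma commMr i g y z : ucs (S (S i)) y -> ucs (S (S i)) z ->
  exists t, ucs i t /\ comm g (y · z) = comm g y · comm g z · t.
Proof.
intros Hy Hz; exists (comm (comm g z) (comm g y) · comm (comm g y) z); split; [|grp].
apply ucsM; [exact (Hy g (comm g z))|apply ucs_commr; exact (Hy g)].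
Qed.

Lemma commVr i g y : ucs (S (S i)) y -> exists t, ucs i t /\ comm g y⁻¹ = (comm g y)⁻¹ · t.
Proof.
intros Hy; destruct (commMr g Hy (ucsV Hy)) as (t & Ht & E).
exists t⁻¹; split; [now apply ucsV|].
rewrite g_inv_r in E; replace (comm g 1) with (1 : X) in E by grp.
replace (comm g y⁻¹) with ((comm g y)⁻¹ · (comm g y · comm g y⁻¹ · t) · t⁻¹) by grp.
rewrite <- E; grp.
Qed.

Lemma comm2_r g y z : ucs 2 y -> ucs 2 z -> comm g (y · z) = comm g y · comm g z.
Proof. intros Hy Hz; destruct (commMr g Hy Hz) as (t & -> & E); rewrite E; grp. Qed.
Lemma comm2_rV g y : ucs 2 y -> comm g y⁻¹ = (comm g y)⁻¹.
Proof. intros Hy; destruct (commVr g Hy) as (t & -> & E); rewrite E; grp. Qed.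
Lemma comm2_l g h y : ucs 2 y -> comm (g · h) y = comm g y · comm h y.
Proof.
intros Hy; replace (comm (g · h) y) with (h⁻¹ · (comm g y · h) · comm h y) by grp.
assert (K : center (comm g y)) by (apply ucs_1; exact (Hy g)).
rewrite (K h); grp.
Qed.
Lemma comm2_lV g y : ucs 2 y -> comm g⁻¹ y = (comm g y)⁻¹.
Proof.
intros Hy; apply inv_unique; rewrite <- comm2_l by auto.
rewrite g_inv_r; unfold comm; grp.
Qed.

(* [r] is the graph of a partial endomorphism of Z_(i+2)/Z_(i+1). *)
Definition good (i : nat) r : Prop :=
  (forall y v, r y v -> ucs (i + 2) y /\ ucs (i + 2) v) /\
  (forall y v y' v', r y v -> r y' v' -> r (y · y') (v · v')) /\
  (forall y v, r y v -> r y⁻¹ v⁻¹) /\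
  (forall y v, ucs (i + 1) y -> ucs (i + 1) v -> r y v) /\
  (forall w, r 1 w -> ucs (i + 1) w).

Lemma good_mul i r y v y' v' : good i r -> r y v -> r y' v' -> r (y · y') (v · v').
Proof. intros (_ & H & _); apply H. Qed.
Lemma good_inv i r y v : good i r -> r y v -> r y⁻¹ v⁻¹.
Proof. intros (_ & _ & H & _); apply H. Qed.
Lemma good_N i r y v : good i r -> ucs (i + 1) y -> ucs (i + 1) v -> r y v.
Proof. intros (_ & _ & _ & H & _); apply H. Qed.
Lemma good_fun i r w : good i r -> r 1 w -> ucs (i + 1) w.
Proof. intros (_ & _ & _ & _ & H); apply H. Qed.
Lemma good_adj i r y v y' v' : good i r -> r y v -> ucs (i + 1) y' -> ucs (i + 1) v' -> r (y · y') (v · v').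
Proof. intros Hr Hy H1 H2; apply (good_mul Hr); auto; apply Hr; auto. Qed.
Lemma good_adjr i r y v v' : good i r -> r y v -> ucs (i + 1) v' -> r y (v · v').
Proof. intros Hr Hy H; rewrite <- (g_one_r X y); apply (good_adj Hr); auto; apply ucs_one. Qed.
Lemma good_uniq i r y v v' : good i r -> r y v -> r y v' -> ucs (i + 1) (v⁻¹ · v').
Proof.
intros Hr H H'; apply Hr; replace (1 : X) with (y⁻¹ · y) by grp.
apply (good_mul Hr); auto; now apply (good_inv Hr).
Qed.
Lemma good_eqr i r y v v' : good i r -> r y v -> ucs (i + 1) (v⁻¹ · v') -> r y v'.
Proof. intros Hr H H'; rewrite <- (mulKV v v'); now apply (good_adjr Hr). Qed.

(** The extension of [e] to higher layers is forced: an element of [Z_(i+3)] is determined modulo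
    [Z_(i+2)] by its commutators modulo [Z_(i+1)], on which the previous stage acts. *)
Fixpoint lift e (i : nat) : X -> X -> Prop :=
  match i with
  | 0 => e
  | S i => fun y v => ucs (S i + 2) y /\ ucs (S i + 2) v /\ forall g, lift e i (comm g y) (comm g v)
  end.

Lemma good_lift e i : good 0 e -> good i (lift e i).
Proof.
intros He; induction i as [|i IH]; auto; cbn [lift].
assert (E2 : S i + 2 = S (i + 2)) by lia. assert (E1 : S i + 1 = S (i + 1)) by lia.
assert (E3 : S i + 2 = S (S (i + 1))) by lia.
split; [|split; [|split; [|split]]].
- tauto.
- intros y v y' v' (Hy & Hv & H) (Hy' & Hv' & H'); repeat split; [now apply ucsM|now apply ucsM|].
  rewrite E3 in *; intros g.
  destruct (commMr g Hy Hy') as (t & Ht & ->), (commMr g Hv Hv') as (s & Hs & ->).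
  apply (good_adj IH); auto; now apply (good_mul IH).
- intros y v (Hy & Hv & H); repeat split; [now apply ucsV|now apply ucsV|].
  rewrite E3 in *; intros g.
  destruct (commVr g Hy) as (t & Ht & ->), (commVr g Hv) as (s & Hs & ->).
  apply (good_adj IH); auto; now apply (good_inv IH).
- intros y v Hy Hv; split; [|split]; [apply (@ucs_le X (S i + 1)); auto; lia..|].
  rewrite E1 in *; intros g; apply (good_N IH); [exact (Hy g)|exact (Hv g)].
- intros w (_ & _ & H); rewrite E1; intros g; apply (good_fun IH).
  specialize (H g); now replace (comm g 1) with (1 : X) in H by grp.
Qed.

(** Within [Z_2] the tuple [x] detects the centre. Generating tuples do so ([gen_nondeg]), and
    unlike generation this is first-order. *)
Definition nondeg {J : Type} (x : J -> X) : Prop :=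
  forall w, ucs 2 w -> (forall j, comm (x j) w = 1) -> ucs 1 w.

(** The relation coded by [u]. If [e] satisfies [[g, e y] = [lam g, y]] and [u j = lam (x j)], it is
    the graph of [e] for nondegenerate [x]. Quantification over scalars thus becomes quantification
    over tuples. *)
Definition Phi {J : Type} (x u : J -> X) (y v : X) : Prop :=
  ucs 2 y /\ ucs 2 v /\ forall j, comm (x j) v = comm (u j) y.

Lemma central_comm1 y : ucs 1 y -> forall g, comm g y = 1.
Proof. intros H g; exact (H g). Qed.

Lemma good_Phi J (x u : J -> X) : nondeg x -> good 0 (Phi x u).
Proof.
intros Hx; split; [|split; [|split; [|split]]].
- intros y v H; split; apply H.
- intros y v y' v' (Hy & Hv & H) (Hy' & Hv' & H'); repeat split; [now apply ucsM|now apply ucsM|].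
  intros j; now rewrite !comm2_r, H, H'.
- intros y v (Hy & Hv & H); repeat split; [now apply ucsV|now apply ucsV|].
  intros j; now rewrite !comm2_rV, H.
- intros y v Hy Hv; repeat split; [now apply ucs_S|now apply ucs_S|].
  intros j; now rewrite !central_comm1.
- intros w (_ & Hw & H); apply Hx; auto; intros j; rewrite H; grp.
Qed.

Lemma nondeg_id : nondeg (fun g => g).
Proof. intros w _ H g; apply H. Qed.

(** Here [x] is the family of all elements, so the first clause is the adjoint condition. The bound
    [d] is chosen for groups of class at most [d + 2], whose layers above the centre have index at
    most [d]. *)
Definition R0 e : Prop :=
  (exists lam : X -> X, forall y v, e y v <-> Phi (fun g => g) lam y v) /\
  forall i, i <= d -> forall y, ucs (i + 2) y -> exists v, lift e i y v.

Lemma R0_good e : R0 e -> good 0 e.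
Proof.
intros [[lam H] _].
rewrite (rel_ext H); apply good_Phi, nondeg_id.
Qed.

Lemma R0_total e y : R0 e -> ucs 2 y -> exists v, e y v.
Proof. intros [_ H] Hy; exact (H 0 ltac:(lia) y Hy). Qed.

(** Both relations are saturated and single-valued modulo [Z_1], so totality of the smaller one
    forces equality. Most ring axioms below are therefore proved as inclusions. *)
Lemma rel_eq e f : good 0 e -> good 0 f -> (forall y, ucs 2 y -> exists v, e y v) ->
  (forall y v, e y v -> f y v) -> e = f.
Proof.
intros He Hf Ht H; apply rel_ext; intros y v; split; [auto|intros K].
destruct (Ht y) as [v0 Hv0]; [apply (proj1 Hf _ _ K)|].
apply (good_eqr He Hv0); apply (good_uniq Hf (H _ _ Hv0) K).
Qed.

Lemma R0_eq e f : R0 e -> R0 f -> (forall y v, e y v -> f y v) -> e = f.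
Proof.
intros He Hf; apply rel_eq; auto using R0_good; intros; now apply R0_total.
Qed.

Lemma R0_intro e (lam : X -> X) : good 0 e -> (forall y v, e y v -> Phi (fun g => g) lam y v) ->
  (forall i, i <= d -> forall y, ucs (i + 2) y -> exists v, lift e i y v) -> R0 e.
Proof.
intros He Hl Ht; split; auto; exists lam.
replace e with (Phi (fun g => g) lam); [reflexivity|symmetry; apply rel_eq; auto].
- apply good_Phi, nondeg_id.
- exact (Ht 0 ltac:(lia)).
Qed.

(** * Ring operations on the relations *)

Definition eadd e f y v := exists v1 v2, e y v1 /\ f y v2 /\ v = v1 · v2.
Definition emul e f y v := exists t, f y t /\ e t v.
Definition eneg e y v := e y v⁻¹.
Definition ezero y v := ucs 2 y /\ ucs 1 v.
Definition eone y v := ucs 2 y /\ ucs 2 v /\ ucs 1 (y⁻¹ · v).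

(** [Z_2] is commutative only modulo [Z_1]; the factor [t] absorbs the reordering in sums of
    scalars. *)
Lemma swap2 y z : ucs 2 y -> exists t, ucs 1 t /\ y · z = z · y · t.
Proof. intros Hy; exists (comm y z); split; [now apply ucs_commr|grp]. Qed.

Lemma good_eadd e f : good 0 e -> good 0 f -> good 0 (eadd e f).
Proof.
intros He Hf; split; [|split; [|split; [|split]]].
- intros y v (v1 & v2 & H1 & H2 & ->); apply (proj1 He) in H1; apply (proj1 Hf) in H2.
  split; [apply H1|apply ucsM; [apply H1|apply H2]].
- intros y v y' v' (v1 & v2 & H1 & H2 & ->) (v1' & v2' & H1' & H2' & ->).
  destruct (@swap2 v2 v1') as (t & Ht & E); [apply (proj1 Hf _ _ H2)|].
  exists (v1 · v1' ), (v2 · v2' · (v2'⁻¹ · t · v2')); repeat split.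
  + now apply (good_mul He).
  + apply (good_adjr Hf); [now apply (good_mul Hf)|now apply ucs_norm].
  + transitivity (v1 · (v2 · v1') · v2'); [grp|rewrite E].
    assert (K : center t) by now apply ucs_1.
    transitivity (v1 · v1' · v2 · (t · v2')); [|grp]; grp.
- intros y v (v1 & v2 & H1 & H2 & ->).
  destruct (@swap2 v2⁻¹ v1⁻¹) as (t & Ht & E); [apply ucsV, (proj1 Hf _ _ H2)|].
  exists (v1⁻¹), (v2⁻¹ · t); repeat split.
  + now apply (good_inv He).
  + apply (good_adjr Hf); auto; now apply (good_inv Hf).
  + rewrite invM, E; grp.
- intros y v Hy Hv; exists 1, v; split; [apply (good_N He); auto; apply ucs_one|split; [now apply (good_N Hf)|grp]].
- intros w (v1 & v2 & H1 & H2 & ->); apply ucsM; [now apply (good_fun He)|now apply (good_fun Hf)].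
Qed.

Lemma good_emul e f : good 0 e -> good 0 f -> good 0 (emul e f).
Proof.
intros He Hf; split; [|split; [|split; [|split]]].
- intros y v (t & H1 & H2); apply (proj1 Hf) in H1; apply (proj1 He) in H2; split; [apply H1|apply H2].
- intros y v y' v' (t & H1 & H2) (t' & H1' & H2'); exists (t · t').
  split; [now apply (good_mul Hf)|now apply (good_mul He)].
- intros y v (t & H1 & H2); exists t⁻¹; split; [now apply (good_inv Hf)|now apply (good_inv He)].
- intros y v Hy Hv; exists 1; split; [apply (good_N Hf)|apply (good_N He)]; auto; apply ucs_one.
- intros w (t & H1 & H2); apply (good_fun Hf) in H1; apply (good_fun He).
  replace (1 : X) with (t · t⁻¹) by grp; rewrite <- (g_one_r X w).
  apply (good_mul He); auto; apply (good_N He); [now apply ucsV|apply ucs_one].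
Qed.

Lemma good_eneg e : good 0 e -> good 0 (eneg e).
Proof.
intros He; split; [|split; [|split; [|split]]]; unfold eneg.
- intros y v H; apply (proj1 He) in H; split; [apply H|].
  rewrite <- (invK v); apply ucsV, H.
- intros y v y' v' H H'.
  destruct (@swap2 v⁻¹ v'⁻¹) as (t & Ht & E); [apply (proj1 He _ _ H)|].
  rewrite invM; replace (v'⁻¹ · v⁻¹) with (v⁻¹ · v'⁻¹ · t⁻¹) by (rewrite E; grp).
  apply (good_adjr He); [now apply (good_mul He)|now apply ucsV].
- intros y v H; now apply (good_inv He).
- intros y v Hy Hv; apply (good_N He); auto; now apply ucsV.
- intros w H; rewrite <- (invK w); apply ucsV, (good_fun He), H.
Qed.

Lemma good_ezero : good 0 ezero.
Proof.
split; [|split; [|split; [|split]]]; unfold ezero.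
- intros y v [Hy Hv]; split; auto; now apply ucs_S.
- intros y v y' v' [] []; split; now apply ucsM.
- intros y v []; split; now apply ucsV.
- intros y v Hy Hv; split; auto; now apply ucs_S.
- intros w [_ H]; exact H.
Qed.

Lemma good_eone : good 0 eone.
Proof.
replace eone with (Phi (fun g => g) (fun g => g)); [apply good_Phi, nondeg_id|].
apply rel_ext; intros y v; unfold eone; split.
- intros H; split; [apply H|split; [apply H|]].
  refine (good_uniq (i := 0) (y := y) (good_Phi (fun g => g) nondeg_id) _ H).
  split; [apply H|split; [apply H|auto]].
- intros (Hy & Hv & H); split; [auto|split; [auto|]]; intros g.
  rewrite <- (mulKV y v), comm2_r by (auto; now apply ucs_S).
  rewrite (central_comm1 H); grp.
Qed.

Lemma lift_eadd e f i : good 0 e -> good 0 f -> forall y v w,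
  lift e i y v -> lift f i y w -> lift (eadd e f) i y (v · w).
Proof.
intros He Hf; induction i as [|i IH]; intros y v w.
- intros H1 H2; now exists v, w.
- intros (Hy & Hv & H1) (_ & Hw & H2); split; [auto|split; [now apply ucsM|]]; intros g.
  replace (S i + 2) with (S (S (i + 1))) in * by lia.
  destruct (commMr g Hv Hw) as (t & Ht & ->).
  apply (good_adjr (good_lift i (good_eadd He Hf))); auto.
Qed.
Lemma lift_emul e f i : forall y v w, lift f i y v -> lift e i v w -> lift (emul e f) i y w.
Proof.
induction i as [|i IH]; intros y v w.
- intros H1 H2; now exists v.
- intros (Hy & Hv & H1) (_ & Hw & H2); split; [auto|split; [auto|]]; intros g; eauto.
Qed.
Lemma lift_eneg e i : good 0 e -> forall y v, lift e i y v -> lift (eneg e) i y v⁻¹.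
Proof.
intros He; induction i as [|i IH]; intros y v.
- intros H; unfold eneg; simpl; now rewrite invK.
- intros (Hy & Hv & H); split; [auto|split; [now apply ucsV|]]; intros g.
  replace (S i + 2) with (S (S (i + 1))) in * by lia.
  destruct (commVr g Hv) as (t & Ht & ->).
  apply (good_adjr (good_lift i (good_eneg He))); auto.
Qed.
Lemma lift_ezero i : forall y, ucs (i + 2) y -> lift ezero i y 1.
Proof.
induction i as [|i IH]; intros y Hy; [split; [auto|apply ucs_one]|].
split; [auto|split; [apply ucs_one|]]; intros g.
replace (comm g 1) with (1 : X) by grp; apply IH, Hy.
Qed.
Lemma lift_eone i : forall y, ucs (i + 2) y -> lift eone i y y.
Proof.
induction i as [|i IH]; intros y Hy; [split; [auto|split; [auto|replace (y⁻¹ · y) with (1 : X) by grp; apply ucs_one]]|].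
split; [auto|split; [auto|]]; intros g; apply IH, Hy.
Qed.

Lemma R0_add e f : R0 e -> R0 f -> R0 (eadd e f).
Proof.
intros He Hf; assert (Ge := R0_good He); assert (Gf := R0_good Hf).
destruct He as [[lam Hl] He], Hf as [[mu Hm] Hf].
apply R0_intro with (lam := fun g => lam g · mu g); [now apply good_eadd| |].
- intros y v (v1 & v2 & H1 & H2 & ->); apply Hl in H1; apply Hm in H2.
  destruct H1 as (Hy & Hv1 & H1), H2 as (_ & Hv2 & H2).
  split; [auto|split; [now apply ucsM|]]; intros g.
  now rewrite comm2_r, comm2_l, H1, H2.
- intros i Hi y Hy; destruct (He i Hi y Hy) as [v Hv], (Hf i Hi y Hy) as [w Hw].
  exists (v · w); now apply lift_eadd.
Qed.
Lemma R0_mul e f : R0 e -> R0 f -> R0 (emul e f).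
Proof.
intros He Hf; assert (Ge := R0_good He); assert (Gf := R0_good Hf).
destruct He as [[lam Hl] He], Hf as [[mu Hm] Hf].
(* Adjoints compose in the opposite order. *)
apply R0_intro with (lam := fun g => mu (lam g)); [now apply good_emul| |].
- intros y v (t & H1 & H2); apply Hm in H1; apply Hl in H2.
  destruct H1 as (Hy & Ht & H1), H2 as (_ & Hv & H2).
  split; [auto|split; [auto|]]; intros g; now rewrite H2, H1.
- intros i Hi y Hy; destruct (Hf i Hi y Hy) as [v Hv].
  destruct (He i Hi v) as [w Hw]; [apply (proj1 (good_lift i Gf) _ _ Hv)|].
  exists w; exact (lift_emul Hv Hw).
Qed.
Lemma R0_neg e : R0 e -> R0 (eneg e).
Proof.
intros He; assert (Ge := R0_good He); destruct He as [[lam Hl] He].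
apply R0_intro with (lam := fun g => (lam g)⁻¹); [now apply good_eneg| |].
- intros y v H; apply Hl in H; destruct H as (Hy & Hv & H).
  split; [auto|split; [now apply (@subV' X _ _ (ucs_sub X 2))|]]; intros g.
  rewrite comm2_lV, <- H, <- comm2_rV, invK by auto; auto.
- intros i Hi y Hy; destruct (He i Hi y Hy) as [v Hv]; exists v⁻¹; now apply lift_eneg.
Qed.
Lemma R0_zero : R0 ezero.
Proof.
apply R0_intro with (lam := fun _ => 1); [apply good_ezero| |].
- intros y v [Hy Hv]; split; [auto|split; [now apply ucs_S|]]; intros g.
  rewrite (central_comm1 Hv); grp.
- intros i Hi y Hy; exists 1; now apply lift_ezero.
Qed.
Lemma R0_one : R0 eone.
Proof.
apply R0_intro with (lam := fun g => g); [apply good_eone| |].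
- intros y v (Hy & Hv & H); split; [auto|split; [auto|]]; intros g.
  rewrite <- (mulKV y v), comm2_r by (auto; now apply ucs_S).
  rewrite (central_comm1 H); grp.
- intros i Hi y Hy; exists y; now apply lift_eone.
Qed.

Lemma eadd_comm e f : R0 e -> R0 f -> eadd e f = eadd f e.
Proof.
intros He Hf; apply R0_eq; auto using R0_add; intros y v (v1 & v2 & H1 & H2 & ->).
destruct (@swap2 v1 v2) as (t & Ht & E); [apply (proj1 (R0_good He) _ _ H1)|].
exists v2, (v1 · t); repeat split; auto; [now apply (good_adjr (R0_good He))|rewrite E; grp].
Qed.
Lemma eadd_assoc e f r : R0 e -> R0 f -> R0 r -> eadd e (eadd f r) = eadd (eadd e f) r.
Proof.
intros He Hf Hr; apply R0_eq; auto using R0_add; intros y v (v1 & v' & H1 & (v2 & v3 & H2 & H3 & ->) & ->).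
exists (v1 · v2), v3; split; [now exists v1, v2|split; [auto|grp]].
Qed.
Lemma eadd_0_l e : R0 e -> eadd ezero e = e.
Proof.
intros He; symmetry; apply R0_eq; auto using R0_add, R0_zero; intros y v H.
exists 1, v; split; [split; [apply (proj1 (R0_good He) _ _ H)|apply ucs_one]|split; [auto|grp]].
Qed.
Lemma eadd_neg e : R0 e -> eadd e (eneg e) = ezero.
Proof.
intros He; symmetry; apply R0_eq; auto using R0_add, R0_zero, R0_neg; intros y v [Hy Hv].
destruct (R0_total He Hy) as [w Hw].
exists w, (w⁻¹ · v); split; [auto|split; [|grp]]; unfold eneg.
rewrite invM, invK.
assert (K : center v⁻¹) by (now apply ucs_1, ucsV); rewrite (K w).
apply (good_adjr (R0_good He)); auto; now apply ucsV.
Qed.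
Lemma emul_1_l e : R0 e -> emul eone e = e.
Proof.
intros He; symmetry; apply R0_eq; auto using R0_mul, R0_one; intros y v H.
exists v; split; auto; apply (@lift_eone 0), (proj1 (R0_good He) _ _ H).
Qed.
Lemma emul_1_r e : R0 e -> emul e eone = e.
Proof.
intros He; symmetry; apply R0_eq; auto using R0_mul, R0_one; intros y v H.
exists y; split; auto; apply (@lift_eone 0), (proj1 (R0_good He) _ _ H).
Qed.
Lemma emul_assoc e f r : emul e (emul f r) = emul (emul e f) r.
Proof.
apply rel_ext; intros y v; split.
- intros (t & (s & H1 & H2) & H3); exists s; split; auto; now exists t.
- intros (s & H1 & (t & H2 & H3)); exists t; split; auto; now exists s.
Qed.
Lemma emul_distr_l e f r : R0 e -> R0 f -> R0 r -> emul (eadd e f) r = eadd (emul e r) (emul f r).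
Proof.
intros He Hf Hr; apply R0_eq; auto using R0_mul, R0_add.
intros y v (t & H & v1 & v2 & H1 & H2 & ->); exists v1, v2; repeat split; auto; now exists t.
Qed.
Lemma emul_distr_r e f r : R0 e -> R0 f -> R0 r -> emul r (eadd e f) = eadd (emul r e) (emul r f).
Proof.
intros He Hf Hr; symmetry; apply R0_eq; auto using R0_mul, R0_add.
intros y v (v1 & v2 & (t1 & H1 & H1') & (t2 & H2 & H2') & ->); exists (t1 · t2); split.
- now exists t1, t2.
- now apply (good_mul (R0_good Hr)).
Qed.
Lemma emul_neg_l e f : R0 e -> R0 f -> emul (eneg e) f = eneg (emul e f).
Proof. intros He Hf; apply R0_eq; auto using R0_mul, R0_neg. Qed.
Lemma emul_neg_r e f : R0 e -> R0 f -> emul e (eneg f) = eneg (emul e f).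
Proof.
intros He Hf; apply R0_eq; auto using R0_mul, R0_neg.
intros y v (t & H1 & H2); exists t⁻¹; split; auto; now apply (good_inv (R0_good He)).
Qed.
Lemma emul_0_l e : R0 e -> emul ezero e = ezero.
Proof.
intros He; apply R0_eq; auto using R0_mul, R0_zero.
intros y v (t & H1 & H2 & H3); split; [apply (proj1 (R0_good He) _ _ H1)|auto].
Qed.
Lemma emul_0_r e : R0 e -> emul e ezero = ezero.
Proof.
intros He; symmetry; apply R0_eq; auto using R0_mul, R0_zero.
intros y v [H1 H2]; exists 1; split; [split; [auto|apply ucs_one]|].
apply (good_N (R0_good He)); auto; apply ucs_one.
Qed.

(* The centre, because [R0] need not be commutative. *)
Definition RR e : Prop := R0 e /\ forall f, R0 f -> emul e f = emul f e.

Lemma RR_add e f : RR e -> RR f -> RR (eadd e f).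
Proof.
intros [He Ce] [Hf Cf]; split; [now apply R0_add|intros r Hr].
now rewrite emul_distr_l, emul_distr_r, Ce, Cf.
Qed.
Lemma RR_mul e f : RR e -> RR f -> RR (emul e f).
Proof.
intros [He Ce] [Hf Cf]; split; [now apply R0_mul|intros r Hr].
now rewrite <- emul_assoc, Cf, emul_assoc, Ce, emul_assoc.
Qed.
Lemma RR_neg e : RR e -> RR (eneg e).
Proof.
intros [He Ce]; split; [now apply R0_neg|intros r Hr].
now rewrite emul_neg_l, emul_neg_r, Ce.
Qed.
Lemma RR_zero : RR ezero.
Proof. split; [apply R0_zero|intros r Hr; now rewrite emul_0_l, emul_0_r]. Qed.
Lemma RR_one : RR eone.
Proof. split; [apply R0_one|intros r Hr; now rewrite emul_1_l, emul_1_r]. Qed.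

Definition scal : Type := {e | RR e}.
Lemma scal_eq (a b : scal) : proj1_sig a = proj1_sig b -> a = b.
Proof.
destruct a as [a Ha], b as [b Hb]; simpl; intros <-; f_equal; apply proof_irrelevance.
Qed.
Definition sadd (a b : scal) : scal := exist _ _ (RR_add (proj2_sig a) (proj2_sig b)).
Definition smul (a b : scal) : scal := exist _ _ (RR_mul (proj2_sig a) (proj2_sig b)).
Definition sneg (a : scal) : scal := exist _ _ (RR_neg (proj2_sig a)).
Definition szero : scal := exist _ _ RR_zero.
Definition sone : scal := exist _ _ RR_one.

Lemma scal_R0 (a : scal) : R0 (proj1_sig a).
Proof. apply (proj2_sig a). Qed.

Definition scalars : CRing.
Proof.
refine (@Build_CRing scal szero sone sadd smul sneg _); split; intros; apply scal_eq; simpl.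
- apply eadd_0_l, scal_R0.
- apply eadd_comm; apply scal_R0.
- apply eadd_assoc; apply scal_R0.
- apply emul_1_l, scal_R0.
- apply (proj2_sig x), scal_R0.
- apply emul_assoc.
- apply emul_distr_l; apply scal_R0.
- reflexivity.
- apply eadd_neg, scal_R0.
Defined.
End Scalars.

(** * Definability of the scalars *)

Section Coding.
Variables (X : Group) (d : nat) (J : Type) (x : J -> X).
Implicit Types (u w : J -> X) (e f : X -> X -> Prop).

Definition U u : Prop := nondeg x /\ RR d (Phi x u).
Definition codes u (a : scalars X d) : Prop := U u /\ proj1_sig a = Phi x u.

Hypothesis Hx : nondeg x.

Lemma R0_code e : R0 d e -> exists u, e = Phi x u.
Proof.
intros He; assert (Ge := R0_good He); assert (Te := fun y => R0_total (y := y) He).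
destruct He as [[lam Hl] _]; exists (fun j => lam (x j)).
apply rel_eq; auto using good_Phi.
intros y v H; apply Hl in H; destruct H as (Hy & Hv & H); split; [auto|split; auto].
Qed.

Lemma codes_ex (a : scalars X d) : exists u, codes u a.
Proof.
destruct a as [e He]; destruct (R0_code (proj1 He)) as [u ->].
exists u; split; [split; auto|auto].
Qed.
Lemma U_codes u : U u -> exists a, codes u a.
Proof. intros H; exists (exist _ _ (proj2 H)); split; auto. Qed.
Lemma codes_uniq u a b : codes u a -> codes u b -> a = b.
Proof. intros [_ H] [_ K]; apply scal_eq; congruence. Qed.
Lemma codes_same u w a b : codes u a -> codes w b -> Phi x u = Phi x w -> a = b.
Proof. intros [_ H] [_ K] E; apply scal_eq; congruence. Qed.
Lemma codes_rel u w a : codes u a -> Phi x w = Phi x u -> codes w a.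
Proof. intros [[_ H] K] E; split; [split; auto|]; congruence. Qed.

(** Codes are added coordinatewise, so they form a subgroup of a power of [X] ([U_sub]) on which
    decoding is a homomorphism. *)
Lemma Phi_add u w : R0 d (Phi x u) -> R0 d (Phi x w) ->
  Phi x (fun j => u j · w j) = eadd (Phi x u) (Phi x w).
Proof.
intros Hu Hw; symmetry; assert (K := R0_add Hu Hw).
apply rel_eq; [now apply R0_good in K|now apply good_Phi|intros; now apply (R0_total K)|].
intros y v (v1 & v2 & (Hy & Hv1 & H1) & (_ & Hv2 & H2) & ->).
split; [auto|split; [now apply ucsM|]]; intros j; now rewrite comm2_r, comm2_l, H1, H2.
Qed.
Lemma Phi_neg u : R0 d (Phi x u) -> Phi x (fun j => (u j)⁻¹) = eneg (Phi x u).
Proof.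
intros Hu; symmetry; assert (K := R0_neg Hu).
apply rel_eq; [now apply R0_good in K|now apply good_Phi|intros; now apply (R0_total K)|].
intros y v (Hy & Hv & H); split; [auto|].
assert (Hv' : ucs 2 v) by now apply (@subV' X _ _ (ucs_sub X 2)).
split; [auto|]; intros j; now rewrite comm2_lV, <- H, <- comm2_rV, invK.
Qed.
Lemma Phi_zero : Phi x (fun _ => 1) = @ezero X.
Proof.
symmetry; apply rel_eq; [apply good_ezero|now apply good_Phi|intros y Hy; exists 1; split; auto; apply ucs_one|].
intros y v [Hy Hv]; split; [auto|split; [now apply ucs_S|]]; intros j.
rewrite (central_comm1 Hv); grp.
Qed.
Lemma Phi_one : Phi x x = @eone X.
Proof.
symmetry; apply rel_eq; [apply good_eone|now apply good_Phi|intros y Hy; exists y; now apply (@lift_eone X 0)|].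
intros y v (Hy & Hv & H); split; [auto|split; [auto|]]; intros j.
rewrite <- (mulKV y v), comm2_r by (auto; now apply ucs_S).
rewrite (central_comm1 H); grp.
Qed.

Lemma codes_add u w a b : codes u a -> codes w b -> codes (fun j => u j · w j) (radd _ a b).
Proof.
intros [[_ Hu] Eu] [[_ Hw] Ew].
assert (E : Phi x (fun j => u j · w j) = eadd (Phi x u) (Phi x w)) by (apply Phi_add; [apply Hu|apply Hw]).
split; [split; auto; rewrite E; now apply RR_add|simpl; congruence].
Qed.
Lemma codes_neg u a : codes u a -> codes (fun j => (u j)⁻¹) (ropp _ a).
Proof.
intros [[_ Hu] Eu].
assert (E : Phi x (fun j => (u j)⁻¹) = eneg (Phi x u)) by (apply Phi_neg, Hu).
split; [split; auto; rewrite E; now apply RR_neg|simpl; congruence].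
Qed.
Lemma codes_zero : codes (fun _ => 1) (r0 _).
Proof. split; [split; auto; rewrite Phi_zero; apply RR_zero|simpl; now rewrite Phi_zero]. Qed.
Lemma codes_one : codes x (r1 _).
Proof. split; [split; auto; rewrite Phi_one; apply RR_one|simpl; now rewrite Phi_one]. Qed.
Lemma codes_pow u a m : codes u a -> codes (fun j => gpow (u j) m) (rmul (scalars X d) (zsc (Z.of_nat m)) a).
Proof.
intros Hu; rewrite <- zpow_zsc, zpow_nat.
induction m as [|m IH]; [apply codes_zero|exact (codes_add Hu IH)].
Qed.
Lemma U_sub : @is_subgroup (pow_group J X) U.
Proof.
split; [|split].
- apply codes_zero.
- intros u w Hu Hw; destruct (U_codes Hu) as [a Ha], (U_codes Hw) as [b Hb].
  apply (codes_add Ha Hb).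
- intros u Hu; destruct (U_codes Hu) as [a Ha]; apply (codes_neg Ha).
Qed.
End Coding.

Lemma gen_nondeg (X : Group) (J : Type) (x : J -> X) :
  (forall g, gen (fun y => exists j, y = x j) g) -> nondeg x.
Proof.
intros Hx w Hw Hj g; generalize (Hx g).
apply (@gen_min X _ (fun g => comm g w = 1)).
- split; [grp|split].
  + intros a b Ha Hb; rewrite comm2_l, Ha, Hb by auto; grp.
  + intros a Ha; rewrite comm2_lV, Ha by auto; grp.
- intros s [j ->]; auto.
Qed.

Lemma list_tuple A (l : list A) : exists n (x : I n -> A), forall a, In a l -> exists k, a = x k.
Proof.
induction l as [|a l (n & x & IH)].
- exists 0, (fun k : I 0 => match (k : Empty_set) with end); intros a [].
- exists (S n), (ocons a x); intros b [<-|Hb].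
  + now exists None.
  + destruct (IH b Hb) as [k ->]; now exists (Some k).
Qed.

(** Decoding maps a subgroup of the noetherian group [pow_group (I n) X] onto the additive group of
    scalars. *)
Lemma scalars_noeth (X : Group) c d : (forall x : X, ucs c x) -> finitely_generated X -> rnoeth (scalars X d).
Proof.
intros Hc HX; pose proof HX as [l Hl].
destruct (list_tuple l) as (n & x & Hn).
assert (Hx : nondeg x).
{ apply gen_nondeg; intros g; generalize (Hl g).
  apply gen_mono; intros s Hs; now apply Hn. }
apply (@noeth_image (pow_group (I n) X) (addG (scalars X d)) (fun _ => True) _ (@codes X d _ x)).
- now apply (@noeth_pow X c).
- apply (subT (X := addG (scalars X d))).
- intros u a w b Hu Hw; apply (codes_add Hx Hu Hw).
- intros u a Hu; apply (codes_neg Hx Hu).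
- auto.
- intros a Ha; apply (codes_uniq Ha (codes_zero d Hx)).
- intros a _; apply (codes_ex Hx).
Qed.

Section Definable_coding.
Variables (X : Group) (d : nat) (J : Type) (x : J -> X).
(** [R0] asks for a function [lam]. Here each [g] gets its own [h], which is first-order; choice
    gives back [lam] in [dR0_iff]. *)
Definition dR0 (u : J -> X) : Prop :=
  (forall g, exists h, forall y v, Phi x u y v -> comm g v = comm h y) /\
  forall i, i <= d -> forall y, ucs (i + 2) y -> exists v, lift (Phi x u) i y v.
(** Centrality is tested on coded endomorphisms only; for nondegenerate [x] these are all of them
    ([R0_code]). *)
Definition dU (u : J -> X) : Prop := nondeg x /\ dR0 u /\
  forall w, dR0 w -> forall y v, emul (Phi x u) (Phi x w) y v <-> emul (Phi x w) (Phi x u) y v.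

Lemma dR0_iff u : nondeg x -> (dR0 u <-> R0 d (Phi x u)).
Proof.
intros Hx; split; intros [H Ht].
- apply choice in H; destruct H as [lam H].
  apply R0_intro with (lam := lam); auto using good_Phi.
  intros y v K; split; [apply K|split; [apply K|]]; intros g; now apply H.
- split; auto; intros g; destruct H as [lam H]; exists (lam g).
  intros y v K; apply H in K; apply K.
Qed.
Lemma dU_iff u : dU u <-> U d x u.
Proof.
split; intros [Hx H]; split; auto.
- destruct H as [H1 H2]; apply dR0_iff in H1; auto; split; auto.
  intros f Hf; destruct (R0_code Hx Hf) as [w ->]; apply rel_ext, H2; now apply dR0_iff.
- destruct H as [H1 H2]; split; [now apply dR0_iff|].
  intros w Hw y v; rewrite H2; [reflexivity|now apply dR0_iff].
Qed.
End Definable_coding.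

Lemma deft_ren V W (r : V -> W) (t : forall X : Group, (V -> X) -> X) :
  DefT t -> DefT (fun X (e : W -> X) => t X (fun v => e (r v))).
Proof.
intros [w Hw]; exists (wsub (fun v => wvar (r v)) w); intros X e; now rewrite wev_sub, Hw.
Qed.

Ltac dterm := repeat first
  [ assumption | apply deft_var | apply deft_one | apply deft_comm | apply deft_mul | apply deft_inv
  | apply deft_gpow | match goal with H : forall k, DefT _ |- _ => apply H end
  | match goal with H : forall k, DefT _ |- _ => apply (deft_ren _ (H _)) end
  | match goal with H : DefT _ |- _ => apply (deft_ren _ H) end
  | apply (deft_wev (fun k X e => _)) | progress intros ].

(* [dspec] collects the predicates whose definability is known; it is tried before the connectives because
   [apply] would unfold these predicates. *)
Ltac dspec := fail.
Ltac ddef := repeat first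
  [ dspec | apply def_and | apply def_not | apply def_imp | apply def_bi | apply def_ex | apply def_all
  | apply def_exT | apply def_allT | apply def_allI | apply def_exlist | apply def_list
  | apply (def_eq (t := fun X e => _) (u := fun X e => _)) | progress intros ]; dterm.

Lemma def_ucs i : forall V (t : forall X : Group, (V -> X) -> X), DefT t -> Def (fun X e => ucs i (t X e)).
Proof.
induction i as [|i IH]; intros V t Ht; simpl.
- apply def_eq; dterm.
- apply def_all, (IH _ (fun X e => comm (e None) (t X (fun v => e (Some v))))); dterm.
Qed.

Definition dfam n V := I n -> forall X : Group, (V -> X) -> X.

Ltac dspec ::= apply (def_ucs _ (t := fun X e => _)).

Lemma def_nondeg n V (s : dfam n V) : (forall k, DefT (s k)) ->
  Def (fun X e => nondeg (fun k => s k X e)).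
Proof. unfold nondeg; intros Hs; ddef. Qed.
Lemma def_Phi n V (s u : dfam n V) t v : (forall k, DefT (s k)) -> (forall k, DefT (u k)) -> DefT t -> DefT v ->
  Def (fun X e => Phi (fun k => s k X e) (fun k => u k X e) (t X e) (v X e)).
Proof. unfold Phi; intros Hs Hu Ht Hv; ddef. Qed.
Lemma def_lift n i : forall V (s u : dfam n V) t v,
  (forall k, DefT (s k)) -> (forall k, DefT (u k)) -> DefT t -> DefT v ->
  Def (fun X e => lift (Phi (fun k => s k X e) (fun k => u k X e)) i (t X e) (v X e)).
Proof.
induction i as [|i IH]; intros V s u t v Hs Hu Ht Hv; cbn [lift]; [now apply def_Phi|].
apply def_and; [now apply def_ucs|apply def_and; [now apply def_ucs|]].
apply def_all, (IH _ (fun k X e => s k X (fun v => e (Some v))) (fun k X e => u k X (fun v => e (Some v)))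
  (fun X e => comm (e None) (t X (fun v => e (Some v))))
  (fun X e => comm (e None) (v X (fun v => e (Some v))))); intros; dterm.
Qed.

Ltac dspec ::= first
  [ apply (def_lift _ (s := fun k X e => _) (u := fun k X e => _) (t := fun X e => _) (v := fun X e => _))
  | apply (def_Phi (s := fun k X e => _) (u := fun k X e => _) (t := fun X e => _) (v := fun X e => _))
  | apply (def_ucs _ (t := fun X e => _)) ].

Lemma def_dR0 d n V (s u : dfam n V) : (forall k, DefT (s k)) -> (forall k, DefT (u k)) ->
  Def (fun X e => dR0 d (fun k => s k X e) (fun k => u k X e)).
Proof.
intros Hs Hu; apply (def_iff (P := fun X e =>
  (forall g, exists h, forall y v, Phi (fun k => s k X e) (fun k => u k X e) y v -> comm g v = comm h y) /\
  forall i, In i (seq 0 (S d)) -> forall y, ucs (i + 2) y ->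
    exists v, lift (Phi (fun k => s k X e) (fun k => u k X e)) i y v)); [|ddef].
intros X e; split; intros [H K]; split; auto; intros i Hi; apply K; [apply in_seq|apply in_seq in Hi]; lia.
Qed.

Lemma def_U d n V (s u : dfam n V) : (forall k, DefT (s k)) -> (forall k, DefT (u k)) ->
  Def (fun X e => U d (fun k => s k X e) (fun k => u k X e)).
Proof.
intros Hs Hu; apply (def_iff (P := fun X e => dU d (fun k => s k X e) (fun k => u k X e)));
  [intros; apply dU_iff|].
apply def_and; [now apply def_nondeg|apply def_and; [now apply def_dR0|]].
apply def_allT, def_imp; [apply (def_dR0 d (s := fun k X e => _) (u := fun k X e => _))|unfold emul]; ddef.
Qed.

Ltac dspec ::= first
  [ apply (def_U _ (s := fun k X e => _) (u := fun k X e => _))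
  | apply (def_lift _ (s := fun k X e => _) (u := fun k X e => _) (t := fun X e => _) (v := fun X e => _))
  | apply (def_Phi (s := fun k X e => _) (u := fun k X e => _) (t := fun X e => _) (v := fun X e => _))
  | apply (def_ucs _ (t := fun X e => _)) ].

(* Substitution of terms for the two arguments, in a larger set of variables, is part of the definition. *)
Definition drel V (r : forall X : Group, (V -> X) -> X -> X -> Prop) : Prop :=
  forall W (rho : V -> W) (t v : forall X : Group, (W -> X) -> X), DefT t -> DefT v ->
  Def (fun X e => r X (fun a => e (rho a)) (t X e) (v X e)).

Lemma drel_Phi n V (s u : dfam n V) : (forall k, DefT (s k)) -> (forall k, DefT (u k)) ->
  drel (fun X e => Phi (fun k => s k X e) (fun k => u k X e)).
Proof. intros Hs Hu W rho t v Ht Hv; ddef. Qed.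
Lemma drel_emul V (r s : forall X : Group, (V -> X) -> X -> X -> Prop) : drel r -> drel s ->
  drel (fun X e => emul (r X e) (s X e)).
Proof.
intros Hr Hs W rho t v Ht Hv; apply def_ex, def_and.
- apply (Hs _ (fun a => Some (rho a)) (fun X e => t X (fun v => e (Some v))) (fun X e => e None)); dterm.
- apply (Hr _ (fun a => Some (rho a)) (fun X e => e None) (fun X e => v X (fun v => e (Some v)))); dterm.
Qed.
Lemma drel_eadd V (r s : forall X : Group, (V -> X) -> X -> X -> Prop) : drel r -> drel s ->
  drel (fun X e => eadd (r X e) (s X e)).
Proof.
intros Hr Hs W rho t v Ht Hv; apply def_ex, def_ex, def_and; [|apply def_and].
- apply (Hr _ (fun a => Some (Some (rho a))) (fun X e => t X (fun v => e (Some (Some v)))) (fun X e => e (Some None))); dterm.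
- apply (Hs _ (fun a => Some (Some (rho a))) (fun X e => t X (fun v => e (Some (Some v)))) (fun X e => e None)); dterm.
- ddef.
Qed.
Lemma drel_ezero V : @drel V (fun X e => @ezero X).
Proof. intros W rho t v Ht Hv; unfold ezero; ddef. Qed.
Lemma drel_eone V : @drel V (fun X e => @eone X).
Proof. intros W rho t v Ht Hv; unfold eone; ddef. Qed.
Fixpoint epow {X : Group} (e : X -> X -> Prop) (s : nat) : X -> X -> Prop :=
  match s with 0 => @eone X | S s => emul e (epow e s) end.
Lemma drel_epow V (r : forall X : Group, (V -> X) -> X -> X -> Prop) s : drel r ->
  drel (fun X e => epow (r X e) s).
Proof. intros Hr; induction s; simpl; [apply drel_eone|now apply drel_emul]. Qed.
Lemma drel_eq V (r s : forall X : Group, (V -> X) -> X -> X -> Prop) : drel r -> drel s ->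
  Def (fun X e => r X e = s X e).
Proof.
intros Hr Hs; apply (def_iff (P := fun X e => forall y v, r X e y v <-> s X e y v)).
- intros X e; split; [apply rel_ext|now intros ->].
- apply def_all, def_all, def_bi.
  + apply (Hr _ (fun a => Some (Some a)) (fun X e => e (Some None)) (fun X e => e None)); dterm.
  + apply (Hs _ (fun a => Some (Some a)) (fun X e => e (Some None)) (fun X e => e None)); dterm.
Qed.

Ltac drels := repeat first
  [ apply drel_eq | apply drel_emul | apply drel_eadd | apply drel_ezero | apply drel_eone | apply drel_epow
  | apply (drel_Phi (s := fun k X e => _) (u := fun k X e => _)) ]; dterm.

(** * First-order clauses on ideals, congruences and spans *)

Section Clauses.
Variables (d n : nat).
Notation W := (word (I n)).
Notation C := (I n -> word (I n)).

(** Elements of [G] enter a formula as words in the generators, and the same words are then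
    evaluated at the image tuple in [H]. *)
Definition val {X : Group} (x : I n -> X) (c : C) : I n -> X := fun k => wev x (c k).

(** The first-order counterpart of [idl] ([Lin_idl]). *)
Fixpoint Lin {X : Group} (x : I n -> X) (L : list C) (u : I n -> X) : Prop :=
  match L with
  | nil => Phi x u = @ezero X
  | c :: L => exists v w, U d x v /\ U d x w /\ Lin x L w /\
      Phi x u = eadd (emul (Phi x (val x c)) (Phi x v)) (Phi x w)
  end.
(** Linear combinations of the listed elements with scalar coefficients, modulo [Z_(i+1)], which is
    the value at [nil]. *)
Fixpoint Span {X : Group} (x : I n -> X) (i : nat) (L : list W) (y : X) : Prop :=
  match L with
  | nil => ucs (i + 1) y
  | a :: L => exists u, U d x u /\ exists v z, lift (Phi x u) i (wev x a) v /\ Span x i L z /\ y = v · z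
  end.

Lemma def_Lin L : forall V (x u : dfam n V), (forall k, DefT (x k)) -> (forall k, DefT (u k)) ->
  Def (fun X e => Lin (fun k => x k X e) L (fun k => u k X e)).
Proof.
induction L as [|c L IH]; intros V x u Hx Hu; cbn [Lin]; [drels|].
apply def_exT, def_exT, def_and; [ddef|apply def_and; [ddef|apply def_and]]; [|unfold val; drels].
apply (IH _ (fun k X e => x k X (fun v => e (inr (inr v)))) (fun k X e => e (inl k))); dterm.
Qed.

Lemma def_Span i L : forall V (x : dfam n V) y, (forall k, DefT (x k)) -> DefT y ->
  Def (fun X e => Span (fun k => x k X e) i L (y X e)).
Proof.
induction L as [|a L IH]; intros V x y Hx Hy; cbn [Span]; [ddef|].
apply def_exT, def_and; [ddef|apply def_ex, def_ex, def_and; [ddef|apply def_and; [|ddef]]].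
apply (IH _ (fun k X e => x k X (fun v => e (Some (Some (inr v))))) (fun X e => e None)); dterm.
Qed.

(** Finitely many named scalars represent the ring modulo [m]. With names taken from [G], this puts
    every scalar of [H] into the image of [F] modulo [m]. *)
Definition modcl {X : Group} (x : I n -> X) (L : list C) (m : nat) : Prop :=
  forall u, U d x u -> exists c, In c L /\ exists w, U d x w /\
    Phi x u = Phi x (fun k => val x c k · gpow (w k) m).
Definition nilcl {X : Group} (x : I n -> X) (s : nat) (L : list C) : Prop :=
  forall u, U d x u -> epow (Phi x u) s = @ezero X -> Lin x L u.
Definition spancl {X : Group} (x : I n -> X) (i : nat) (L : list W) : Prop :=
  forall y, ucs (i + 2) y -> Span x i L y.

Lemma def_modcl L m : Def (fun X (e : I n -> X) => modcl e L m).
Proof.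
apply def_allT, def_imp; [ddef|apply def_exlist; intros c; apply def_exT, def_and; [ddef|unfold val; drels]].
Qed.
Lemma def_nilcl s L : Def (fun X (e : I n -> X) => nilcl e s L).
Proof.
apply def_allT, def_imp; [ddef|apply def_imp; [drels|]].
apply (def_Lin L (x := fun k X e => _) (u := fun k X e => _)); dterm.
Qed.
Lemma def_spancl i L : Def (fun X (e : I n -> X) => spancl e i L).
Proof.
apply def_all, def_imp; [ddef|].
apply (def_Span i L (x := fun k X e => _) (y := fun X e => _)); dterm.
Qed.
End Clauses.

(** * A homomorphism that is onto modulo the centre *)

Lemma epow_rpow (X : Group) d (a : scalars X d) s : proj1_sig (rpow a s) = epow (proj1_sig a) s.
Proof. induction s as [|s IH]; [reflexivity|simpl; now rewrite <- IH]. Qed.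

Section In_one_group.
Variables (X : Group) (d n : nat) (x : I n -> X).
Hypothesis Hx : nondeg x.

Lemma Lin_idl cs rs : Forall2 (fun c r => @codes X d _ x (val x c) r) cs rs ->
  forall u a, codes x u a -> (Lin d x cs u <-> idl rs a).
Proof.
induction 1 as [|c r cs rs Hcr Hl IH]; intros u a Hu; simpl.
- split; intros E.
  + apply scal_eq; rewrite (proj2 Hu), E; reflexivity.
  + subst a; now rewrite <- (proj2 Hu).
- split.
  + intros (v & w & Hv & Hw & HL & E).
    destruct (U_codes Hv) as [b Hb], (U_codes Hw) as [e He].
    exists b, e; split; [|now apply (IH w)].
    apply scal_eq; rewrite (proj2 Hu), E; simpl; now rewrite (proj2 Hcr), (proj2 Hb), (proj2 He).
  + intros (b & e & E & He).
    destruct (codes_ex Hx b) as [v Hv], (codes_ex Hx e) as [w Hw].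
    exists v, w; split; [apply Hv|split; [apply Hw|split; [now apply (IH w e)|]]].
    rewrite <- (proj2 Hu), E; simpl; now rewrite (proj2 Hcr), (proj2 Hv), (proj2 Hw).
Qed.

(** Serves to verify [spancl] in [G]: the span is a subgroup, so it contains the layer as soon as it
    contains its generators. *)
Lemma Span_sub i L : i <= d -> (forall w, In w L -> ucs (i + 2) (wev x w)) ->
  (is_subgroup (Span d x i L) /\ forall y, ucs (i + 1) y -> Span d x i L y) /\
  (forall y, Span d x i L y -> ucs (i + 2) y) /\ forall w, In w L -> Span d x i L (wev x w).
Proof.
intros Hi; induction L as [|a L IH]; intros HL; simpl.
- split; [split; [apply ucs_sub|auto]|split; [|intros w []]].
  intros y Hy; apply (@ucs_le X (i + 1)); auto; lia.
- destruct IH as ((HS & HN) & Hd & HI); [intros; apply HL; now right|].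
  assert (Ha : ucs (i + 2) (wev x a)) by (apply HL; now left).
  assert (Ua : forall u, U d x u -> good 0 (Phi x u)) by (intros; now apply good_Phi).
  assert (Hdom : forall u v, U d x u -> lift (Phi x u) i (wev x a) v -> ucs (i + 2) v).
  { intros u v Hu Hv; apply (proj1 (good_lift i (Ua u Hu)) _ _ Hv). }
  assert (Hco : forall z v, Span d x i L z -> ucs (i + 2) v -> Span d x i L (comm z v)).
  { intros z v Hz Hv; apply HN, ucs_commr.
    replace (S (i + 1)) with (i + 2) by lia; now apply Hd. }
  assert (L1 : lift (Phi x (fun _ => 1)) i (wev x a) 1)
    by (rewrite Phi_zero by auto; now apply lift_ezero).
  assert (U1 : U d x (fun _ => 1)) by apply (codes_zero d Hx).
  split; [split; [split; [|split]|]|split].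
  + exists (fun _ => 1); split; auto; exists 1, 1; split; [auto|split; [now apply sub1|grp]].
  + intros y y' (u & Hu & v & z & Hv & Hz & ->) (u' & Hu' & v' & z' & Hv' & Hz' & ->).
    exists (fun k => u k · u' k); split.
    { apply (@subM (pow_group (I n) X) _ _ _ (U_sub d Hx) Hu Hu'). }
    (* Reordering the four factors costs [comm z v'], which lies in [Z_(i+1)] and is absorbed by the
       span. *)
    exists (v · v'), (z · comm z v' · z'); split; [|split].
    * rewrite (Phi_add Hx (proj1 (proj2 Hu)) (proj1 (proj2 Hu'))); apply lift_eadd; auto.
    * apply subM; auto; apply subM; auto; apply Hco; eauto.
    * grp.
  + intros y (u & Hu & v & z & Hv & Hz & ->).
    exists (fun k => (u k)⁻¹); split.
    { apply (@subV (pow_group (I n) X) _ _ (U_sub d Hx) Hu). }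
    exists v⁻¹, (z⁻¹ · comm z⁻¹ v⁻¹); split; [|split].
    * rewrite (Phi_neg Hx (proj1 (proj2 Hu))); apply lift_eneg; auto.
    * assert (Hz' : Span d x i L z⁻¹) by now apply subV.
      apply subM; auto; apply Hco; auto; apply ucsV; eauto.
    * grp.
  + intros y Hy; exists (fun _ => 1); split; auto; exists 1, y; split; [auto|split; [auto|grp]].
  + intros y (u & Hu & v & z & Hv & Hz & ->); apply ucsM; eauto.
  + intros w [<-|Hw].
    * exists x; split; [apply (codes_one d Hx)|exists (wev x a), 1; split; [|split; [now apply sub1|grp]]].
      rewrite Phi_one by auto; now apply lift_eone.
    * exists (fun _ => 1); split; auto; exists 1, (wev x w); split; [auto|split; [auto|grp]].
Qed.
End In_one_group.

Section Central_hom.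
Variables (G H : Group) (d n : nat) (x : I n -> G).
Hypotheses (Hx : forall g, gen (fun y => exists k, y = x k) g)
  (HG : forall g : G, ucs (d + 2) g) (HH : forall h : H, ucs (d + 2) h)
  (FG : finitely_generated G) (FH : finitely_generated H) (GH : elem_equiv G H).

Notation R := (scalars G d).
Notation S := (scalars H d).

Let ndx : nondeg x := gen_nondeg Hx.

Lemma word_of : exists wd : G -> word (I n), forall g, wev x (wd g) = g.
Proof. exact (choice (fun g w => wev x w = g) (fun g => @gen_word G (I n) x g (Hx g))). Qed.

Lemma code_words : exists cw : R -> I n -> word (I n), forall r, codes x (val x (cw r)) r.
Proof.
destruct word_of as [wd Hwd]; apply (choice (fun r c => codes x (val x c) r)); intros r.
destruct (codes_ex ndx r) as [u Hu]; exists (fun k => wd (u k)).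
replace (val x _) with u; auto; extensionality k; symmetry; apply Hwd.
Qed.

(* What a finite part of the type of [x] says about a homomorphism [f : G -> H]. *)
Section Transported.
Variables (f : G -> H) (Hf : is_hom f) (rl : list R).
Hypothesis Hrl : forall r, @gen (addG R) (fun y => In y rl) r.
Let h := fun k => f (x k).
Let fu (u : I n -> G) : I n -> H := fun k => f (u k).
Hypotheses (ndh : nondeg h)
  (HU : forall r, In r rl -> exists u, codes x u r /\ U d h (fu u))
  (HC : forall c, (forall y, ucs 2 y -> comm c y = 1) -> forall y, ucs 2 y -> comm (f c) y = 1)
  (HM : forall r r', In r rl -> In r' rl -> exists u u' v, codes x u r /\ codes x u' r' /\
     codes x v (rmul R r r') /\ Phi h (fu v) = emul (Phi h (fu u)) (Phi h (fu u'))).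

(** Two codes of one scalar differ coordinatewise by elements centralizing [Z_2], and [HC] keeps
    this property under [f]. So the image of a scalar does not depend on its code. *)
Lemma Phi_transport u u' (r : R) : codes x u r -> codes x u' r -> Phi h (fu u) = Phi h (fu u').
Proof.
intros Hu Hu'; assert (E : Phi x u = Phi x u') by (rewrite <- (proj2 Hu), <- (proj2 Hu'); auto).
assert (K : forall k y, ucs 2 y -> comm (f (u k)) y = comm (f (u' k)) y).
{ intros k y Hy.
  assert (Kc : forall y, ucs 2 y -> comm ((u k)⁻¹ · u' k) y = 1).
  { intros z Hz; destruct (R0_total (proj1 (proj2 (proj1 Hu))) Hz) as [v Hv].
    assert (Hv' := Hv); rewrite E in Hv'.
    rewrite comm2_l, comm2_lV by auto.
    rewrite <- (proj2 (proj2 Hv) k), <- (proj2 (proj2 Hv') k); grp. }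
  assert (E' := HC Kc Hy).
  rewrite Hf, (homV Hf), comm2_l, comm2_lV in E' by auto.
  symmetry; now apply eq_of_div. }
apply rel_ext; intros y v; unfold Phi, fu; split; intros (Hy & Hv & Hk); split; auto; split; auto;
  intros k; rewrite Hk; auto; symmetry; auto.
Qed.

Lemma U_transport (r : R) : exists u, codes x u r /\ U d h (fu u).
Proof.
generalize (Hrl r); apply (@gen_min (addG R) _ (fun r : R => exists u, codes x u r /\ U d h (fu u))); auto.
split; [|split].
- exists (fun _ => 1); split; [apply (codes_zero d ndx)|].
  replace (fu _) with (fun _ : I n => (1 : H)); [apply (codes_zero d ndh)|].
  extensionality k; unfold fu; now rewrite (hom1 Hf).
- intros a b (u & Hu & Ku) (w & Hw & Kw); exists (fun k => u k · w k); split; [apply (codes_add ndx Hu Hw)|].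
  replace (fu _) with (fun k => fu u k · fu w k); [|extensionality k; unfold fu; now rewrite Hf].
  apply (@subM (pow_group (I n) H) _ _ _ (U_sub d ndh) Ku Kw).
- intros a (u & Hu & Ku); exists (fun k => (u k)⁻¹); split; [apply (codes_neg ndx Hu)|].
  replace (fu _) with (fun k => (fu u k)⁻¹); [|extensionality k; unfold fu; now rewrite (homV Hf)].
  apply (@subV (pow_group (I n) H) _ _ (U_sub d ndh) Ku).
Qed.

(** Additivity comes from the codes; only products need the finitely many equations [HM]. *)
Lemma scalar_map : exists F : R -> S, is_rhom F /\ forall u (r : R), codes x u r -> codes h (fu u) (F r).
Proof.
assert (E : forall r : R, exists s : S, forall u, codes x u r -> codes h (fu u) s).
{ intros r; destruct (U_transport r) as (u & Hu & Ku); destruct (U_codes Ku) as [s Hs].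
  exists s; intros w Hw; apply (codes_rel ndh Hs), (Phi_transport Hw Hu). }
apply choice in E; destruct E as [F HF].
assert (HFa : forall r r', F (radd R r r') = radd S (F r) (F r')).
{ intros r r'; destruct (codes_ex ndx r) as [u Hu], (codes_ex ndx r') as [u' Hu'].
  apply (codes_uniq (HF _ _ (codes_add ndx Hu Hu'))).
  replace (fu _) with (fun k => fu u k · fu u' k); [|extensionality k; unfold fu; now rewrite Hf].
  apply (codes_add ndh); auto. }
exists F; split; [split; [|split]|auto].
- exact HFa.
- apply (@additive_mul R S F rl); auto.
  intros r r' Hr Hr'; destruct (HM Hr Hr') as (u & u' & v & Hu & Hu' & Hv & E).
  apply scal_eq; rewrite (proj2 (HF _ _ Hv)), E; simpl.
  now rewrite (proj2 (HF _ _ Hu)), (proj2 (HF _ _ Hu')).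
- apply (codes_uniq (HF _ _ (codes_one d ndx))); apply (codes_one d ndh).
Qed.
End Transported.

Theorem central_hom (P : forall X : Group, (I n -> X) -> Prop) : Def P -> P G x ->
  exists f : G -> H, is_hom f /\ P H (fun k => f (x k)) /\
  forall y : H, exists g z, center z /\ y = f g · z.
Proof.
intros HP HPG.
assert (NG : noeth (fun _ : G => True)) by (apply (@fg_noeth G _ HG FG)).
assert (NR : rnoeth R) by apply (@scalars_noeth G _ d HG FG).
assert (NS : rnoeth S) by apply (@scalars_noeth H _ d HH FH).
destruct (rhom_onto NR NS) as (q & s & nl & Hq & Hnil & Honto).
destruct word_of as [wd Hwd]; destruct code_words as [cw Hcw].
destruct (NR _ (@subT (addG R)) (fun _ K => K)) as [rl Hrl].
assert (Hrl' : forall r, @gen (addG R) (fun y => In y rl) r) by (intros r; now apply Hrl).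
clear Hrl.
set (m := Z.to_nat q).
destruct (@fin_mod (addG R) (fun _ => True) (@subT (addG R)) (fun a b _ _ => Radd_comm (rth R) a b) m)
  as (tl & _ & Htl); [unfold m; lia|now apply NR; auto; apply (@subT (addG R))|].
(* The centralizer of [Z_2]. It is finitely generated, so finitely many words are enough to state
   [HC]. *)
assert (HCs : is_subgroup (fun c : G => forall y, ucs 2 y -> comm c y = 1)).
{ split; [intros; grp|split].
  - intros a b Ha Hb y Hy; rewrite comm2_l, Ha, Hb by auto; grp.
  - intros a Ha y Hy; rewrite comm2_lV, Ha by auto; grp. }
destruct (NG _ HCs (fun _ _ => Logic.I)) as [cl Hcl].
assert (E : forall i, exists l : list G, forall y, ucs (i + 2) y <-> gen (fun a => In a l) y).
{ intros i; apply (NG _ (ucs_sub G (i + 2)) (fun _ _ => Logic.I)). }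
apply choice in E; destruct E as [yl Hyl].
(* A value of each scalar on each element of each layer, fixed in advance in [G] so that a word can
   name it; 1 is a default outside the domain. *)
assert (E : forall p : nat * R * G, exists t, fst (fst p) <= d -> ucs (fst (fst p) + 2) (snd p) ->
   lift (proj1_sig (snd (fst p))) (fst (fst p)) (snd p) t).
{ intros [[i r] a]; simpl; destruct (classic (i <= d /\ ucs (i + 2) a)) as [[Hi Ha]|Hno].
  - destruct (proj2 (scal_R0 r) i Hi a Ha) as [t Ht]; eauto.
  - exists 1; tauto. }
apply choice in E; destruct E as [tt Htt].
set (levels := seq 0 (Datatypes.S d)).
(* After [P], the clauses supply in order: nondegeneracy, codes for [rl], the hypothesis [HC],
   products, the two conditions of [rhom_onto], spanning of the layers, the action of [rl] on
   generators of the layers, and membership of these generators in the layers. *)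
destruct (@exists_hom G H n x _ GH Hx HH (fun X e => P X e /\ nondeg e /\
  (forall c, In c (map cw rl) -> U d e (val e c)) /\
  (forall w, In w (map wd cl) -> forall y, ucs 2 y -> comm (wev e w) y = 1) /\
  (forall p, In p (list_prod rl rl) -> Phi e (val e (cw (rmul R (fst p) (snd p)))) =
      emul (Phi e (val e (cw (fst p)))) (Phi e (val e (cw (snd p))))) /\
  modcl d e (map cw tl) m /\ nilcl d e s (map cw nl) /\
  (forall i, In i levels -> spancl d e i (map wd (yl i))) /\
  (forall i, In i levels -> forall p, In p (list_prod rl (yl i)) ->
      lift (Phi e (val e (cw (fst p)))) i (wev e (wd (snd p))) (wev e (wd (tt (i, fst p, snd p))))) /\
  (forall i, In i levels -> forall a, In a (yl i) -> ucs (i + 2) (wev e (wd a)))))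
  as (f & Hf & HPH & ndh & C2 & C3 & C4 & C5 & C6 & C7 & C8 & C9).
- repeat apply def_and; auto.
  + apply (def_nondeg (s := fun k X e => _)); dterm.
  + unfold val; ddef.
  + ddef.
  + apply def_list; intros p; unfold val; drels.
  + apply def_modcl.
  + apply def_nilcl.
  + apply def_list; intros i; apply def_spancl.
  + unfold val; ddef.
  + ddef.
- assert (Hc : forall r, proj1_sig r = Phi x (val x (cw r))) by (intros r; apply Hcw).
  refine (conj HPG (conj ndx (conj _ (conj _ (conj _ (conj _ (conj _ (conj _ (conj _ _))))))))).
  + intros c K; apply in_map_iff in K; destruct K as (r & <- & _); apply Hcw.
  + intros w Hw; apply in_map_iff in Hw; destruct Hw as (c & <- & Hc'); rewrite Hwd.
    apply (Hcl c); now apply gen_incl.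
  + intros p _; now rewrite <- !Hc.
  + intros u Hu; destruct (U_codes Hu) as [a Ha].
    destruct (Htl a Logic.I) as (t & b & Ht & _ & E).
    exists (cw t); split; [now apply in_map|].
    destruct (codes_ex ndx b) as [w Hw]; exists w; split; [apply Hw|].
    rewrite <- (proj2 Ha), E, <- zpow_nat, zpow_zsc.
    exact (proj2 (codes_add ndx (Hcw t) (codes_pow ndx m Hw))).
  + intros u Hu E; destruct (U_codes Hu) as [a Ha].
    apply (@Lin_idl G d n x ndx _ nl) with (a := a); auto.
    * clear -Hcw; induction nl; simpl; constructor; auto.
    * apply Hnil, scal_eq; rewrite epow_rpow, (proj2 Ha), E; reflexivity.
  + intros i Hi y Hy; apply in_seq in Hi.
    destruct (@Span_sub G d n x ndx i (map wd (yl i))) as ((HS & _) & _ & HI); [lia| |].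
    * intros w Hw; apply in_map_iff in Hw; destruct Hw as (a & <- & Ha); rewrite Hwd.
      apply Hyl; now apply gen_incl.
    * apply Hyl in Hy; revert Hy; apply gen_min; auto; intros a Ha.
      rewrite <- (Hwd a); apply HI; now apply in_map.
  + intros i Hi [r a] Hp; apply in_seq in Hi; apply in_prod_iff in Hp; simpl.
    rewrite !Hwd, <- Hc; apply (Htt (i, r, a)); simpl; [lia|apply Hyl; now apply gen_incl].
  + intros i _ a Ha; rewrite Hwd; apply Hyl; now apply gen_incl.
- set (h := fun k => f (x k)) in *.
  assert (Ew : forall w, wev h w = f (wev x w)) by (intros w; symmetry; apply (wev_hom Hf)).
  assert (Ev : forall c, val h c = (fun k => f (val x c k))) by (intros c; extensionality k; apply Ew).
  destruct (@scalar_map f Hf rl Hrl') as (F & HF & HFc); auto.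
  { intros r Hr; exists (val x (cw r)); split; auto; rewrite <- Ev; apply C2; now apply in_map. }
  { intros c Hc y Hy; revert c Hc.
    enough (K : forall c, gen (fun y => In y cl) c -> comm (f c) y = 1) by (intros c Hc; apply K, Hcl, Hc).
    apply (@gen_min G _ (fun c => comm (f c) y = 1)).
    - split; [rewrite (hom1 Hf); grp|split].
      + intros a b Ha Hb; rewrite Hf, comm2_l, Ha, Hb by auto; grp.
      + intros a Ha; rewrite (homV Hf), comm2_lV, Ha by auto; grp.
    - intros c Hc; rewrite <- (Hwd c), <- Ew; apply C3; auto; now apply in_map. }
  { intros r r' Hr Hr'; exists (val x (cw r)), (val x (cw r')), (val x (cw (rmul R r r'))).
    split; [apply Hcw|split; [apply Hcw|split; [apply Hcw|]]]; rewrite <- !Ev; apply (C4 (r, r')); now apply in_prod. }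
  fold h in HFc.
  assert (HFv : forall r, codes h (val h (cw r)) (F r)) by (intros r; rewrite Ev; apply HFc, Hcw).
  assert (Fonto : forall b, exists r, F r = b).
  { apply Honto; auto.
    - intros b; destruct (codes_ex ndh b) as [u Hu].
      destruct (C5 u (proj1 Hu)) as (c & Hc & w & Hw & E).
      apply in_map_iff in Hc; destruct Hc as (t & <- & Ht).
      destruct (U_codes Hw) as [b' Hb']; exists t, b'.
      apply (codes_same Hu (codes_add ndh (HFv t) (codes_pow ndh m Hb'))) in E.
      rewrite E; unfold m; now rewrite Z2Nat.id by lia.
    - intros b Hb; destruct (codes_ex ndh b) as [u Hu].
      apply (@Lin_idl H d n h ndh (map cw nl) (map F nl)) with (u := u); auto.
      + clear -HFv; induction nl; simpl; constructor; auto.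
      + apply C6; [apply Hu|]; rewrite <- (proj2 Hu), <- epow_rpow, Hb; reflexivity. }
  exists f; split; [auto|split; [auto|]].
  (* A scalar [F r] sends the image of a generator of a layer into the image of [f]: the formula
     states this for [r] in [rl], and the property is additive in [r]. *)
  assert (Lf : forall i r a, i <= d -> In a (yl i) -> exists u, codes h u (F r) /\
  exists t, lift (Phi h u) i (f a) (f t)).
  { intros i r a Hi Ha; generalize (Hrl' r).
    apply (@gen_min (addG R) _ (fun r : R => exists u, codes h u (F r) /\ exists t, lift (Phi h u) i (f a) (f t))).
    - split; [|split].
      + exists (fun _ => 1); split.
        { change (codes h (fun _ => 1) (F (r0 R))); rewrite (rhom0 HF); apply (codes_zero d ndh). }
        exists 1; rewrite Phi_zero, (hom1 Hf) by auto; apply lift_ezero.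
        rewrite <- (Hwd a), <- Ew; apply (C9 i); auto; apply in_seq; lia.
      + intros b c (u & Hu & t & Ht) (w & Hw & t' & Ht'); exists (fun k => u k · w k); split.
        { change (codes h (fun k => u k · w k) (F (radd R b c))); rewrite (rhomD HF); now apply (codes_add ndh). }
        exists (t · t'); rewrite Hf, (Phi_add ndh (proj1 (proj2 (proj1 Hu))) (proj1 (proj2 (proj1 Hw)))).
        apply lift_eadd; auto; now apply good_Phi.
      + intros b (u & Hu & t & Ht); exists (fun k => (u k)⁻¹); split.
        { change (codes h (fun k => (u k)⁻¹) (F (ropp R b))).
          replace (F (ropp R b)) with (ropp S (F b)) by (symmetry; apply (homV (rhom_add HF) b)).
          now apply (codes_neg ndh). }
        exists t⁻¹; rewrite (homV Hf), (Phi_neg ndh (proj1 (proj2 (proj1 Hu)))).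
        apply lift_eneg; auto; now apply good_Phi.
    - intros b Hb; exists (val h (cw b)); split; auto; exists (tt (i, b, a)).
      assert (K : In i levels) by (apply in_seq; lia).
      specialize (C8 i K (b, a)); simpl in C8; rewrite !Ew, !Hwd in C8.
      apply C8; now apply in_prod. }
  (* Every scalar of [H] is some [F r], so a span over all scalars of [H] stays in the image of [f]
     modulo [Z_(i+1)]. *)
  assert (Sf : forall i l, i <= d -> (forall a, In a l -> In a (yl i)) ->
     forall z, Span d h i (map wd l) z -> exists g z', ucs (i + 1) z' /\ z = f g · z').
  { intros i l Hi; induction l as [|a l IH]; intros Hl z; simpl.
    - intros Hz; exists 1, z; split; auto; rewrite (hom1 Hf); grp.
    - intros (u & Hu & v & z0 & Hv & Hz & ->).
      destruct (IH (fun a Ha => Hl a (or_intror Ha)) z0 Hz) as (g & z' & Hz' & ->).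
      destruct (U_codes Hu) as [b Hb]; destruct (Fonto b) as [r Hr].
      destruct (Lf i r a Hi (Hl a (or_introl eq_refl))) as (u' & Hu' & t & Ht).
      assert (EP : Phi h u = Phi h u') by (rewrite <- (proj2 Hb), <- (proj2 Hu'), Hr; auto).
      rewrite EP, Ew, Hwd in Hv.
      assert (K := good_uniq (good_lift i (good_Phi u' ndh)) Ht Hv).
      exists (t · g), ((f g)⁻¹ · ((f t)⁻¹ · v) · f g · z'); split.
      + apply ucsM; auto; now apply ucs_norm.
      + rewrite Hf; grp. }
  (* Descent through the upper central series from [H = Z_(d+2)]. It stops at the centre, reached
     for [k = d + 1], since scalars act only on the layers above it. *)
  assert (Down : forall k, k <= d + 1 -> forall y : H, exists g z, ucs (d + 2 - k) z /\ y = f g · z).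
  { induction k as [|k IH]; intros Hk y.
    - exists 1, y; rewrite Nat.sub_0_r, (hom1 Hf); split; [apply HH|grp].
    - destruct IH with (y := y) as (g & z & Hz & ->); [lia|].
      assert (Hi : In (d - k) levels) by (apply in_seq; lia).
      replace (d + 2 - k) with (d - k + 2) in Hz by lia.
      destruct (Sf (d - k) (yl (d - k)) ltac:(lia) (fun a Ha => Ha) z (C7 _ Hi z Hz)) as (g' & z' & Hz' & ->).
      exists (g · g'), z'; replace (d + 2 - Datatypes.S k) with (d - k + 1) by lia; split; auto.
      rewrite Hf; grp. }
  intros y; destruct (Down (d + 1) (le_n _) y) as (g & z & Hz & E).
  replace (d + 2 - (d + 1)) with 1%nat in Hz by lia; exists g, z; split; auto; now apply ucs_1.
Qed.
End Central_hom.

(** * Commutator width *)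

Section Lower_central.
Variable G : Group.
Implicit Types (a b g h x y z t p : G).

Lemma lcs_sub i : is_subgroup (lcs G i).
Proof. destruct i; [apply subT|apply gen_subgroup]. Qed.
Lemma lcs_comm i x y : lcs G i x -> lcs G (S i) (comm x y).
Proof. intros H; apply gen_incl; eauto. Qed.
Lemma lcs_comm' i x y : lcs G i x -> lcs G (S i) (comm y x).
Proof.
intros H; replace (comm y x) with (comm x y)⁻¹ by grp.
apply subV; [apply lcs_sub|now apply lcs_comm].
Qed.
Lemma lcs_norm i g x : lcs G i x -> lcs G i (g⁻¹ · x · g).
Proof.
revert g x; induction i as [|i IH]; intros g x; [auto|].
apply (@gen_min G _ (fun x => lcs G (S i) (g⁻¹ · x · g))).
- apply (@hom_preim G G (fun x => g⁻¹ · x · g)); [intros u v; grp|apply lcs_sub].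
- intros s (u & v & Hu & ->).
  replace (g⁻¹ · comm u v · g) with (comm (g⁻¹ · u · g) (g⁻¹ · v · g)) by grp.
  now apply lcs_comm, IH.
Qed.

Lemma nilpotent_ucs : nilpotent G -> exists c, forall g, ucs c g.
Proof.
intros [c Hc]; exists c.
assert (E : forall k, k <= c -> forall x, lcs G (c - k) x -> ucs k x).
{ induction k as [|k IH]; intros Hk x Hx.
  - apply Hc; now rewrite Nat.sub_0_r in Hx.
  - intros g; apply IH; [lia|].
    replace (c - k) with (S (c - S k)) by lia; now apply lcs_comm'. }
intros g; apply (E c); [lia|]; rewrite Nat.sub_diag; exact Logic.I.
Qed.

(** One commutator for each entry of [l], in this order, with the second argument free in [A]: the
    number of factors is fixed at [length l]. *)
Fixpoint comm_prod (A : G -> Prop) (l : list G) (t : G) : Prop :=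
  match l with
  | nil => t = 1
  | x :: l => exists g p, A g /\ comm_prod A l p /\ t = comm x g · p
  end.

Section Modulo.
Variable j : nat.
Let N := lcs G (S (S j)).
(** [lcs G 0] is the whole group, so in the usual numbering from 1 this is congruence modulo the
    term of index [j + 3]. *)
Definition eqm x y : Prop := N (x⁻¹ · y).

Instance eqm_equiv : Equivalence eqm.
Proof.
split.
- intros x; unfold eqm; rewrite g_inv_l; apply sub1, lcs_sub.
- intros x y H; unfold eqm; replace (y⁻¹ · x) with (x⁻¹ · y)⁻¹ by grp.
  apply subV; auto; apply lcs_sub.
- intros x y z H K; unfold eqm; replace (x⁻¹ · z) with (x⁻¹ · y · (y⁻¹ · z)) by grp.
  apply subM; auto; apply lcs_sub.
Qed.
Instance eqm_mul : Proper (eqm ==> eqm ==> eqm) (@g_op G).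
Proof.
intros x x' Hx y y' Hy; unfold eqm.
replace ((x · y)⁻¹ · (x' · y')) with ((y⁻¹ · (x⁻¹ · x') · y) · (y⁻¹ · y')) by grp.
apply subM; [apply lcs_sub|now apply lcs_norm|auto].
Qed.
Instance eqm_inv : Proper (eqm ==> eqm) (@g_inv G).
Proof.
intros x x' Hx; unfold eqm.
replace (x⁻¹⁻¹ · x'⁻¹) with ((x⁻¹)⁻¹ · (x⁻¹ · x')⁻¹ · x⁻¹) by grp.
apply lcs_norm, subV; auto; apply lcs_sub.
Qed.
Lemma eqm_1 x : eqm 1 x <-> N x.
Proof. unfold eqm; now grp. Qed.

Lemma eqm_central c g : lcs G (S j) c -> eqm (c · g) (g · c).
Proof.
intros H; unfold eqm; replace ((c · g)⁻¹ · (g · c)) with (comm g c) by grp.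
now apply lcs_comm'.
Qed.
Lemma eqm_comm_l g h a : lcs G j a -> eqm (comm (g · h) a) (comm g a · comm h a).
Proof.
intros Ha; replace (comm (g · h) a) with (h⁻¹ · (comm g a · h) · comm h a) by grp.
rewrite (eqm_central h (lcs_comm' g Ha)); grp.
Qed.
Lemma eqm_comm_lV g a : lcs G j a -> eqm (comm g⁻¹ a) (comm g a)⁻¹.
Proof.
intros Ha; replace (comm g⁻¹ a) with (comm g⁻¹ a · comm g a · (comm g a)⁻¹) by grp.
rewrite <- (eqm_comm_l g⁻¹ g Ha); rewrite g_inv_l; replace (comm 1 a) with (1 : G) by grp.
now rewrite g_one_l.
Qed.
(** Modulo [N], [comm _ a] is a homomorphism into a central subgroup, so it kills commutators. No
    three subgroups lemma is involved. *)
Lemma derived_comm c a : derived G c -> lcs G j a -> N (comm c a).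
Proof.
intros Hc Ha; apply eqm_1; revert c Hc.
apply (@gen_min G _ (fun c => eqm 1 (comm c a))).
- split; [replace (comm 1 a) with (1 : G) by grp; reflexivity|split].
  + intros x y Hx Hy; rewrite eqm_comm_l, <- Hx, <- Hy by auto; now rewrite g_one_l.
  + intros x Hx; rewrite eqm_comm_lV, <- Hx by auto; now rewrite inv1.
- intros s (x & y & ->); unfold comm at 2.
  rewrite !eqm_comm_l, !eqm_comm_lV by auto.
  rewrite mulA'.
  rewrite (eqm_central (comm y a) (lcs_comm' x Ha)).
  grp.
Qed.
Lemma eqm_comm_r x g a : lcs G j a -> eqm (comm x (g · a)) (comm x g · comm x a).
Proof.
intros Ha; replace (comm x (g · a)) with (comm x a · comm x g · comm (comm x g) a) by grp.
assert (K : eqm (comm (comm x g) a) 1).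
{ symmetry; apply eqm_1, derived_comm; auto; apply gen_incl; eauto. }
rewrite K, g_one_r; apply eqm_central; now apply lcs_comm'.
Qed.

(** A factor built from [lcs G j] is absorbed by changing each [g] into [g · a], so a product is
    corrected without becoming longer. *)
Lemma comm_prod_mul (A : G -> Prop) l : (forall g a, A g -> lcs G j a -> A (g · a)) ->
  forall p q, comm_prod A l p -> comm_prod (lcs G j) l q ->
  exists r, comm_prod A l r /\ eqm r (p · q).
Proof.
intros HA; induction l as [|x l IH]; intros p q; simpl.
- intros -> ->; exists 1; split; auto; grp.
- intros (g & p' & Hg & Hp & ->) (a & q' & Ha & Hq & ->).
  destruct (IH p' q' Hp Hq) as (r & Hr & E).
  exists (comm x (g · a) · r); split; [exists (g · a), r; auto|].
  rewrite E, eqm_comm_r by auto; rewrite !mulA'.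
  rewrite <- (mulA' p'), <- (eqm_central p' (lcs_comm' x Ha)); rewrite !mulA'; reflexivity.
Qed.

Lemma comm_prod_inv l : forall p, comm_prod (lcs G j) l p -> exists r, comm_prod (lcs G j) l r /\ eqm r p⁻¹.
Proof.
induction l as [|x l IH]; intros p; simpl.
- intros ->; exists 1; split; auto; grp.
- intros (g & p' & Hg & Hp & ->); destruct (IH p' Hp) as (r & Hr & E).
  assert (Hg' : lcs G j g⁻¹) by (apply subV; auto; apply lcs_sub).
  exists (comm x g⁻¹ · r); split; [exists g⁻¹, r; auto|].
  rewrite E, invM.
  assert (K : eqm (comm x g⁻¹) (comm x g)⁻¹).
  { replace (comm x g⁻¹) with ((comm x g)⁻¹ · (comm x g · comm x g⁻¹)) by grp.
    rewrite <- (eqm_comm_r x g Hg'), g_inv_r; replace (comm x 1) with (1 : G) by grp.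
    now rewrite g_one_r. }
  rewrite K; apply eqm_central, subV; [apply lcs_sub|now apply lcs_comm'].
Qed.

Lemma comm_prod_1 (A : G -> Prop) l : A 1 -> comm_prod A l 1.
Proof.
intros H; induction l as [|x l IH]; simpl; auto; exists 1, 1; repeat split; auto; grp.
Qed.
Lemma comm_prod_In (A : G -> Prop) l x b : A 1 -> A b -> In x l -> comm_prod A l (comm x b).
Proof.
intros H1 Hb; induction l as [|y l IH]; [intros []|intros [->|Hx]]; simpl.
- exists b, 1; repeat split; auto; [now apply comm_prod_1|grp].
- exists 1, (comm x b); repeat split; auto; grp.
Qed.

Lemma lcs_comm_prod l : (forall g, gen (fun y => In y l) g) ->
  forall t, lcs G (S j) t -> exists p, comm_prod (lcs G j) l p /\ eqm p t.
Proof.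
intros Hl.
assert (H1 : lcs G j 1) by apply sub1, lcs_sub.
assert (HT : is_subgroup (fun t => exists p, comm_prod (lcs G j) l p /\ eqm p t)).
{ split; [exists 1; split; [now apply comm_prod_1|reflexivity]|split].
  - intros s t (p & Hp & Ep) (q & Hq & Eq).
    destruct (@comm_prod_mul (lcs G j) l) with (p := p) (q := q) as (r & Hr & Er); auto.
    { intros; apply subM; auto; apply lcs_sub. }
    exists r; split; auto; now rewrite Er, Ep, Eq.
  - intros s (p & Hp & Ep); destruct (comm_prod_inv Hp) as (r & Hr & Er).
    exists r; split; auto; now rewrite Er, Ep. }
assert (HC : forall y b, lcs G j b -> exists p, comm_prod (lcs G j) l p /\ eqm p (comm y b)).
{ intros y b Hb; generalize (Hl y).
  apply (@gen_min G _ (fun y => exists p, comm_prod (lcs G j) l p /\ eqm p (comm y b))).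
  - split; [replace (comm 1 b) with (1 : G) by grp; apply HT|split].
    + intros u v Hu Hv; destruct (proj1 (proj2 HT) _ _ Hu Hv) as (p & Hp & Ep).
      exists p; split; auto; now rewrite Ep, <- eqm_comm_l.
    + intros u Hu; destruct (proj2 (proj2 HT) _ Hu) as (p & Hp & Ep).
      exists p; split; auto; now rewrite Ep, <- eqm_comm_lV.
  - intros x Hx; exists (comm x b); split; [now apply comm_prod_In|reflexivity]. }
apply gen_min; auto.
intros s (b & y & Hb & ->); replace (comm b y) with (comm y b)⁻¹ by grp.
apply (proj2 (proj2 HT)); auto.
Qed.
End Modulo.

Lemma derived_lcs g : derived G g -> lcs G 1 g.
Proof. apply gen_mono; intros s (x & y & ->); exists x, y; simpl; auto. Qed.

Theorem commutator_width l : nilpotent G -> (forall g, gen (fun y => In y l) g) ->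
  forall t, derived G t -> comm_prod (fun _ => True) l t.
Proof.
intros [c Hc] Hl t Ht.
(* Successive approximation along the lower central series, always with the same number of
   commutators. *)
assert (E : forall i, exists p, comm_prod (fun _ => True) l p /\ lcs G (S i) (p⁻¹ · t)).
{ induction i as [|i (p & Hp & E)].
  - exists 1; split; [now apply comm_prod_1|grp; now apply derived_lcs].
  - destruct (lcs_comm_prod Hl E) as (q & Hq & Eq).
    destruct (@comm_prod_mul i (fun _ => True) l) with (p := p) (q := q) as (r & Hr & Er); auto.
    exists r; split; auto; change (eqm i r t).
    destruct (eqm_equiv i) as [_ _ Htr]; apply (Htr _ (p · q)); auto.
    assert (K := eqm_mul (j := i) (x := p) (y := p) (@Equivalence_Reflexive _ _ (eqm_equiv i) p) Eq).
    now rewrite mulKV in K. }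
destruct (E c) as (p & Hp & Ep).
(* [Hc] concerns [lcs G c], the approximation [lcs G (S c)]; what remains is the inclusion of the
   second in the first. *)
replace t with p; auto; symmetry; apply eq_of_div, Hc.
revert Ep; generalize (p⁻¹ · t); intros s; simpl; apply gen_min; [apply lcs_sub|].
intros u (x & y & Hx & ->).
replace (comm x y) with (x⁻¹ · (y⁻¹ · x · y)) by grp.
apply subM; [apply lcs_sub|apply subV; auto; apply lcs_sub|now apply lcs_norm].
Qed.
End Lower_central.

(** * Finitely generated abelian groups *)

Section Subgroup_type.
Variables (X : Group) (B : X -> Prop).
Hypothesis HB : is_subgroup B.

Lemma sig_eq (s t : {x | B x}) : proj1_sig s = proj1_sig t -> s = t.
Proof. destruct s as [x Hx], t as [y Hy]; simpl; intros <-; f_equal; apply proof_irrelevance. Qed.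

Definition sub_group : Group.
Proof.
refine (@Build_Group {x | B x}
  (fun s t => exist _ (proj1_sig s · proj1_sig t) (proj1 (proj2 HB) _ _ (proj2_sig s) (proj2_sig t)))
  (fun s => exist _ (proj1_sig s)⁻¹ (proj2 (proj2 HB) _ (proj2_sig s)))
  (exist _ 1 (proj1 HB)) _ _ _ _ _); intros; apply sig_eq; simpl; grp.
Defined.
Definition sub_val (s : sub_group) : X := proj1_sig s.
Lemma sub_val_hom : is_hom sub_val.
Proof. intros s t; reflexivity. Qed.
Lemma sub_valP s : B (sub_val s).
Proof. exact (proj2_sig s). Qed.
Lemma sub_val_inj s t : sub_val s = sub_val t -> s = t.
Proof. apply sig_eq. Qed.
Lemma sub_group_noeth : noeth B -> noeth (fun _ : sub_group => True).
Proof.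
intros HN; apply (@noeth_image X sub_group B (fun _ => True) (fun x s => sub_val s = x)); auto.
- apply subT.
- intros x s y t <- <-; reflexivity.
- intros x s <-; reflexivity.
- intros x s <-; apply sub_valP.
- intros s Hs; now apply sub_val_inj.
- intros s _; eauto.
Qed.
End Subgroup_type.

Fixpoint mprod {X : Group} r : (I r -> X) -> (I r -> Z) -> X :=
  match r with
  | 0 => fun _ _ => 1
  | S r => fun w c => zpow (w None) (c None) · mprod (fun k => w (Some k)) (fun k => c (Some k))
  end.

Lemma mprod_hom (X Y : Group) (f : X -> Y) : is_hom f -> forall r (w : I r -> X) c,
  f (mprod w c) = mprod (fun k => f (w k)) c.
Proof.
intros Hf; induction r as [|r IH]; intros w c; simpl; [now apply hom1|].
now rewrite Hf, (hom_zpow Hf), IH.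
Qed.

Section Commutative.
Variable T : Group.
Hypothesis Tc : forall a b : T, a · b = b · a.
Implicit Types (a b v y : T).

Lemma swap4 a b u v : a · b · (u · v) = a · u · (b · v).
Proof. rewrite !mulA'; f_equal; rewrite <- !mulA'; f_equal; apply Tc. Qed.

Lemma mprod_add r : forall (w : I r -> T) c c',
  mprod w (fun k => (c k + c' k)%Z) = mprod w c · mprod w c'.
Proof.
induction r as [|r IH]; intros w c c'; simpl; [grp|].
now rewrite zpow_add, IH, swap4.
Qed.
Lemma mprod_zero r : forall (w : I r -> T), mprod w (fun _ => 0%Z) = 1.
Proof. induction r as [|r IH]; intros w; simpl; auto; rewrite IH; grp. Qed.
Lemma mprod_opp r (w : I r -> T) c : mprod w (fun k => (- c k)%Z) = (mprod w c)⁻¹.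
Proof.
apply inv_unique; rewrite <- mprod_add, <- (mprod_zero w); f_equal.
extensionality k; lia.
Qed.

Section Three_elements.
Variables y a b : T.
(** A normal form for products of powers of three commuting elements: the tactic [lin] reduces
    identities between them to identities of integer exponents. *)
Definition lin3 i j k : T := zpow y i · (zpow a j · zpow b k).
Lemma lin3M i j k i' j' k' : lin3 i j k · lin3 i' j' k' = lin3 (i + i') (j + j') (k + k').
Proof. unfold lin3; rewrite !zpow_add, swap4; f_equal; apply swap4. Qed.
Lemma lin3X i j k n : zpow (lin3 i j k) n = lin3 (n * i) (n * j) (n * k).
Proof. unfold lin3; rewrite !zpow_mulc by apply Tc; now rewrite !zpow_mul. Qed.
Lemma lin3V i j k : (lin3 i j k)⁻¹ = lin3 (- i) (- j) (- k).
Proof.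
symmetry; apply inv_unique; rewrite lin3M, !Z.add_opp_diag_r; unfold lin3; simpl; grp.
Qed.
Lemma lin3_1 i : zpow y i = lin3 i 0 0. Proof. unfold lin3; simpl; grp. Qed.
Lemma lin3_2 i : zpow a i = lin3 0 i 0. Proof. unfold lin3; simpl; grp. Qed.
Lemma lin3_3 i : zpow b i = lin3 0 0 i. Proof. unfold lin3; simpl; grp. Qed.
End Three_elements.
Ltac lin y a b := rewrite ?(lin3_1 y a b), ?(lin3_2 y a b), ?(lin3_3 y a b), ?invM;
  repeat rewrite ?lin3X, ?lin3V, ?lin3M; f_equal; try nia.

Section Isolated.
Variable N : T -> Prop.
(** Equivalently, [N] is a subgroup and [T / N] is torsion-free. *)
Definition isolated : Prop := is_subgroup N /\ forall b k, k <> 0%Z -> N (zpow b k) -> N b.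

Hypothesis HN : isolated.

Lemma iso_sub : is_subgroup N. Proof. apply HN. Qed.

(* The exponents [i] and [j] are Bezout coefficients of [P] and [Q]. *)
Lemma common_root b v P Q : P <> 0%Z -> N ((zpow v Q)⁻¹ · zpow b P) ->
  exists u i j k l, u = zpow b i · zpow v j /\ N ((zpow u k)⁻¹ · b) /\ N ((zpow u l)⁻¹ · v).
Proof.
intros HP H; assert (HS := iso_sub).
destruct (Z.gcd_divide_l P Q) as [P' EP], (Z.gcd_divide_r P Q) as [Q' EQ].
assert (Hg : Z.gcd P Q <> 0%Z) by (intros E; apply Z.gcd_eq_0_l in E; auto).
destruct (Z.gcd_bezout P Q _ eq_refl) as (al & be & Bz).
assert (B1 : (al * P' + be * Q' = 1)%Z) by nia.
assert (H' : N ((zpow v Q')⁻¹ · zpow b P')).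
{ apply (proj2 HN) with (k := Z.gcd P Q); auto.
  replace (zpow ((zpow v Q')⁻¹ · zpow b P') (Z.gcd P Q)) with ((zpow v Q)⁻¹ · zpow b P); auto.
  lin v b b. }
exists (zpow b be · zpow v al), be, al, Q', P'; split; [auto|].
split.
- replace ((zpow (zpow b be · zpow v al) Q')⁻¹ · b) with (zpow ((zpow v Q')⁻¹ · zpow b P') al);
    [now apply sub_zpow|].
  rewrite <- (zpow_1r b) at 3; lin v b b.
- replace ((zpow (zpow b be · zpow v al) P')⁻¹ · v) with (zpow ((zpow v Q')⁻¹ · zpow b P') (- be));
    [now apply sub_zpow|].
  rewrite <- (zpow_1r v) at 3; lin v b b.
Qed.
End Isolated.

Hypothesis TN : noeth (fun _ : T => True).

(** The elements with a nonzero power in the group generated by [N] and [y]. For isolated [N] and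
    [y] outside it, the quotient by [N] has rank one. *)
Definition pure_hull (N : T -> Prop) y b : Prop :=
  exists k j, k <> 0%Z /\ N ((zpow y j)⁻¹ · zpow b k).

Lemma pure_hull_sub N y : isolated N -> is_subgroup (pure_hull N y).
Proof.
intros HN; assert (HS := iso_sub HN); split; [|split].
- exists 1%Z, 0%Z; split; [lia|]; rewrite zpow_1l; simpl; grp; now apply sub1.
- intros a b (k & j & Hk & Ha) (l & i & Hl & Hb); exists (k * l)%Z, (j * l + i * k)%Z; split; [lia|].
  assert (E : N (zpow ((zpow y j)⁻¹ · zpow a k) l · zpow ((zpow y i)⁻¹ · zpow b l) k)).
  { apply subM; auto; now apply sub_zpow. }
  replace ((zpow y (j * l + i * k))⁻¹ · zpow (a · b) (k * l)) with
    (zpow ((zpow y j)⁻¹ · zpow a k) l · zpow ((zpow y i)⁻¹ · zpow b l) k); auto.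
  rewrite (@zpow_mulc T a b (k * l)%Z (Tc a b)); lin y a b.
- intros a (k & j & Hk & Ha); exists (- k)%Z, j; split; [lia|].
  replace (zpow a⁻¹ (- k)) with (zpow a k); auto.
  replace a⁻¹ with (zpow a (-1)) by (simpl; grp); rewrite <- zpow_mul; f_equal; lia.
Qed.

Lemma pure_hull_isolated N y : isolated N -> isolated (pure_hull N y).
Proof.
intros HN; split; [now apply pure_hull_sub|].
intros b k Hk (l & j & Hl & H); exists (l * k)%Z, j; split; [lia|]; now rewrite zpow_mul.
Qed.

(** Noetherian induction on [cyc v]: an element of the hull outside [cyc v] has a common root [u]
    with [v], and [cyc u] is larger. A maximal such subgroup is the whole hull. *)
Lemma pure_hull_cyclic N y : isolated N -> ~ N y ->
  exists u, pure_hull N y u /\ forall b, pure_hull N y b -> exists j, N ((zpow u j)⁻¹ · b).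
Proof.
intros HN Hy; assert (HS := iso_sub HN).
set (cyc := fun v b => exists j, N ((zpow v j)⁻¹ · b)).
assert (Hcyc : forall v, is_subgroup (cyc v)).
{ intros v; split; [|split].
  - exists 0%Z; simpl; grp; now apply sub1.
  - intros a b [j Ha] [i Hb]; exists (j + i)%Z; rewrite <- zpow_opp.
    replace (- (j + i))%Z with (- j + - i)%Z by lia.
    rewrite zpow_add, swap4, !zpow_opp; now apply subM.
  - intros a [j Ha]; exists (- j)%Z; rewrite zpow_opp, Tc, <- invM; now apply subV. }
assert (HP := pure_hull_sub y HN).
assert (E : forall S : T -> Prop, is_subgroup S -> (forall x, S x -> True) ->
  forall v, pure_hull N y v -> (forall b, S b <-> cyc v b) ->
  exists u, pure_hull N y u /\ forall b, pure_hull N y b -> cyc u b).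
{ apply (@noeth_ind T (fun _ => True) (fun S => forall v, pure_hull N y v -> (forall b, S b <-> cyc v b) ->
    exists u, pure_hull N y u /\ forall b, pure_hull N y b -> cyc u b)); auto.
  intros S _ _ IH v Hv HSv.
  destruct (classic (forall b, pure_hull N y b -> cyc v b)) as [K|K]; [eauto|].
  apply not_all_ex_not in K; destruct K as [b K]; apply imply_to_and in K; destruct K as [Hb Hnb].
  assert (W : exists u, pure_hull N y u /\ cyc u b /\ cyc u v).
  { destruct (classic (N v)) as [Nv|Nv].
    - exists b; split; auto; split; [exists 1%Z; rewrite zpow_1r; grp; now apply sub1|exists 0%Z; simpl; now grp].
    - destruct Hv as (l & i & Hl & Hv), Hb as (p & j & Hp & Hb).
      assert (Hi : i <> 0%Z).
      { intros ->; apply Nv, (proj2 HN) with (k := l); auto; simpl in Hv; now grp_in Hv. }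
      (* [y] is eliminated between [b^p = y^j] and [v^l = y^i] modulo [N], which gives the exponents
         [p * i] and [l * j]. *)
      destruct (@common_root N HN b v (p * i) (l * j)) as (u & i' & j' & k & m & Eu & H1 & H2); [lia| |].
      + replace ((zpow v (l * j))⁻¹ · zpow b (p * i)) with
          (zpow ((zpow y j)⁻¹ · zpow b p) i · zpow ((zpow y i)⁻¹ · zpow v l) (- j)).
        { apply subM; auto; now apply sub_zpow. }
        lin y v b.
      + exists u; split; [|split; [now exists k|now exists m]].
        subst u; apply subM; auto; apply sub_zpow; auto; [exists p, j|exists l, i]; auto. }
  destruct W as (u & Hu & [k Hk] & [m Hm]).
  apply (IH (cyc u)) with (v := u); auto; [|exists b; split; [now exists k|now rewrite HSv]|reflexivity].
  intros x Hx; apply HSv in Hx; destruct Hx as [j Hx].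
  assert (Hv' : cyc u (zpow v j)) by (apply sub_zpow; auto; now exists m).
  destruct Hv' as [i Hi]; exists i.
  replace ((zpow u i)⁻¹ · x) with ((zpow u i)⁻¹ · zpow v j · ((zpow v j)⁻¹ · x)) by grp.
  now apply subM. }
apply (E (cyc y) (Hcyc y) (fun _ _ => Logic.I) y); [|reflexivity].
exists 1%Z, 1%Z; split; [lia|grp; now apply sub1].
Qed.

(** Noetherian induction on [N]: replace it by the pure hull of an outside element, and add a
    generator of the hull modulo [N] to the basis obtained there. *)
Lemma basis_mod N : isolated N -> exists r (w : I r -> T),
  (forall b, exists c, N ((mprod w c)⁻¹ · b)) /\ (forall c, N (mprod w c) -> forall k, c k = 0%Z).
Proof.
intros HN; assert (HS := iso_sub HN).
enough (E : forall N, is_subgroup N -> (forall x, N x -> True) -> isolated N -> exists r (w : I r -> T),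
  (forall b, exists c, N ((mprod w c)⁻¹ · b)) /\ (forall c, N (mprod w c) -> forall k, c k = 0%Z)) by auto.
clear N HN HS.
apply (@noeth_ind T (fun _ => True) (fun N => isolated N -> exists r (w : I r -> T),
  (forall b, exists c, N ((mprod w c)⁻¹ · b)) /\ (forall c, N (mprod w c) -> forall k, c k = 0%Z))); auto.
intros N HS _ IH HN.
destruct (classic (exists y, ~ N y)) as [[y Hy]|Hno].
- destruct (pure_hull_cyclic HN Hy) as (u & Hu & Hcyc).
  assert (HNy : forall x, N x -> pure_hull N y x).
  { intros x Hx; exists 1%Z, 0%Z; split; [lia|]; rewrite zpow_1r; simpl; now grp. }
  destruct (IH (pure_hull N y)) as (r & w & Hw1 & Hw2); auto.
  + now apply pure_hull_sub.
  + exists y; split; auto; exists 1%Z, 1%Z; split; [lia|grp; now apply sub1].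
  + now apply pure_hull_isolated.
  + exists (S r), (ocons u w); split.
    * intros b; destruct (Hw1 b) as [c Hc]; destruct (Hcyc _ Hc) as [j Hj].
      exists (ocons j c); simpl.
      change (N ((zpow u j · mprod w c)⁻¹ · b)); rewrite Tc, (Tc (zpow u j)), invM, Tc, mulA'; auto.
    * intros c; simpl; change (fun k => ocons u w (Some k)) with w; intros Hc.
      assert (E : forall k, c (Some k) = 0%Z).
      { apply Hw2; apply (@subDl T _ (zpow u (c None))); auto.
        - now apply pure_hull_sub.
        - apply sub_zpow; auto; now apply pure_hull_sub. }
      intros [k|]; auto.
      assert (E1 : mprod w (fun k : I r => c (Some k)) = 1).
      { rewrite <- (mprod_zero w); f_equal; extensionality k; auto. }
      change (N (zpow u (c None) · mprod w (fun k : I r => c (Some k)))) in Hc.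
      rewrite E1, g_one_r in Hc.
      destruct (Z.eq_dec (c None) 0) as [E0|E0]; auto; exfalso.
      apply (proj2 HN) in Hc; auto.
      destruct (Hcyc y) as [j Hj]; [exists 1%Z, 1%Z; split; [lia|grp; now apply sub1]|].
      apply Hy; rewrite <- (mulKV (zpow u j) y); apply subM; auto; now apply sub_zpow.
- exists 0, (fun _ => 1); split; [|intros c _ []].
  intros b; exists (fun _ => 0%Z); apply NNPP; intros K; apply Hno; eauto.
Qed.

Lemma exponent (B Q : T -> Prop) : is_subgroup B -> is_subgroup Q ->
  (forall b, B b -> exists k, 1 <= k /\ Q (gpow b k)) ->
  exists m, 1 <= m /\ forall b, B b -> Q (gpow b m).
Proof.
intros HB HQ H; destruct (TN HB (fun _ _ => Logic.I)) as [l Hl].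
assert (E : forall l : list T, (forall b, In b l -> B b) -> exists m, 1 <= m /\ forall b, In b l -> Q (gpow b m)).
{ clear l Hl; induction l as [|a l IH]; intros Hl.
  - exists 1%nat; split; [lia|intros b []].
  - destruct IH as (m & Hm & IH); [intros; apply Hl; now right|].
    destruct (H a) as (k & Hk & Hq); [apply Hl; now left|].
    exists (m * k)%nat; split; [nia|intros b [<-|Hb]].
    + rewrite gpow_mul; now apply sub_gpow.
    + rewrite Nat.mul_comm, gpow_mul; apply sub_gpow; auto. }
destruct (E l) as (m & Hm & Hml); [intros b Hb; apply Hl; now apply gen_incl|].
exists m; split; auto; intros b Hb; apply Hl in Hb; revert b Hb.
apply (@gen_min T _ (fun b => Q (gpow b m))); auto.
apply (@hom_preim T T (fun b => gpow b m)); auto.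
intros a b; apply gpow_mulc, Tc.
Qed.
End Commutative.

(** * Rank counted modulo 2 *)

Fixpoint allb (r : nat) : list (I r -> bool) :=
  match r with
  | 0 => (fun _ => true) :: nil
  | S r => map (ocons true) (allb r) ++ map (ocons false) (allb r)
  end.

Lemma allb_all r (e : I r -> bool) : In e (allb r).
Proof.
induction r as [|r IH]; simpl.
- left; extensionality k; destruct k.
- apply in_or_app; destruct (e None) eqn:E; [left|right]; apply in_map_iff;
    (exists (fun k => e (Some k)); split; [|apply IH]);
    extensionality k; destruct k; simpl; auto.
Qed.
Lemma allb_length r : length (allb r) = 2 ^ r.
Proof. induction r as [|r IH]; simpl; auto; rewrite length_app, !length_map, IH; lia. Qed.
Lemma allb_NoDup r : NoDup (allb r).
Proof.
induction r as [|r IH]; simpl; [constructor; auto; constructor|].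
assert (E : forall (b : bool) (u v : I r -> bool), ocons b u = ocons b v -> u = v).
{ intros b u v K; extensionality k; exact (f_equal (fun h => h (Some k)) K). }
apply NoDup_app; [apply FinFun.Injective_map_NoDup; auto; intros u v; apply E..|].
intros u Hu Hv; apply in_map_iff in Hu, Hv; destruct Hu as (a & <- & _), Hv as (b & K & _).
discriminate (f_equal (fun h => h None) K).
Qed.

Definition bz {r} (e : I r -> bool) (k : I r) : Z := Z.b2z (e k).

Definition basis (T : Group) (N : T -> Prop) r (w : I r -> T) : Prop :=
  (forall b, exists c, N ((mprod w c)⁻¹ · b)) /\ (forall c, N (mprod w c) -> forall k, c k = 0%Z).
(** Unlike integral spanning, spanning modulo squares involves finitely many exponent vectors, hence
    is first-order when [N] is. *)
Definition spans_mod2 (T : Group) (N : T -> Prop) r (w : I r -> T) : Prop :=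
  forall z, exists e, In e (allb r) /\ exists y i, N i /\ z = mprod w (bz e) · (y · y) · i.

Section Rank.
Variables (T : Group) (N : T -> Prop).
Hypotheses (Tc : forall a b : T, a · b = b · a) (HN : is_subgroup N).

Lemma basis_spans r (w : I r -> T) : basis N w -> spans_mod2 N w.
Proof.
intros [Hb _] z; destruct (Hb z) as [c Hc].
exists (fun k => Z.odd (c k)); split; [apply allb_all|].
exists (mprod w (fun k => Z.div2 (c k))), ((mprod w c)⁻¹ · z); split; auto.
rewrite <- !mprod_add by auto.
replace (fun k => (bz (fun k => Z.odd (c k)) k + (Z.div2 (c k) + Z.div2 (c k)))%Z) with c; [now rewrite mulKV|].
extensionality k; unfold bz; rewrite (Z.div2_odd (c k)) at 1; lia.
Qed.

(** A count modulo [N] and squares: the basis gives [2^r'] distinct classes, while [w] represents at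
    most [2^r]. *)
Lemma rank_le r r' (w : I r -> T) (w' : I r' -> T) : basis N w' -> spans_mod2 N w -> r' <= r.
Proof.
intros [Hb Hi] Hw.
assert (E : forall e' : I r' -> bool, exists e : I r -> bool, exists c i, N i /\
   mprod w' (fun k => (bz e' k + - (c k + c k))%Z) = mprod w (bz e) · i).
{ intros e'; destruct (Hw (mprod w' (bz e'))) as (e & _ & y & i & Hi' & E).
  destruct (Hb y) as [c Hc].
  exists e, c, (((mprod w' c)⁻¹ · y) · ((mprod w' c)⁻¹ · y) · i); split.
  - apply subM; auto; apply subM; auto.
  - rewrite (mprod_add Tc w' (bz e')), (mprod_opp Tc w' (fun k => (c k + c k)%Z)), E.
    rewrite (mprod_add Tc w' c), (swap4 Tc), invM.
    set (p := mprod w' c); set (M := mprod w (bz e)).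
    rewrite (Tc _ (p⁻¹ · p⁻¹)), (Tc M (y · y)), (Tc M); now rewrite !mulA', (Tc M). }
apply choice in E; destruct E as [g Hg].
assert (Hinj : FinFun.Injective g).
{ intros u v E; destruct (Hg u) as (c & i & Hi1 & E1), (Hg v) as (c' & i' & Hi2 & E2).
  rewrite <- E in E2.
  assert (K : N (mprod w' (fun k => ((bz u k + - (c k + c k)) + - (bz v k + - (c' k + c' k)))%Z))).
  { rewrite (mprod_add Tc w' (fun k => (bz u k + - (c k + c k))%Z)).
    rewrite (mprod_opp Tc w' (fun k => (bz v k + - (c' k + c' k))%Z)), E1, E2.
    rewrite invM, (Tc _ i), (Tc i'⁻¹), mulA', mulKV; apply subM; auto; now apply subV. }
  extensionality k; specialize (Hi _ K k); cbv beta delta [bz] in Hi.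
  destruct (u k), (v k); auto; cbv [Z.b2z] in Hi; lia. }
apply (Nat.pow_le_mono_r_iff 2); [lia|].
rewrite <- !allb_length, <- (length_map g).
apply NoDup_incl_length; [apply FinFun.Injective_map_NoDup; auto; apply allb_NoDup|].
intros e _; apply allb_all.
Qed.
End Rank.

(** * Regular groups *)

(** The kernels of the iterates stabilize, say at [n]. A kernel element of [eta] is the [n]-th
    iterate of some [b]; then [b] lies in the next kernel, hence in the [n]-th. *)
Lemma noeth_hopf (A : Group) (eta : A -> A) : noeth (fun _ : A => True) -> is_hom eta ->
  (forall b, exists a, eta a = b) -> forall a, eta a = 1 -> a = 1.
Proof.
intros HA He Hs a Ha.
assert (Hi : forall n, is_hom (fun a => Nat.iter n eta a)).
{ induction n as [|n IH]; intros x y; simpl; [auto|]; now rewrite IH, He. }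
assert (Hsn : forall n b, exists a, Nat.iter n eta a = b).
{ induction n as [|n IH]; intros b; simpl; [eauto|].
  destruct (Hs b) as [c <-], (IH c) as [d <-]; eauto. }
destruct (@chain_stab A (fun _ => True) (fun n a => Nat.iter n eta a = 1)) as [n Hn]; auto.
- intros n; apply (hom_preim (Hi n) (sub_triv (X := A))).
- intros n x Hx; simpl; rewrite Hx; now apply hom1.
- destruct (Hsn n a) as [b Hb]; rewrite <- Hb; apply (Hn (S n)); simpl; now rewrite Hb.
Qed.

Lemma derived_comm_group (X A : Group) (f : X -> A) : is_hom f -> (forall a b : A, a · b = b · a) ->
  forall x, derived X x -> f x = 1.
Proof.
intros Hf Ac; apply (@gen_min X _ (fun x => f x = 1)).
- apply (hom_preim Hf (sub_triv (X := A))).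
- intros s (x & y & ->); rewrite (homC Hf); unfold comm; rewrite (Ac (f x) (f y)); grp.
Qed.

(** The isomorphism [theta] is abstract: it need not carry [G0] to the factor [A]. The facts about
    [kap] and [alp] are therefore derived from the definition of an addition. *)
Lemma regular_split (G : Group) : noeth (fun _ : G => True) -> regular G ->
  exists (K A : Group) (kap : K -> G) (alp : A -> G),
    isomorphic G (prod_group K A) /\ is_hom kap /\ is_hom alp /\
    (forall a b : A, a · b = b · a) /\ (forall (a : A) j, 1 <= j -> gpow a j = 1 -> a = 1) /\
    noeth (fun _ : A => True) /\ (forall g, exists k a, g = kap k · alp a) /\
    (forall k a, kap k · alp a = 1 -> k = 1 /\ a = 1) /\ (forall a, center (alp a)) /\
    (forall k, center (kap k) -> IG G (kap k)) /\ (forall g, IG G g -> exists k, g = kap k).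
Proof.
intros NG (G0 & (_ & Hcen & Htriv & Hadd) & K & A & _ & iota & _ & _ & _ & Hio & Hinj & Him & theta & Hth & Tinj & Tsur).
destruct (choice _ Tsur) as [psi Hpsi].
assert (Hpsi' : forall g, psi (theta g) = g) by (intros g; apply Tinj, Hpsi).
assert (Hph : is_hom psi) by (intros p q; apply Tinj; now rewrite Hth, !Hpsi).
set (kap := fun k : K => psi (k, 1 : A)); set (alp := fun a : A => psi (1 : K, a)).
assert (Epsi : forall k a, kap k · alp a = psi (k, a)).
{ intros k a; unfold kap, alp; rewrite <- Hph; f_equal; simpl; unfold pmul; simpl.
  now rewrite g_one_r, g_one_l. }
assert (iota_cen : forall a, center (iota a)) by (intros a; apply Hcen, Him; eauto).
assert (Ac : forall a b : A, a · b = b · a) by (intros a b; apply Hinj; rewrite !Hio; apply iota_cen).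
(* A torsion element of [A] gives a central torsion element of [G0]; this lies in [I(G)], which
   meets [G0] trivially. *)
assert (Af : forall (a : A) j, 1 <= j -> gpow a j = 1 -> a = 1).
{ intros a j Hj E; apply Hinj; rewrite (hom1 Hio); apply Htriv; [apply Him; eauto|].
  split; [exists j; split; auto; rewrite <- (hom_gpow Hio), E, (hom1 Hio)|apply iota_cen].
  apply sub1, gen_subgroup. }
assert (NA : noeth (fun _ : A => True)).
{ apply (@noeth_image G A (fun _ => True) (fun _ => True) (fun x a => x = iota a)); auto.
  - apply subT.
  - intros x y x' y' -> ->; now rewrite Hio.
  - intros x y ->; now rewrite (homV Hio).
  - intros a E; apply Hinj; now rewrite (hom1 Hio).
  - intros a _; eauto. }
assert (Hsnd : @is_hom G A (fun g => snd (theta g))) by (intros x y; now rewrite Hth).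
assert (HIG : forall g, IG G g -> snd (theta g) = 1).
{ intros g [(j & Hj & Hd) _]; apply (Af _ j Hj).
  rewrite <- (hom_gpow Hsnd); now apply (derived_comm_group Hsnd Ac). }
assert (alp_cen : forall a, center (alp a)).
{ intros a y; apply Tinj; unfold alp; rewrite !Hth, Hpsi; destruct (theta y) as [k b].
  simpl; unfold pmul; simpl; now rewrite g_one_l, g_one_r, Ac. }
exists K, A, kap, alp.
split; [now exists theta|].
split; [intros x y; unfold kap; rewrite <- Hph; f_equal; simpl; unfold pmul; simpl; now rewrite g_one_l|].
split; [intros x y; unfold alp; rewrite <- Hph; f_equal; simpl; unfold pmul; simpl; now rewrite g_one_l|].
split; [auto|split; [auto|split; [auto|]]].
split; [intros g; exists (fst (theta g)), (snd (theta g)); rewrite Epsi, <- surjective_pairing; auto|].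
split.
{ intros k a; rewrite Epsi; intros E.
  assert (E' : theta (psi (k, a)) = theta 1) by now rewrite E.
  rewrite Hpsi, (hom1 Hth) in E'; now injection E'. }
split; [auto|split].
- intros k Hk; apply Hadd in Hk; destruct Hk as (g0 & i & H0 & Hi & E).
  apply Him in H0; destruct H0 as [a <-].
  assert (Ea : snd (theta (iota a)) = 1).
  { assert (E1 : snd (theta (kap k)) = 1) by (unfold kap; now rewrite Hpsi).
    rewrite E, Hth in E1; simpl in E1; rewrite (HIG i Hi), g_one_r in E1; exact E1. }
  (* The endomorphism [snd (theta (iota a))] of [A] is onto, because [Z(G) = G0 I(G)] and [theta]
     maps [I(G)] into the factor [K]; being onto, it is injective. *)
  apply (@noeth_hopf A (fun a => snd (theta (iota a))) NA) in Ea.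
  + now rewrite E, Ea, (hom1 Hio), g_one_l.
  + intros u v; now rewrite Hio, Hsnd.
  + intros b; assert (Hb := alp_cen b); apply Hadd in Hb; destruct Hb as (g1 & i' & H1 & Hi' & E').
    apply Him in H1; destruct H1 as [a' <-]; exists a'.
    assert (E1 : snd (theta (alp b)) = b) by (unfold alp; now rewrite Hpsi).
    rewrite E', Hth in E1; simpl in E1; now rewrite (HIG i' Hi'), g_one_r in E1.
- intros g Hg; exists (fst (theta g)); unfold kap; rewrite <- (HIG g Hg), <- surjective_pairing; auto.
Qed.

(** * First-order forms of the derived subgroup and of the rank of the centre *)

Fixpoint DW {X : Group} (w : nat) (z : X) : Prop :=
  match w with 0 => z = 1 | S w => exists a b t, DW w t /\ z = comm a b · t end.

Lemma DW_derived (X : Group) w (z : X) : DW w z -> derived X z.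
Proof.
revert z; induction w as [|w IH]; intros z; simpl.
- intros ->; apply sub1, gen_subgroup.
- intros (a & b & t & Ht & ->); apply subM; [apply gen_subgroup| |apply IH, Ht].
  apply gen_incl; eauto.
Qed.
Lemma comm_prod_DW (X : Group) (l : list X) t : comm_prod (fun _ => True) l t -> DW (length l) t.
Proof.
revert t; induction l as [|x l IH]; intros t; simpl; auto.
intros (g & p & _ & Hp & ->); exists x, g, p; auto.
Qed.
Lemma def_DW w : forall V (t : forall X : Group, (V -> X) -> X), DefT t -> Def (fun X e => DW w (t X e)).
Proof.
induction w as [|w IH]; intros V t Ht; simpl; [ddef|].
apply def_ex, def_ex, def_ex, def_and; [|ddef].
apply (IH _ (fun X e => e None)); dterm.
Qed.
Lemma def_center V (t : forall X : Group, (V -> X) -> X) : DefT t -> Def (fun X e => center (t X e)).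
Proof.
intros Ht; apply (def_iff (P := fun X e => ucs 1 (t X e))); [intros; apply ucs_1|now apply def_ucs].
Qed.
Ltac dspec ::= first
  [ apply (def_DW _ (t := fun X e => _)) | apply (def_center (t := fun X e => _)) | apply (def_ucs _ (t := fun X e => _)) ].

Lemma deft_zpow V (t : forall X : Group, (V -> X) -> X) k : DefT t -> DefT (fun X e => zpow (t X e) k).
Proof.
intros Ht; destruct k; simpl; [apply deft_one|now apply deft_gpow|apply deft_inv; now apply deft_gpow].
Qed.
Lemma deft_mprod V r : forall (s : dfam r V) c, (forall k, DefT (s k)) ->
  DefT (fun X e => mprod (fun k => s k X e) c).
Proof.
induction r as [|r IH]; intros s c Hs; simpl; [apply deft_one|].
apply deft_mul; [apply deft_zpow, Hs|apply (IH (fun k => s (Some k))); intros; apply Hs].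
Qed.

Section Center_rank.
Variables (w m r : nat).
(** [I(X)] appears as the set of central elements whose [m]-th power is a product of [w]
    commutators; [w] and [m] will be chosen so that this is correct in both groups. *)
Definition center_rank (X : Group) : Prop :=
  exists u : I r -> X, (forall k, center (u k)) /\ forall z, center z ->
    exists e, In e (allb r) /\ exists y i, center y /\ (center i /\ DW w (gpow i m)) /\
      z = mprod u (bz e) · (y · y) · i.

Lemma def_center_rank : Def (fun X (_ : Empty_set -> X) => center_rank X).
Proof.
unfold center_rank; ddef; apply (deft_mprod (s := fun k X e => _)); dterm.
Qed.

Lemma center_rank_iff (X : Group) (Q : X -> Prop) :
  (forall i, center i -> (DW w (gpow i m) <-> Q i)) ->
  (center_rank X <-> exists u : I r -> sub_group (center_sub X), spans_mod2 (fun s => Q (sub_val s)) u).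
Proof.
intros HQ; split.
- intros (u & Hu & H); exists (fun k => exist _ (u k) (Hu k)); intros z.
  destruct (H (sub_val z) (sub_valP z)) as (e & He & y & i & Hy & [Hi Hd] & E).
  exists e; split; auto; exists (exist _ y Hy), (exist _ i Hi); split; [now apply HQ|].
  apply sub_val_inj; rewrite E; simpl; f_equal; f_equal.
  symmetry; apply (mprod_hom (@sub_val_hom X _ (center_sub X))).
- intros [u H]; exists (fun k => sub_val (u k)); split; [intros k; apply sub_valP|].
  intros z Hz; destruct (H (exist _ z Hz)) as (e & He & y & i & Hi & E).
  exists e; split; auto; exists (sub_val y), (sub_val i); split; [apply sub_valP|].
  split; [split; [apply sub_valP|apply HQ; auto; apply sub_valP]|].
  apply (f_equal (@sub_val X _ (center_sub X))) in E; simpl in E.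
  change z with (sub_val (exist (@center X) z Hz : sub_group (center_sub X))) at 1.
  unfold sub_val at 1; simpl; rewrite E; f_equal; f_equal.
  apply (mprod_hom (@sub_val_hom X _ (center_sub X))).
Qed.
End Center_rank.

Lemma center_comm (X : Group) (s t : sub_group (center_sub X)) : s · t = t · s.
Proof. apply sub_val_inj; apply (proj2_sig s). Qed.

Section Isolated_center.
Variable X : Group.
Lemma IG_sub : is_subgroup (IG X).
Proof.
assert (HD := gen_subgroup (fun z : X => exists x y : X, z = comm x y)); fold (derived X) in HD.
split; [|split].
- split; [exists 1%nat; split; auto; simpl; rewrite g_one_l; now apply sub1|apply sub1, center_sub].
- intros a b [(k & Hk & Ka) Ca] [(l & Hl & Lb) Cb]; split; [|apply subM; auto; apply center_sub].
  exists (k * l)%nat; split; [nia|]; rewrite gpow_mulc by apply Ca.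
  apply subM; auto; [rewrite Nat.mul_comm|]; rewrite gpow_mul; now apply sub_gpow.
- intros a [(k & Hk & Ka) Ca]; split; [|apply subV; auto; apply center_sub].
  exists k; split; auto; rewrite gpow_inv; now apply subV.
Qed.

Lemma IG_pow (z : X) k : 1 <= k -> center z -> IG X (gpow z k) -> IG X z.
Proof.
intros Hk Hz [(j & Hj & H) _]; split; auto; exists (j * k)%nat; split; [nia|].
now rewrite gpow_mul.
Qed.

Lemma IG_isolated : isolated (fun s : sub_group (center_sub X) => IG X (sub_val s)).
Proof.
split; [apply (hom_preim (@sub_val_hom X _ (center_sub X)) IG_sub)|].
intros b k Hk; rewrite (hom_zpow (@sub_val_hom X _ (center_sub X))); intros H.
apply (@IG_pow _ (Z.to_nat (Z.abs k))); [lia|apply sub_valP|].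
rewrite <- zpow_nat, Z2Nat.id by lia.
destruct (Z.abs_eq_or_opp k) as [->| ->]; auto.
rewrite zpow_opp; apply subV; auto; apply IG_sub.
Qed.
End Isolated_center.

Lemma isomorphic_trans (X Y W : Group) : isomorphic X Y -> isomorphic Y W -> isomorphic X W.
Proof.
intros (f & Hf & Fi & Fs) (g & Hg & Gi & Gs); exists (fun x => g (f x)); split; [|split].
- intros x y; now rewrite Hf, Hg.
- intros x y E; auto.
- intros z; destruct (Gs z) as [y <-], (Fs y) as [x <-]; eauto.
Qed.

Section Torsion.
Variable T : Group.
Hypothesis Tc : forall a b : T, a · b = b · a.
Definition torsion (a : T) : Prop := exists k, 1 <= k /\ gpow a k = 1.

Lemma torsion_isolated : isolated torsion.
Proof.
split; [split; [|split]|].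
- exists 1%nat; split; auto; apply gpow_1.
- intros a b (k & Hk & Ea) (l & Hl & Eb); exists (k * l)%nat; split; [nia|].
  rewrite gpow_mulc by apply Tc; rewrite (gpow_mul b k l), Eb, Nat.mul_comm, gpow_mul, Ea, !gpow_1; grp.
- intros a (k & Hk & Ea); exists k; split; auto; rewrite gpow_inv, Ea; grp.
- intros b k Hk (j & Hj & E); exists (j * Z.to_nat (Z.abs k))%nat; split; [nia|].
  rewrite <- zpow_nat, Nat2Z.inj_mul, Z2Nat.id, zpow_mul, zpow_nat by lia.
  destruct (Z.abs_eq_or_opp k) as [->| ->]; auto.
  rewrite zpow_opp, gpow_inv, E; grp.
Qed.

(* Modulo torsion the group is free of finite rank, and a basis element is not a square. *)
Lemma squares_torsion : noeth (fun _ : T => True) -> (forall a : T, exists b, a = b · b) ->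
  forall a, torsion a.
Proof.
intros TN Hsq; destruct (basis_mod Tc TN torsion_isolated) as ([|r] & w & Hb & Hi).
- intros a; destruct (Hb a) as [c Hc]; simpl in Hc; now grp_in Hc.
- exfalso; destruct (Hsq (w None)) as [b E]; destruct (Hb b) as [c Hc].
  assert (HS := proj1 torsion_isolated).
  set (dl := fun k : I (S r) => match k with None => 1%Z | Some _ => 0%Z end).
  assert (Ed : mprod w dl = w None).
  { transitivity (zpow (w None) 1 · mprod (fun k => w (Some k)) (fun _ : I r => 0%Z)); [reflexivity|].
    rewrite mprod_zero, zpow_1r; grp. }
  assert (K : torsion (mprod w (fun k => ((c k + c k) + - dl k)%Z))).
  { rewrite (mprod_add Tc w (fun k => (c k + c k)%Z)), (mprod_opp Tc w dl), (mprod_add Tc w c), Ed, E.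
    rewrite invM, (swap4 Tc); replace (mprod w c · b⁻¹) with ((mprod w c)⁻¹ · b)⁻¹ by (rewrite invM, invK; apply Tc).
    apply subM; auto; now apply subV. }
  specialize (Hi _ K None); cbv beta iota delta [dl] in Hi; lia.
Qed.
End Torsion.

Lemma derived_sub (X : Group) : is_subgroup (derived X).
Proof. apply gen_subgroup. Qed.

Lemma comm_central_r (X : Group) (a b z : X) : center z -> comm a (b · z) = comm a b.
Proof.
intros Hz; replace (comm a (b · z)) with (comm a z · (z⁻¹ · (comm a b · z))) by grp.
rewrite <- (Hz (comm a b)), mulVK; apply ucs_1 in Hz.
rewrite (Hz a : comm a z = 1); apply g_one_l.
Qed.
Lemma comm_central_l (X : Group) (a b z : X) : center z -> comm (a · z) b = comm a b.
Proof.
intros Hz; replace (comm (a · z) b) with (comm b (a · z))⁻¹ by grp.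
rewrite comm_central_r by auto; grp.
Qed.

(** * Construction of the isomorphism *)

Section Elementarily_equivalent.
Variables (G H : Group).
Hypotheses (GH : elem_equiv G H) (HGn : nilpotent G) (HGr : regular G)
  (HGf : finitely_generated G) (HHf : finitely_generated H).

(** Sentences true in [G] say that the products of [w] commutators are closed under the group
    operations and include all commutators; in [H] they therefore form the derived subgroup. *)
Lemma derived_width w : (forall g, derived G g <-> DW w g) -> forall h, derived H h <-> DW w h.
Proof.
intros HD h; split; [|apply DW_derived].
destruct (@transfer G H (fun X => ((forall a b : X, DW w a -> DW w b -> DW w (a · b)) /\
   (forall a : X, DW w a -> DW w a⁻¹)) /\ forall a b : X, DW w (comm a b)) GH) as [[H1 H2] H3].
- ddef.
- split; [split|]; [intros a b Ha Hb|intros a Ha|intros a b]; apply (proj1 (HD _)).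
  + apply subM; [apply derived_sub|now apply HD|now apply HD].
  + apply subV; [apply derived_sub|now apply HD].
  + apply gen_incl; eauto.
- apply gen_min.
  + split; [|split; auto]; replace (1 : H) with (comm (1 : H) 1) by grp; apply H3.
  + intros s (a & b & ->); apply H3.
Qed.

(** One sentence for each exponent [p]: a bound on the centre of [G] that is uniform in [p] passes
    to [H] one exponent at a time. *)
Lemma transfer_central_pow p (P Q : forall X : Group, X -> Prop) :
  Def (fun X (e : option Empty_set -> X) => P X (e None)) ->
  Def (fun X (e : option Empty_set -> X) => Q X (e None)) ->
  (forall g : G, center g -> P G (gpow g p) -> Q G g) ->
  forall h : H, center h -> P H (gpow h p) -> Q H h.
Proof.
intros HP HQ; apply (@transfer G H (fun X => forall z : X, center z -> P X (gpow z p) -> Q X z) GH).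
apply def_all, def_imp; [ddef|apply def_imp; auto].
apply (@def_sub (option Empty_set) (option Empty_set) (fun X e => P X (e None)) (fun _ X e => gpow (e None) p)); auto; dterm.
Qed.

Theorem regular_elementary_equivalence : isomorphic G H.
Proof.
destruct (nilpotent_ucs HGn) as [c Hc].
assert (HcH : forall h : H, ucs c h).
{ apply (@transfer G H (fun X => forall g : X, ucs c g) GH); auto.
  ddef. }
assert (NG := @fg_noeth G c Hc HGf); assert (NH := @fg_noeth H c HcH HHf).
destruct HGf as [lG HlG]; destruct (list_tuple lG) as (n & x & Hlx).
assert (Hx : forall g, gen (fun y => exists k, y = x k) g).
{ intros g; generalize (HlG g); apply gen_mono; auto. }
set (w := length lG).
assert (DG : forall g, derived G g <-> DW w g).
{ intros g; split; [|apply DW_derived].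
  intros Hg; apply comm_prod_DW, (commutator_width HGn HlG Hg). }
assert (DH := derived_width DG).
destruct (regular_split NG HGr) as (K & A & kap & alp & Giso & Hkap & Halp & Ac & Af & NA & Gdec & Guni &
  alp_cen & kap_IG & IG_kap).
set (TG := sub_group (center_sub G)).
assert (NTG : noeth (fun _ : TG => True)) by (apply sub_group_noeth, (noeth_mono NG); auto).
assert (valG := @sub_val_hom G _ (center_sub G)).
(* The [m]-th powers of elements of [I(G)] lie in the derived subgroup, so that [DW w (gpow i m)]
   will define [I] on the centre of both groups. *)
destruct (@exponent TG (@center_comm G) NTG (fun s => IG G (sub_val s)) (fun s => derived G (sub_val s)))
  as (m & Hm & Em).
{ apply (hom_preim valG (IG_sub G)). }
{ apply (hom_preim valG (derived_sub G)). }
{ intros b [(k & Hk & Hb) _]; exists k; split; auto; now rewrite (hom_gpow valG). }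
assert (EmG : forall i : G, IG G i -> derived G (gpow i m)).
{ intros i Hi; generalize (Em (exist _ i (proj2 Hi)) Hi); now rewrite (hom_gpow valG). }
assert (IGG : forall i : G, center i -> (DW w (gpow i m) <-> IG G i)).
{ intros i Hi; split; [intros Hd; split; auto; exists m; split; auto; now apply (proj2 (DG _))|].
  intros Hi'; apply (proj1 (DG _)), EmG, Hi'. }
assert (IGH : forall i : H, center i -> (DW w (gpow i m) <-> IG H i)).
{ intros i Hi; split; [intros Hd; split; auto; exists m; split; auto; now apply (proj2 (DH _))|].
  intros [(p & Hp & Hip) _]; revert Hi Hip; rewrite DH.
  apply (@transfer_central_pow p (fun X z => DW w z) (fun X z => DW w (gpow z m))).
  - ddef.
  - ddef.
  - intros g Hg Hd; apply IGG; auto; split; auto; exists p; split; auto; now apply (proj2 (DG _)). }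
(* [t] kills the torsion of [Z(G)] and, by transfer, that of [Z(H)]. *)
destruct (@exponent TG (@center_comm G) NTG (@torsion TG) (fun s => s = 1)) as (t & Ht & Et).
{ apply (torsion_isolated (@center_comm G)). }
{ apply sub_triv. }
{ auto. }
assert (EtG : forall p (g : G), 1 <= p -> center g -> gpow g p = 1 -> gpow g t = 1).
{ intros p g Hp Hg E; assert (E' := Et (exist _ g Hg)).
  apply (f_equal (@sub_val G _ (center_sub G))) in E'.
  - now rewrite (hom_gpow valG) in E'.
  - exists p; split; auto; apply sub_val_inj; now rewrite (hom_gpow valG). }
assert (EtH : forall p (h : H), 1 <= p -> center h -> gpow h p = 1 -> gpow h t = 1).
{ intros p h Hp; apply (@transfer_central_pow p (fun X z => z = 1) (fun X z => gpow z t = 1)).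
  - ddef.
  - ddef.
  - intros g; now apply EtG. }
(* If [g] is central, [f g = 1] and [g = y^(2t)] with [y] central, then [f y] is torsion, so that [y^t] is again in
   the kernel and [g] is a square in the central part of the kernel. *)
set (q := (2 * t)%nat).
destruct (fin_mod (center_sub G) (fun a b Ha _ => Ha b) (m := q)) as (LZ & HLZ & EZ);
  [unfold q; lia|apply NG; auto; apply center_sub|].
destruct (fin_mod (IG_sub G) (fun a b Ha _ => proj2 Ha b) Hm) as (LI & HLI & EI);
  [apply NG; auto; apply IG_sub|].
(* [LN] keeps the representatives of [Z(G)] modulo [q]-th powers that are not [q]-th powers of
   central elements; the formula asserts the same of their images. *)
set (notpow := fun a : G => ~ exists z, center z /\ a = gpow z q).
set (LN := filter (fun a => if excluded_middle_informative (notpow a) then true else false) LZ).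
destruct (word_of Hx) as [wd Hwd].
destruct (@central_hom G H c n x Hx) with (P := fun (X : Group) (e : I n -> X) =>
   (forall z, center z -> DW w (gpow z m) -> exists v, In v (map wd LI) /\ exists z',
      (center z' /\ DW w (gpow z' m)) /\ z = wev e v · gpow z' m) /\
   (forall v, In v (map wd LN) -> ~ exists z, center z /\ wev e v = gpow z q))
  as (f & Hf & [P1 P2] & Hfc); auto.
{ intros g; apply (@ucs_le G c); auto; lia. }
{ intros g; apply (@ucs_le H c); auto; lia. }
{ ddef. }
{ split.
  - intros z Hz Hd; destruct (EI z) as (a & z' & Ha & Hz' & E); [now apply IGG|].
    exists (wd a); split; [now apply in_map|]; exists z'; rewrite Hwd.
    split; auto; split; [apply Hz'|apply IGG; auto; apply Hz'].
  - intros v Hv; apply in_map_iff in Hv; destruct Hv as (a & <- & Ha); rewrite Hwd.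
    apply filter_In in Ha; destruct Ha as [_ Ha].
    destruct (excluded_middle_informative (notpow a)); [auto|discriminate]. }
assert (Ew : forall v, wev (fun k => f (x k)) v = f (wev x v)) by (intros v; symmetry; apply (wev_hom Hf)).
assert (fcen : forall g, center g -> center (f g)).
{ intros g Hg y; destruct (Hfc y) as (g' & z & Hz & ->).
  rewrite g_assoc, <- Hf, (Hg g'), Hf, !mulA'; f_equal; symmetry; apply Hz. }
assert (fder : forall y, derived H y -> exists g, derived G g /\ y = f g).
{ apply (@gen_min H _ (fun y => exists g, derived G g /\ y = f g)).
  - assert (HS := derived_sub G); split; [|split].
    + exists 1; split; [now apply sub1|now rewrite (hom1 Hf)].
    + intros a b (g & Hg & ->) (g' & Hg' & ->); exists (g · g'); split; [now apply subM|now rewrite Hf].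
    + intros a (g & Hg & ->); exists g⁻¹; split; [now apply subV|now rewrite (homV Hf)].
  - intros s (a & b & ->); destruct (Hfc a) as (g & z & Hz & ->), (Hfc b) as (g' & z' & Hz' & ->).
    exists (comm g g'); split; [apply gen_incl; eauto|].
    now rewrite (homC Hf), comm_central_l, comm_central_r. }
assert (fder' : forall g, derived G g -> derived H (f g)).
{ apply (@gen_min G _ (fun g => derived H (f g))); [apply (hom_preim Hf (derived_sub H))|].
  intros s (a & b & ->); rewrite (homC Hf); apply gen_incl; eauto. }
assert (injZ : forall g, center g -> f g = 1 -> g = 1).
{ assert (Hroot : forall g, center g -> f g = 1 -> exists y, center y /\ g = gpow y q).
  { intros g Hg E; destruct (EZ g Hg) as (a & b & Ha & Hb & Eg).
    destruct (classic (exists z, center z /\ a = gpow z q)) as [(z & Hz & Ez)|Hno].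
    - exists (z · b); split; [apply subM; auto; apply center_sub|].
      rewrite gpow_mulc by apply Hz; congruence.
    (* Here [g = a b^q], so [f g = 1] makes [f a] the [q]-th power of the inverse of [f b], which
       [P2] excludes. *)
    - exfalso; apply (P2 (wd a)).
      + apply in_map, filter_In; split; auto.
        destruct (excluded_middle_informative (notpow a)); auto.
      + exists (f b)⁻¹; split; [apply subV; [apply center_sub|now apply fcen]|].
        rewrite Ew, Hwd, gpow_inv, <- (hom_gpow Hf); apply inv_unique.
        now rewrite <- Hf, <- (HLZ a Ha (gpow b q)), <- Eg. }
  set (D := fun g => center g /\ f g = 1).
  assert (HD : is_subgroup D).
  { apply subI; [apply center_sub|apply (hom_preim Hf (sub_triv (X := H)))]. }
  assert (Tor : forall s : sub_group HD, torsion s).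
  { apply squares_torsion.
    - intros s u; apply sub_val_inj, (proj2_sig s).
    - apply sub_group_noeth, (noeth_mono NG); auto.
    - intros s; destruct (sub_valP s) as [Hs Es]; destruct (Hroot _ Hs Es) as (y & Hy & E).
      assert (Dy : D (gpow y t)).
      { split; [apply sub_gpow; auto; apply center_sub|]; rewrite (hom_gpow Hf).
        apply (@EtH q); [unfold q; lia|now apply fcen|]; now rewrite <- (hom_gpow Hf), <- E. }
      exists (exist _ _ Dy); apply sub_val_inj; rewrite E; unfold q; simpl.
      now rewrite Nat.add_0_r, gpow_add. }
  (* The central part of the kernel is torsion, so [y] is torsion and [y^t = 1]; then [g = y^q] is
     trivial because [t] divides [q]. *)
  intros g Hg Eg; destruct (Hroot g Hg Eg) as (y & Hy & E).
  destruct (Tor (exist _ g (conj Hg Eg))) as (k & Hk & Ek).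
  apply (f_equal (@sub_val G _ HD)) in Ek; rewrite (hom_gpow (@sub_val_hom G _ HD)) in Ek.
  change (gpow g k = 1) in Ek.
  rewrite E; unfold q; rewrite gpow_mul, (EtG (k * q)%nat), gpow_1; auto; [unfold q; nia|].
  rewrite gpow_mul, <- E; exact Ek. }
(* A nontrivial kernel would meet the centre: commutators with a kernel element stay in the kernel
   and lie one step lower in the upper central series. *)
assert (inj : forall g, f g = 1 -> g = 1).
{ assert (E : forall i g, ucs i g -> f g = 1 -> g = 1).
  { induction i as [|i IH]; intros g Hg Eg; [exact Hg|].
    apply injZ; auto; apply ucs_1; intros y; apply IH; [apply Hg|].
    rewrite (homC Hf), Eg; grp. }
  intros g; apply (E c); auto. }
(* By [P1], [z] is [f a] times the [m]-th power of an element of [I(H)]; this power lies in the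
   derived subgroup of [H], which is the image of that of [G]. *)
assert (IGf : forall z, IG H z -> exists k, z = f (kap k)).
{ intros z Hz; destruct (P1 z (proj2 Hz)) as (v & Hv & z' & [Cz' Dz'] & E); [apply IGH; auto; apply Hz|].
  apply in_map_iff in Hv; destruct Hv as (a & <- & Ha); rewrite Ew, Hwd in E.
  destruct (fder (gpow z' m)) as (g & Hg & Eg); [now apply (proj2 (DH _))|].
  assert (Cg : center g).
  { apply ucs_1; intros y; apply inj; rewrite (homC Hf), <- Eg.
    assert (C : center (gpow z' m)) by (apply sub_gpow; auto; apply center_sub).
    apply ucs_1 in C; apply C. }
  destruct (IG_kap (a · g)) as [k Ek].
  - apply subM; auto; [apply IG_sub|]; split; auto; exists 1%nat; split; auto; simpl; now rewrite g_one_r.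
  - exists k; rewrite <- Ek, Hf, <- Eg; exact E. }
(* [A] is torsion-free, hence free on [wA]; below, [wH] is a basis of [Z(H)] modulo [I(H)] and
   generates the complement [W]. *)
destruct (basis_mod Ac NA (N := fun a => a = 1)) as (r & wA & HbA & HiA).
{ split; [apply sub_triv|]; intros b k Hk E; apply (@Af b (Z.to_nat (Z.abs k))); [lia|].
  rewrite <- zpow_nat, Z2Nat.id by lia.
  destruct (Z.abs_eq_or_opp k) as [->| ->]; auto; rewrite zpow_opp, E; grp. }
set (TH := sub_group (center_sub H)).
assert (NTH : noeth (fun _ : TH => True)) by (apply sub_group_noeth, (noeth_mono NH); auto).
destruct (basis_mod (@center_comm H) NTH (IG_isolated H)) as (r' & wH & HbH & HiH).
(* This identifies the rank of [A] with that of [Z(G)] modulo [I(G)], which [center_rank]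
   measures. *)
assert (BG : basis (fun s : TG => IG G (sub_val s)) (fun k => exist _ (alp (wA k)) (alp_cen (wA k)) : TG)).
{ assert (Ev : forall c, sub_val (mprod (fun k => exist _ (alp (wA k)) (alp_cen (wA k)) : TG) c) = alp (mprod wA c)).
  { intros e; rewrite (mprod_hom valG), (mprod_hom Halp); reflexivity. }
  split.
  - intros s; destruct (Gdec (sub_val s)) as (k & a & E); destruct (HbA a) as [e He]; exists e.
    assert (Ea : a = mprod wA e) by (now apply eq_of_div).
    rewrite valG, (homV valG), Ev, <- Ea, E.
    replace ((alp a)⁻¹ · (kap k · alp a)) with (kap k) by (rewrite <- (alp_cen a), mulVK; auto).
    apply kap_IG; replace (kap k) with (sub_val s · (alp a)⁻¹) by (rewrite E; grp).
    apply subM; [apply center_sub|apply sub_valP|apply subV; auto; apply center_sub].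
  - intros e; rewrite Ev; intros He; apply HiA.
    destruct (IG_kap _ He) as [k Ek]; apply (Guni k⁻¹).
    rewrite (homV Hkap), <- Ek; grp. }
assert (BH : basis (fun s : TH => IG H (sub_val s)) wH) by (split; auto).
assert (Er : r' = r).
{ apply Nat.le_antisymm.
  - assert (R : center_rank w m r H).
    { apply (@transfer G H (center_rank w m r) GH); [apply def_center_rank|].
      apply (center_rank_iff r IGG); eexists; apply (basis_spans (@center_comm G) BG). }
    apply (center_rank_iff r IGH) in R; destruct R as [u Hu].
    apply (rank_le (@center_comm H) (proj1 (IG_isolated H)) BH Hu).
  - assert (R : center_rank w m r' G).
    { apply (@transfer H G (center_rank w m r')).
      - intros phi Hphi; symmetry; now apply GH.
      - apply def_center_rank.
      - apply (center_rank_iff r' IGH); eexists; apply (basis_spans (@center_comm H) BH). }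
    apply (center_rank_iff r' IGG) in R; destruct R as [u Hu].
    apply (rank_le (@center_comm G) (proj1 (IG_isolated G)) BG Hu). }
subst r'.
apply (isomorphic_trans Giso).
destruct (choice _ HbA) as [co Hco].
assert (Eco : forall a, a = mprod wA (co a)) by (intros a; now apply eq_of_div).
assert (co_mul : forall a b, co (a · b) = fun k => (co a k + co b k)%Z).
{ intros a b; extensionality k.
  enough (E : (co (a · b) k + - (co a k + co b k) = 0)%Z) by lia.
  apply (HiA (fun k => (co (a · b) k + - (co a k + co b k))%Z)).
  rewrite (mprod_add Ac wA (co (a · b))), (mprod_opp Ac wA (fun k => (co a k + co b k)%Z)).
  rewrite (mprod_add Ac wA (co a)), <- !Eco; grp. }
assert (co_surj : forall e, co (mprod wA e) = e).
{ intros e; extensionality k.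
  enough (E : (co (mprod wA e) k + - e k = 0)%Z) by lia.
  apply (HiA (fun k => (co (mprod wA e) k + - e k)%Z)).
  rewrite (mprod_add Ac wA (co (mprod wA e))), (mprod_opp Ac wA e), <- Eco; grp. }
(* On [A] the map [f] is replaced by the one that matches the two bases, since [f] need not carry
   [alp] onto a complement of [I(H)]. *)
set (beta := fun a : A => (sub_val (mprod wH (co a)) : H)).
assert (beta_cen : forall a, center (beta a)) by (intros a; apply sub_valP).
assert (beta_hom : is_hom beta).
{ intros a b; unfold beta; rewrite co_mul, (mprod_add (@center_comm H) wH (co a)); reflexivity. }
set (Psi := fun p : prod_group K A => f (kap (fst p)) · beta (snd p)).
assert (HPsi : is_hom Psi).
{ intros [k a] [k' a']; unfold Psi; simpl; rewrite Hkap, Hf, beta_hom, !mulA'; f_equal.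
  rewrite <- !mulA'; f_equal; symmetry; apply beta_cen. }
exists Psi; split; [auto|split].
(* [beta a] is central and equals [f (kap k⁻¹)]. By injectivity [kap k⁻¹] is central, hence in
   [I(G)]; so [beta a] lies in [I(H)] and its coordinates vanish. *)
- apply (hom_inj HPsi); intros [k a] E; unfold Psi in E; simpl in E.
  assert (Eb : beta a = f (kap k⁻¹)) by (rewrite (homV Hkap), (homV Hf); now apply inv_unique).
  assert (Ck : center (kap k⁻¹)).
  { apply ucs_1; intros y; apply inj; rewrite (homC Hf), <- Eb.
    assert (C := beta_cen a); apply ucs_1 in C; apply C. }
  assert (Eca : forall j, co a j = 0%Z).
  { apply HiH; change (IG H (beta a)); rewrite Eb.
    destruct (kap_IG _ Ck) as [(j & Hj & Hd) _]; split; [|now apply fcen].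
    exists j; split; auto; rewrite <- (hom_gpow Hf); auto. }
  assert (Ea : a = 1).
  { rewrite (Eco a), <- (mprod_zero wA); f_equal; extensionality j; auto. }
  assert (Ek : k = 1).
  { subst a; rewrite (hom1 beta_hom), g_one_r in E; apply inj in E.
    apply (Guni k 1); rewrite E, (hom1 Halp); grp. }
  now subst.
(* The central factor [f (alp a) · z] is an element of [W] times one of [I(H)], and the latter is
   some [f (kap k')]. *)
- intros y; destruct (Hfc y) as (g & z & Hz & ->); destruct (Gdec g) as (k & a & ->).
  assert (Cz : center (f (alp a) · z)) by (apply subM; auto; apply center_sub).
  destruct (HbH (exist _ _ Cz)) as [e He].
  destruct (IGf _ He) as [k' Ek'].
  exists (k · k', mprod wA e); unfold Psi, beta; simpl; rewrite co_surj, Hkap, !Hf, <- Ek'.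
  assert (Cm : center (sub_val (mprod wH e))) by apply sub_valP.
  rewrite (@sub_val_hom H _ (center_sub H)), (homV (@sub_val_hom H _ (center_sub H))).
  set (M := sub_val (mprod wH e)) in *; change (sub_val (exist _ _ Cz)) with (f (alp a) · z).
  rewrite !mulA'; f_equal; rewrite <- (mulA' (f (alp a)) z M), <- (Cm (f (alp a) · z)), mulVK; auto.
Qed.
End Elementarily_equivalent.

Theorem mainTheorem4 (G H : Group) :
  finitely_generated G -> nilpotent G -> regular G ->
  finitely_generated H -> elem_equiv G H -> isomorphic G H.
Proof. intros; now apply regular_elementary_equivalence. Qed.
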